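(* Let $M_{|a,b|}$ be an indecomposable in $\mathrm{rep}_k(A_{\mathbb R})$ such that (i) $M_{|a,b|}$ is not projective; (ii) $M_{|a,b|}$ is not injective; and (iii) $M_{|a,b|}$ is neither simple nor has support of the form $[s_n,s_{n+1}]$, where $s_n$ and $s_{n+1}$ are an adjacent sink and source. Then there exists a unique Auslander-Reiten sequence in $\mathrm{rep}_k(A_{\mathbb R})$ of one of the 16 types (1)--(16) containing $M_{|a,b|}$; that is, an Auslander-Reiten sequence $0\to U\hookrightarrow V\twoheadrightarrow W\to 0$ in $\mathrm{rep}_k(A_{\mathbb R})$ such that $M_{|a,b|}\cong U$, or $M_{|a,b|}\cong W$, or there exists $M_{|c,d|}$ such that $V\cong M_{|a,b|}\oplus M_{|c,d|}$. If $M_{|a,b|}$ does not satisfy conditions (i)--(iii), then it does not belong to any Auslander-Reiten sequence.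
   Context: Fix a field $k$. A quiver of continuous type $A$ is a triple $A_{\mathbb R}=(\mathbb R,S,\preceq)$: $S\subset\mathbb R$ is a discrete (possibly empty) subset without accumulation points; $\bar S=S\cup\{\pm\infty\}$ with $-\infty<s<+\infty$ for $s\in S$; the elements of $\bar S$ are indexed in increasing order by a convex subset of $\mathbb Z\cup\{\pm\infty\}$ containing $0$, $s_n$ being the element of index $n$; $\preceq$ is the partial order on $\mathbb R$ for which two points are comparable only if they lie in a common closed interval between consecutive elements of $\bar S$, on each such interval $\preceq$ is $\le$ or its reverse, the direction reverses at each element of $S$, and $s_n$ is a sink ($\preceq$-minimal) if $n$ is even and a source ($\preceq$-maximal) if $n$ is odd. (An infinite $s_n$ with $n\in\mathbb Z$ is also called a sink or source according to the parity of $n$.) A representation $V$ assigns a $k$-vector space $V(x)$ to each $x\in\mathbb R$ and a linear map $V(x,y):V(x)\to V(y)$ to each $y\preceq x$, with $V(x,z)=V(y,z)\circ V(x,y)$ for $z\preceq y\preceq x$. For an interval $I$, $M_I$ is the representation with $M_I(x)=k$ for $x\in I$ and $0$ otherwise, and identity maps between comparable points of $I$. $|a,b|$ denotes an interval with endpoints $a,b$ (possibly infinite) with unspecified inclusion of endpoints; a bracket at an infinite endpoint is read as open. The indecomposable projectives are $P_a,P_{a)},P_{(a}$, the interval representations with supports $\{x\preceq a\}$, $\{x\preceq a,\ x<a\}$, $\{x\preceq a,\ x>a\}$ (when nonempty; also $P_{\pm\infty}$ when $\pm\infty$ is a source with finite index, with support the interval between $\pm\infty$ and the adjacent sink, sink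 included if finite); injectives $I_a,I_{a)},I_{(a}$ are dual, with $a\preceq x$ in place of $x\preceq a$. $\mathrm{rep}_k(A_{\mathbb R})$ is the category of pointwise finite-dimensional representations that are quotients of finite direct sums of indecomposable projectives. It is abelian and Krull-Schmidt, and its indecomposables are, up to isomorphism, representations $M_I$. A short exact sequence $0\to N\xrightarrow{f}E\xrightarrow{g}M\to0$ is an Auslander-Reiten (almost split) sequence if $f$ is not a section, $g$ is not a retraction, $N$ and $M$ are indecomposable, every nontrivial morphism $N\to X$ with $X$ indecomposable, $X\not\cong N$, factors through $f$, and every nontrivial morphism $X\to M$ with $X$ indecomposable, $X\not\cong M$, factors through $g$. The 16 types. For $a\in\mathbb R\setminus S$ let $s_a$ denote the sink among the two consecutive elements of $\bar S$ surrounding $a$. In each type the monomorphism is $\begin{bmatrix}1\\1\end{bmatrix}$ and the epimorphism is $\begin{bmatrix}1&-1\end{bmatrix}$. Types (1)--(4), $a<b$, $a,b\notin\bar S$: (1) $s_a<a,\ s_b<b$: $M_{[a,b)}\hookrightarrow M_{[a,b]}\oplus M_{(a,b)}\twoheadrightarrow M_{(a,b]}$; (2) $s_a<a,\ s_b>b$: $M_{[a,b]}\hookrightarrow M_{[a,b)}\oplus M_{(a,b]}\twoheadrightarrow M_{(a,b)}$; (3) $s_a>a,\ s_b<b$: $M_{(a,b)}\hookrightarrow M_{(a,b]}\oplus M_{[a,b)}\twoheadrightarrow M_{[a,b]}$; (4) $s_a>a,\ s_b>b$: $M_{(a,b]}\hookrightarrow M_{(a,b)}\oplus M_{[a,b]}\twoheadrightarrow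 M_{[a,b)}$. Types (5),(6), $s_{2n-1}<s_{2n}<b$, $b\notin \bar S$: (5) $s_b<b$: $M_{[s_{2n-1},b)}\hookrightarrow M_{[s_{2n-1},b]}\oplus M_{(s_{2n},b)}\twoheadrightarrow M_{(s_{2n},b]}$; (6) $s_b>b$: $M_{[s_{2n-1},b]}\hookrightarrow M_{[s_{2n-1},b)}\oplus M_{(s_{2n},b]}\twoheadrightarrow M_{(s_{2n},b)}$. Types (7),(8), $s_{2n}<s_{2n+1}<b$, $b\notin\bar S$: (7) $s_b<b$: $M_{(s_{2n+1},b)}\hookrightarrow M_{(s_{2n+1},b]}\oplus M_{[s_{2n},b)}\twoheadrightarrow M_{[s_{2n},b]}$; (8) $s_b>b$: $M_{(s_{2n+1},b]}\hookrightarrow M_{(s_{2n+1},b)}\oplus M_{[s_{2n},b]}\twoheadrightarrow M_{[s_{2n},b)}$. Types (9),(10), $a<s_{2n}<s_{2n+1}$, $a\notin\bar S$: (9) $s_a<a$: $M_{[a,s_{2n+1}]}\hookrightarrow M_{[a,s_{2n})}\oplus M_{(a,s_{2n+1}]}\twoheadrightarrow M_{(a,s_{2n})}$; (10) $s_a>a$: $M_{(a,s_{2n+1}]}\hookrightarrow M_{(a,s_{2n})}\oplus M_{[a,s_{2n+1}]}\twoheadrightarrow M_{[a,s_{2n})}$. Types (11),(12), $a<s_{2n-1}<s_{2n}$, $a\notin\bar S$: (11) $s_a<a$: $M_{[a,s_{2n-1})}\hookrightarrow M_{[a,s_{2n}]}\oplus M_{(a,s_{2n-1})}\twoheadrightarrow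 M_{(a,s_{2n}]}$; (12) $s_a>a$: $M_{(a,s_{2n-1})}\hookrightarrow M_{(a,s_{2n}]}\oplus M_{[a,s_{2n-1})}\twoheadrightarrow M_{[a,s_{2n}]}$. Types (13)--(16): (13) $s_{2m}<s_{2m+1}<s_{2n}<s_{2n+1}$: $M_{(s_{2m+1},s_{2n+1}]}\hookrightarrow M_{(s_{2m+1},s_{2n})}\oplus M_{[s_{2m},s_{2n+1}]}\twoheadrightarrow M_{[s_{2m},s_{2n})}$; (14) $s_{2m-1}<s_{2m}<s_{2n}<s_{2n+1}$: $M_{[s_{2m-1},s_{2n+1}]}\hookrightarrow M_{[s_{2m-1},s_{2n})}\oplus M_{(s_{2m},s_{2n+1}]}\twoheadrightarrow M_{(s_{2m},s_{2n})}$; (15) $s_{2m}<s_{2m+1}<s_{2n-1}<s_{2n}$: $M_{(s_{2m+1},s_{2n-1})}\hookrightarrow M_{(s_{2m+1},s_{2n}]}\oplus M_{[s_{2m},s_{2n-1})}\twoheadrightarrow M_{[s_{2m},s_{2n}]}$; (16) $s_{2m-1}<s_{2m}<s_{2n-1}<s_{2n}$: $M_{[s_{2m-1},s_{2n-1})}\hookrightarrow M_{[s_{2m-1},s_{2n}]}\oplus M_{(s_{2m},s_{2n-1})}\twoheadrightarrow M_{(s_{2m},s_{2n}]}$. *)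

(* Defs.v *)
From HB Require Import structures.
From mathcomp Require Import all_boot all_order all_algebra.
From mathcomp Require Import all_classical all_reals all_analysis.

Set Implicit Arguments.
Unset Strict Implicit.
Unset Printing Implicit Defensive.

Import Order.TTheory GRing.Theory Num.Theory.
Import numFieldNormedType.Exports.

Local Open Scope classical_set_scope.
Local Open Scope ring_scope.

(* A set of reals without limit points in R is automatically discrete.  The
   elements of S and -oo, +oo are indexed by [cA_idx]; the infinite indices
   occur exactly when S is unbounded on the corresponding side.  The values of
   [cA_pt] outside [cA_idx] are never used. *)
Record contA (R : realType) := ContA {
  cA_S : set R;
  cA_idx : set (\bar int);
  cA_pt : \bar int -> \bar R;
  cA_no_acc : limit_point cA_S = set0;
  cA_idx_convex : forall i j m : \bar int,
    cA_idx i -> cA_idx j -> (i <= m)%O -> (m <= j)%O -> cA_idx m;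
  cA_idx0 : cA_idx 0%:E;
  cA_pt_incr : forall i j : \bar int,
    cA_idx i -> cA_idx j -> (i < j)%O -> (cA_pt i < cA_pt j)%O;
  cA_pt_image : cA_pt @` cA_idx = (EFin @` cA_S) `|` [set -oo%E; +oo%E]
}.

Definition has_idx (R : realType) (A : contA R) (n : int) : Prop :=
  cA_idx A n%:E.

Definition pt (R : realType) (A : contA R) (n : int) : \bar R :=
  cA_pt A n%:E.

Definition evenz (n : int) : bool := ~~ odd `|n|%N.

(* [qle A x y] is x \preceq y.  On [s_n, s_(n+1)] with n even, s_n is a sink
   (minimal), so that \preceq is <= there; with n odd it is >=. *)
Definition qle (R : realType) (A : contA R) (x y : R) : Prop :=
  exists n : int,
    [/\ has_idx A n, has_idx A (n + 1),
        (pt A n <= x%:E <= pt A (n + 1))%E,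
        (pt A n <= y%:E <= pt A (n + 1))%E
      & if evenz n then x <= y else y <= x].

Section Order.
Variables (R : realType) (A : contA R).

Lemma pt_leW (m n : int) : has_idx A m -> has_idx A n -> (m <= n)%R ->
  (pt A m <= pt A n)%E.
Proof.
move=> hm hn; rewrite le_eqVlt => /predU1P[->//|mn].
by apply: ltW; apply: cA_pt_incr => //; rewrite lte_fin.
Qed.

Lemma pt_ltW (m n : int) : has_idx A m -> has_idx A n ->
  (pt A m < pt A n)%E -> (m < n)%R.
Proof.
move=> hm hn mn; rewrite ltNge; apply/negP => nm.
by move: mn; rewrite ltNge pt_leW.
Qed.

Lemma qle_between (x y z : R) : qle A z y -> qle A y x ->
  (z <= y <= x) || (x <= y <= z).
Proof.
move=> [n [hn hn1 /andP[zl zu] /andP[yl yu] en]].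
move=> [m [hm hm1 /andP[yl' yu'] /andP[xl xu] em]].
case: (ltP z y) => zy; last first.
  case: (eqVneq z y) => [->|nzy].
    by rewrite lexx /= andbT le_total.
  have lzy : y < z by rewrite lt_neqAle eq_sym nzy.
  have odn : ~~ evenz n.
    by move: en; case: (evenz n) => //; rewrite leNgt lzy.
  case: (leP x y) => xy; first by rewrite /= orbT.
  have evm : evenz m.
    by move: em; case: (evenz m) => //; rewrite leNgt xy.
  have h1 : (n < m + 1)%R.
    apply: pt_ltW => //; apply: le_lt_trans yl _.
    by apply: lt_le_trans xu; rewrite lte_fin.
  have h2 : (m < n + 1)%R.
    apply: pt_ltW => //; apply: le_lt_trans yl' _.
    by apply: lt_le_trans zu; rewrite lte_fin.
  have mn : m = n by apply/eqP; rewrite eq_le -!ltzD1 h1 h2.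
  by move: odn; rewrite -mn evm.
case: (leP y x) => yx; first by rewrite (ltW zy).
have evn : evenz n.
  by move: en; case: (evenz n) => //; rewrite leNgt zy.
have odm : ~~ evenz m.
  by move: em; case: (evenz m) => //; rewrite leNgt yx.
have h1 : (n < m + 1)%R.
  apply: pt_ltW => //; apply: le_lt_trans zl _.
  by apply: lt_le_trans yu'; rewrite lte_fin.
have h2 : (m < n + 1)%R.
  apply: pt_ltW => //; apply: le_lt_trans xl _.
  by apply: lt_le_trans yu; rewrite lte_fin.
have mn : m = n by apply/eqP; rewrite eq_le -!ltzD1 h1 h2.
by move: odm; rewrite mn evn.
Qed.

End Order.

(* Pointwise finite-dimensional representations.  [rmap V x y] is only
   meaningful for y \preceq x; its values at other pairs are never used. *)
Record rep (k : fieldType) (R : realType) (A : contA R) := Rep {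
  rsp :> R -> vectType k;
  rmap : forall x y : R, 'Hom(rsp x, rsp y);
  rmap_id : forall (x : R) (v : rsp x), rmap x x v = v;
  rmap_comp : forall x y z : R, qle A y x -> qle A z y ->
    forall v : rsp x, rmap x z v = rmap y z (rmap x y v)
}.

Definition fam (k : fieldType) (R : realType) (A : contA R) (V W : rep k A) :=
  forall x : R, 'Hom(V x, W x).

Section Reps.
Variables (k : fieldType) (R : realType) (A : contA R).
Implicit Types (U V W X : rep k A) (I J : interval R).

Definition is_mor V W (f : fam V W) : Prop :=
  forall x y, qle A y x -> forall v : V x, f y (rmap V x y v) = rmap W x y (f x v).

Definition is_mono V W (f : fam V W) : Prop := forall x, injective (f x).
Definition is_epi V W (f : fam V W) : Prop :=
  forall x (w : W x), exists v, f x v = w.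

Definition is_iso V W (f : fam V W) : Prop :=
  is_mor f /\ exists g : fam W V,
    is_mor g /\ forall x, cancel (f x) (g x) /\ cancel (g x) (f x).

Definition iso V W : Prop := exists f : fam V W, is_iso f.

Definition is_zero V : Prop := forall x (v : V x), v = 0.

Lemma rzero_id (x : R) (v : 'rV[k]_0) : (0 : 'Hom('rV[k]_0, 'rV[k]_0)) v = v.
Proof. by rewrite (thinmx0 v) linear0. Qed.

Lemma rzero_comp (x y z : R) : qle A y x -> qle A z y -> forall v : 'rV[k]_0,
  (0 : 'Hom('rV[k]_0, 'rV[k]_0)) v
  = (0 : 'Hom('rV[k]_0, 'rV[k]_0)) ((0 : 'Hom('rV[k]_0, 'rV[k]_0)) v).
Proof. by move=> _ _ v; rewrite (thinmx0 v) !linear0. Qed.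

Definition rzero : rep k A :=
  @Rep k R A (fun=> 'rV[k]_0) (fun _ _ => 0) rzero_id rzero_comp.

Section Sum.
Variables V W : rep k A.

Definition sum_fun (x y : R) (v : (V x * W x)%type) : (V y * W y)%type :=
  (rmap V x y v.1, rmap W x y v.2).

Lemma sum_fun_linear x y : linear (@sum_fun x y).
Proof. by move=> a u v; rewrite /sum_fun /= !linearP. Qed.

HB.instance Definition _ x y :=
  GRing.isLinear.Build k (V x * W x)%type (V y * W y)%type *:%R
    (@sum_fun x y) (@sum_fun_linear x y).

Lemma rsum_id (x : R) (v : (V x * W x)%type) : linfun (@sum_fun x x) v = v.
Proof. by rewrite lfunE /= /sum_fun !rmap_id; case: v. Qed.

Lemma rsum_comp (x y z : R) : qle A y x -> qle A z y ->
  forall v : (V x * W x)%type,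
  linfun (@sum_fun x z) v = linfun (@sum_fun y z) (linfun (@sum_fun x y) v).
Proof.
move=> yx zy v; rewrite !lfunE /= /sum_fun /=.
by rewrite (rmap_comp yx zy) (rmap_comp yx zy).
Qed.

Definition rsum : rep k A :=
  @Rep k R A (fun x => (V x * W x)%type) (fun x y => linfun (@sum_fun x y))
    rsum_id rsum_comp.
End Sum.

(* The dimensions are booleans coerced to nat, i.e. k^1 or k^0; the all-ones
   matrix is the identity when both are 1 and an empty matrix otherwise. *)
Definition can_map I J (x y : R) :
    'Hom('rV[k]_(x \in I), 'rV[k]_(y \in J)) :=
  linfun (mulmxr (const_mx 1 : 'M[k]_(x \in I, y \in J))).

Lemma const_mx1_bool (b : bool) : const_mx 1 = 1%:M :> 'M[k]_b.
Proof.
apply/matrixP; case: b => -[i hi] [j hj] //; rewrite !mxE.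
by case: i j hi hj => [|//] [|//].
Qed.

Lemma can_map_id I (x : R) (v : 'rV[k]_(x \in I)) : can_map I I x x v = v.
Proof. by rewrite lfunE /= const_mx1_bool mulmx1. Qed.

Lemma can_map_comp I (x y z : R) : qle A y x -> qle A z y ->
  forall v : 'rV[k]_(x \in I),
  can_map I I x z v = can_map I I y z (can_map I I x y v).
Proof.
move=> yx zy v; rewrite !lfunE /= -mulmxA; congr (_ *m _).
have conv : x \in I -> z \in I -> y \in I.
  move=> xI zI; have /orP[h|h] := qle_between zy yx.
    exact: (@interval_is_interval _ I z x).
  exact: (@interval_is_interval _ I x z).
apply/matrixP => i j; rewrite !mxE.
under eq_bigr do rewrite !mxE mulr1.
have xI : x \in I by case: (x \in I) i => // -[].
have zI : z \in I by case: (z \in I) j => // -[].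
by rewrite sumr_const card_ord (conv xI zI).
Qed.

Definition M I : rep k A :=
  @Rep k R A (fun x => 'rV[k]_(x \in I)) (can_map I I)
    (@can_map_id I) (@can_map_comp I).

Definition nonempty I : Prop := exists x : R, x \in I.

Inductive proj_supp : set R -> Prop :=
| ProjPt (a : R) : proj_supp [set x | qle A x a]
| ProjLt (a : R) : proj_supp [set x | qle A x a /\ x < a]
| ProjGt (a : R) : proj_supp [set x | qle A x a /\ a < x]
| ProjNy (n : int) : has_idx A n -> ~~ evenz n -> pt A n = -oo%E ->
    proj_supp [set x | (x%:E <= pt A (n + 1))%E]
| ProjPy (n : int) : has_idx A n -> ~~ evenz n -> pt A n = +oo%E ->
    proj_supp [set x | (pt A (n - 1) <= x%:E)%E].

Definition indec_projective_itv I : Prop := nonempty I /\ proj_supp [set` I].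

Definition dirsum (s : seq (interval R)) : rep k A :=
  foldr (fun I V => rsum (M I) V) rzero s.

Definition in_rep V : Prop :=
  exists s : seq (interval R),
    (forall I, I \in s -> indec_projective_itv I) /\
    exists q : fam (dirsum s) V, is_mor q /\ is_epi q.

Definition indecomposable V : Prop :=
  [/\ in_rep V, ~ is_zero V &
      forall X Y : rep k A, in_rep X -> in_rep Y -> iso V (rsum X Y) ->
        is_zero X \/ is_zero Y].

Definition projective V : Prop :=
  in_rep V /\
  forall X Y : rep k A, in_rep X -> in_rep Y ->
  forall (p : fam X Y) (f : fam V Y), is_mor p -> is_epi p -> is_mor f ->
  exists h : fam V X, is_mor h /\ forall x v, p x (h x v) = f x v.

Definition rep_injective V : Prop :=
  in_rep V /\
  forall X Y : rep k A, in_rep X -> in_rep Y ->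
  forall (i : fam X Y) (f : fam X V), is_mor i -> is_mono i -> is_mor f ->
  exists h : fam Y V, is_mor h /\ forall x v, h x (i x v) = f x v.

Definition simple V : Prop :=
  [/\ in_rep V, ~ is_zero V &
      forall (X : rep k A) (i : fam X V), in_rep X -> is_mor i -> is_mono i ->
        is_zero X \/ is_iso i].

Record ses := Ses {
  ses_N : rep k A;
  ses_E : rep k A;
  ses_M : rep k A;
  ses_f : fam ses_N ses_E;
  ses_g : fam ses_E ses_M
}.

Definition short_exact (s : ses) : Prop :=
  [/\ is_mor (ses_f s), is_mor (ses_g s), is_mono (ses_f s), is_epi (ses_g s)
    & forall x, limg (ses_f s x) = lker (ses_g s x)].

Definition is_section V W (f : fam V W) : Prop :=
  exists r : fam W V, is_mor r /\ forall x v, r x (f x v) = v.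

Definition is_retraction V W (g : fam V W) : Prop :=
  exists r : fam W V, is_mor r /\ forall x w, g x (r x w) = w.

Definition nontrivial V W (h : fam V W) : Prop := exists x v, h x v <> 0.

Definition AR_seq (s : ses) : Prop :=
  [/\ [/\ in_rep (ses_N s), in_rep (ses_E s), in_rep (ses_M s) & short_exact s],
      ~ is_section (ses_f s) /\ ~ is_retraction (ses_g s),
      indecomposable (ses_N s) /\ indecomposable (ses_M s),
      (forall X (h : fam (ses_N s) X), indecomposable X -> ~ iso X (ses_N s) ->
         is_mor h -> nontrivial h ->
         exists h' : fam (ses_E s) X,
           is_mor h' /\ forall x v, h' x (ses_f s x v) = h x v) &
      (forall X (h : fam X (ses_M s)), indecomposable X -> ~ iso X (ses_M s) ->
         is_mor h -> nontrivial h ->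
         exists h' : fam X (ses_E s),
           is_mor h' /\ forall x v, ses_g s x (h' x v) = h x v)].

(* [1; 1] and [1, -1]: a matrix entry 1 from M_I to M_J is the family that is
   the identity of k on the points of both I and J, and 0 elsewhere. *)
Definition col_fun I J1 J2 (x : R) (v : M I x) : rsum (M J1) (M J2) x :=
  (can_map I J1 x x v, can_map I J2 x x v).

Lemma col_fun_linear I J1 J2 x : linear (@col_fun I J1 J2 x).
Proof. by move=> a u v; rewrite /col_fun !linearP. Qed.

HB.instance Definition _ I J1 J2 x :=
  GRing.isLinear.Build k (M I x) (rsum (M J1) (M J2) x) *:%R
    (@col_fun I J1 J2 x) (@col_fun_linear I J1 J2 x).

Definition row_fun I1 I2 J (x : R) (v : rsum (M I1) (M I2) x) : M J x :=
  can_map I1 J x x v.1 - can_map I2 J x x v.2.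

Lemma row_fun_linear I1 I2 J x : linear (@row_fun I1 I2 J x).
Proof.
move=> a u v; rewrite /row_fun /= (linearP (can_map I1 J x x)).
by rewrite (linearP (can_map I2 J x x)) opprD addrACA -scalerBr.
Qed.

HB.instance Definition _ I1 I2 J x :=
  GRing.isLinear.Build k (rsum (M I1) (M I2) x) (M J x) *:%R
    (@row_fun I1 I2 J x) (@row_fun_linear I1 I2 J x).

Definition itv_ses (U E1 E2 W : interval R) : ses :=
  @Ses (M U) (rsum (M E1) (M E2)) (M W)
    (fun x => linfun (@col_fun U E1 E2 x))
    (fun x => linfun (@row_fun E1 E2 W x)).

End Reps.

Section Types.
Variable (R : realType).

(* Real intervals with extended-real endpoints; [c] tells whether the endpoint
   is included, and is ignored at infinite endpoints. *)
Definition lbd (c : bool) (a : \bar R) : itv_bound R :=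
  match a with
  | EFin r => if c then BLeft r else BRight r
  | -oo%E => -oo%O
  | +oo%E => +oo%O
  end.

Definition ubd (c : bool) (b : \bar R) : itv_bound R :=
  match b with
  | EFin r => if c then BRight r else BLeft r
  | -oo%E => -oo%O
  | +oo%E => +oo%O
  end.

Definition icc (a b : \bar R) := Interval (lbd true a) (ubd true b).
Definition ico (a b : \bar R) := Interval (lbd true a) (ubd false b).
Definition ioc (a b : \bar R) := Interval (lbd false a) (ubd true b).
Definition ioo (a b : \bar R) := Interval (lbd false a) (ubd false b).

Variable A : contA R.

(* t = s_a, the sink among the two consecutive elements surrounding a. *)
Definition near_sink (a : R) (t : \bar R) : Prop :=
  exists n : int,
    [/\ has_idx A n, has_idx A (n + 1), (pt A n < a%:E < pt A (n + 1))%E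
      & t = if evenz n then pt A n else pt A (n + 1)].

Definition sink_lt (a : R) : Prop := exists2 t, near_sink a t & (t < a%:E)%E.
Definition sink_gt (a : R) : Prop := exists2 t, near_sink a t & (a%:E < t)%E.

Local Notation s := (pt A).
Local Notation idx := (has_idx A).

Local Notation notS a := (~ cA_S A a).

(* [ARtype U E1 E2 W] : U, E1, E2, W are the supports in one of the 16 types
   of sequences M_U >-> M_E1 (+) M_E2 ->> M_W, in order. *)
Inductive ARtype : interval R -> interval R -> interval R -> interval R -> Prop :=
| ART1 (a b : R) : a < b -> notS a -> notS b -> sink_lt a -> sink_lt b ->
    ARtype (ico a%:E b%:E) (icc a%:E b%:E) (ioo a%:E b%:E) (ioc a%:E b%:E)
| ART2 (a b : R) : a < b -> notS a -> notS b -> sink_lt a -> sink_gt b ->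
    ARtype (icc a%:E b%:E) (ico a%:E b%:E) (ioc a%:E b%:E) (ioo a%:E b%:E)
| ART3 (a b : R) : a < b -> notS a -> notS b -> sink_gt a -> sink_lt b ->
    ARtype (ioo a%:E b%:E) (ioc a%:E b%:E) (ico a%:E b%:E) (icc a%:E b%:E)
| ART4 (a b : R) : a < b -> notS a -> notS b -> sink_gt a -> sink_gt b ->
    ARtype (ioc a%:E b%:E) (ioo a%:E b%:E) (icc a%:E b%:E) (ico a%:E b%:E)
| ART5 (n : int) (b : R) : idx (2 * n - 1) -> idx (2 * n) ->
    (s (2 * n) < b%:E)%E -> notS b -> sink_lt b ->
    ARtype (ico (s (2 * n - 1)) b%:E)
           (icc (s (2 * n - 1)) b%:E) (ioo (s (2 * n)) b%:E)
           (ioc (s (2 * n)) b%:E)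
| ART6 (n : int) (b : R) : idx (2 * n - 1) -> idx (2 * n) ->
    (s (2 * n) < b%:E)%E -> notS b -> sink_gt b ->
    ARtype (icc (s (2 * n - 1)) b%:E)
           (ico (s (2 * n - 1)) b%:E) (ioc (s (2 * n)) b%:E)
           (ioo (s (2 * n)) b%:E)
| ART7 (n : int) (b : R) : idx (2 * n) -> idx (2 * n + 1) ->
    (s (2 * n + 1) < b%:E)%E -> notS b -> sink_lt b ->
    ARtype (ioo (s (2 * n + 1)) b%:E)
           (ioc (s (2 * n + 1)) b%:E) (ico (s (2 * n)) b%:E)
           (icc (s (2 * n)) b%:E)
| ART8 (n : int) (b : R) : idx (2 * n) -> idx (2 * n + 1) ->
    (s (2 * n + 1) < b%:E)%E -> notS b -> sink_gt b ->
    ARtype (ioc (s (2 * n + 1)) b%:E)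
           (ioo (s (2 * n + 1)) b%:E) (icc (s (2 * n)) b%:E)
           (ico (s (2 * n)) b%:E)
| ART9 (a : R) (n : int) : idx (2 * n) -> idx (2 * n + 1) ->
    (a%:E < s (2 * n))%E -> notS a -> sink_lt a ->
    ARtype (icc a%:E (s (2 * n + 1)))
           (ico a%:E (s (2 * n))) (ioc a%:E (s (2 * n + 1)))
           (ioo a%:E (s (2 * n)))
| ART10 (a : R) (n : int) : idx (2 * n) -> idx (2 * n + 1) ->
    (a%:E < s (2 * n))%E -> notS a -> sink_gt a ->
    ARtype (ioc a%:E (s (2 * n + 1)))
           (ioo a%:E (s (2 * n))) (icc a%:E (s (2 * n + 1)))
           (ico a%:E (s (2 * n)))
| ART11 (a : R) (n : int) : idx (2 * n - 1) -> idx (2 * n) ->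
    (a%:E < s (2 * n - 1))%E -> notS a -> sink_lt a ->
    ARtype (ico a%:E (s (2 * n - 1)))
           (icc a%:E (s (2 * n))) (ioo a%:E (s (2 * n - 1)))
           (ioc a%:E (s (2 * n)))
| ART12 (a : R) (n : int) : idx (2 * n - 1) -> idx (2 * n) ->
    (a%:E < s (2 * n - 1))%E -> notS a -> sink_gt a ->
    ARtype (ioo a%:E (s (2 * n - 1)))
           (ioc a%:E (s (2 * n))) (ico a%:E (s (2 * n - 1)))
           (icc a%:E (s (2 * n)))
| ART13 (m n : int) : idx (2 * m) -> idx (2 * m + 1) ->
    idx (2 * n) -> idx (2 * n + 1) -> (s (2 * m + 1) < s (2 * n))%E ->
    ARtype (ioc (s (2 * m + 1)) (s (2 * n + 1)))
           (ioo (s (2 * m + 1)) (s (2 * n))) (icc (s (2 * m)) (s (2 * n + 1)))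
           (ico (s (2 * m)) (s (2 * n)))
| ART14 (m n : int) : idx (2 * m - 1) -> idx (2 * m) ->
    idx (2 * n) -> idx (2 * n + 1) -> (s (2 * m) < s (2 * n))%E ->
    ARtype (icc (s (2 * m - 1)) (s (2 * n + 1)))
           (ico (s (2 * m - 1)) (s (2 * n))) (ioc (s (2 * m)) (s (2 * n + 1)))
           (ioo (s (2 * m)) (s (2 * n)))
| ART15 (m n : int) : idx (2 * m) -> idx (2 * m + 1) ->
    idx (2 * n - 1) -> idx (2 * n) -> (s (2 * m + 1) < s (2 * n - 1))%E ->
    ARtype (ioo (s (2 * m + 1)) (s (2 * n - 1)))
           (ioc (s (2 * m + 1)) (s (2 * n))) (ico (s (2 * m)) (s (2 * n - 1)))
           (icc (s (2 * m)) (s (2 * n)))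
| ART16 (m n : int) : idx (2 * m - 1) -> idx (2 * m) ->
    idx (2 * n - 1) -> idx (2 * n) -> (s (2 * m) < s (2 * n - 1))%E ->
    ARtype (ico (s (2 * m - 1)) (s (2 * n - 1)))
           (icc (s (2 * m - 1)) (s (2 * n))) (ioo (s (2 * m)) (s (2 * n - 1)))
           (ioc (s (2 * m)) (s (2 * n))).

End Types.

Section Main.
Variables (k : fieldType) (R : realType) (A : contA R).

Definition of_16_types (t : ses k A) : Prop :=
  exists U E1 E2 W : interval R, ARtype A U E1 E2 W /\ t = itv_ses k A U E1 E2 W.

Definition contains (t : ses k A) (I : interval R) : Prop :=
  [\/ iso (M k A I) (ses_N t), iso (M k A I) (ses_M t) |
      exists J : interval R,
        nonempty J /\ iso (ses_E t) (rsum (M k A I) (M k A J))].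

Definition adjacent_supp (I : interval R) : Prop :=
  exists n : int, [/\ has_idx A n, has_idx A (n + 1)
                    & I = icc (pt A n) (pt A (n + 1))].

Definition AR_conditions (I : interval R) : Prop :=
  [/\ ~ projective (M k A I), ~ rep_injective (M k A I)
    & ~ (simple (M k A I) \/ adjacent_supp I)].

End Main.

(* Main.v *)
(* Pair the possible ends of a finitely supported interval by cells: a point
   off S is a degenerate cell, a segment [s_n, s_(n+1)] is a cell, and crossing
   a cell toggles an end.  The 16 types are exactly the squares obtained by
   toggling a left and a right end across two disjoint, correctly ordered cells,
   and such a square is almost split because a nonzero morphism out of M_U that
   is not an isomorphism changes one of the two ends and hence factors through
   the toggled one.  Conversely, if one end of K is not of the kind occurring at
   the start of a square, then every left almost split map out of M_K splits;
   and if the two cells of K overlap, then K is a point, a closed segment, or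
   an ideal or filter of the order, i.e. M_K is simple, exceptional, projective
   or injective.  By the five lemma an almost split sequence is determined by
   its first term, and an indecomposable is an interval representation since
   every nonzero representation has one as a direct summand. *)

Require Import Defs.
From HB Require Import structures.
From mathcomp Require Import all_boot all_order all_algebra.
From mathcomp Require Import all_classical all_reals all_analysis.
From mathcomp Require Import zify lra.

Set Implicit Arguments.
Unset Strict Implicit.
Unset Printing Implicit Defensive.

Import Order.TTheory GRing.Theory Num.Theory.
Import numFieldNormedType.Exports.

Local Open Scope classical_set_scope.
Local Open Scope ring_scope.

(** The ends of supports may be open or infinite, so there is often no first or last point to argue
    with. The substitute is stabilisation: a quotient of finitely many interval modules becomes
    constant along any directed set of points, because membership in an interval does and because
    dimensions are bounded. This is what starts the search for an interval summand, what handles its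
    possibly open right end, and what reduces injectivity of filters and projectivity of ideals to
    vector spaces over a single point. It also explains why a left almost split map splits at an end
    of the wrong kind. Such an end has no nearest change: M_K maps to M_J for intervals J whose end
    is arbitrarily close to that of K. What K sees of the middle term stabilises near the end, so
    for J close enough a factorization of M_K -> M_J already yields a retraction onto M_K. At an end
    of the right kind the nearest change is a whole cell, and no such approximation exists. Only
    first terms are classified directly; the other two terms are then recovered by comparison with
    the square that has the same first term. *)

Section LinearAlgebra.
Variable k : fieldType.
Implicit Types U V : vectType k.

Definition lin_of U V (f : U -> V) (lf : linear f) : {linear U -> V} :=
  HB.pack f (GRing.isLinear.Build k U V *:%R f lf).

Definition lfun_of U V (f : U -> V) (lf : linear f) : 'Hom(U, V) :=
  linfun (lin_of lf).

Lemma lfun_ofE U V (f : U -> V) (lf : linear f) v : lfun_of lf v = f v.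
Proof. exact: lfunE. Qed.

(** The projection [p] onto a complement of [B] plays the role of V -> V/B. The kernel of [p \o m]
    is the preimage of [B], where [psi] vanishes, so a generalized inverse of [p \o m] gives the
    factorization. *)
Lemma lfun_extend U V (m : 'Hom(U, V)) (B : {vspace V}) (psi : 'Hom(U, k^o)) :
  (forall u, m u \in B -> psi u = 0) ->
  exists phi : 'Hom(V, k^o),
    (forall u, phi (m u) = psi u) /\ forall v, v \in B -> phi v = 0.
Proof.
move=> mB; set p := daddv_pi (B^C) B.
have BcB : (B^C :&: B = 0)%VS by rewrite capvC capv_compl.
have pE v : p v + daddv_pi B (B^C) v = v.
  by apply: daddv_pi_add BcB _; rewrite addvC addv_complf memvf.
have pB v : v \in B -> p v = 0.
  move=> vB; apply/eqP; rewrite -memv0 -BcB memv_cap memv_pi /=.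
  rewrite (_ : p v = v - daddv_pi B (B^C) v) ?rpredB ?memv_pi //.
  by rewrite -[X in X - _](pE v) addrK.
have Bp v : p v = 0 -> v \in B.
  by move=> pv; rewrite -(pE v) pv add0r memv_pi.
exists (psi \o ((p \o m)^-1 \o p))%VF; split=> [u|v vB]; last first.
  by rewrite !comp_lfunE pB // !linear0.
rewrite !comp_lfunE; apply/eqP; rewrite -subr_eq0 -linearB; apply/eqP/mB/Bp.
rewrite !linearB /= -!comp_lfunE; apply/eqP; rewrite subr_eq0; apply/eqP.
rewrite -[in RHS](inv_lfun_def (p \o m)%VF) !comp_lfunE //.
Qed.

Lemma lfun_separate V (W : {vspace V}) (v : V) : v \notin W ->
  exists phi : 'Hom(V, k^o), phi v = 1 /\ forall w, w \in W -> phi w = 0.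
Proof.
move=> vW; have lm : linear (fun c : k^o => c *: v : V).
  by move=> a b c; rewrite scalerDl scalerA.
pose m := lfun_of lm; have mE c : m c = c *: v by rewrite lfun_ofE.
have [c|phi [phim phiW]] := @lfun_extend _ _ m W \1%VF.
  rewrite mE id_lfunE => cvW; apply/eqP; apply: contraNT vW => c0.
  by rewrite -(scalerK c0 v) memvZ.
by exists phi; split=> //; rewrite -[v]scale1r -mE phim id_lfunE.
Qed.

End LinearAlgebra.

(** * The order of a quiver of continuous type A *)

Section OrderTheory.
Variables (R : realType) (A : contA R).
Implicit Types (x y z r : R) (m n : int).

Lemma evenzS n : evenz (n + 1) = ~~ evenz n.
Proof.
rewrite /evenz; case: n => [n|n]; first by rewrite -PoszD addn1.
rewrite NegzE; have -> : - n.+1%:Z + 1 = - n%:Z.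
  by rewrite -addn1 PoszD opprD subrK.
by rewrite !abszN /= negbK.
Qed.

Lemma evenz2 n : evenz (2 * n).
Proof. by rewrite /evenz abszM oddM. Qed.

Lemma evenz_half n : evenz n -> exists m, n = 2 * m.
Proof.
rewrite /evenz -dvdn2 => /dvdnP[q nq]; exists (sgz n * q%:Z).
by rewrite [LHS]intEsg nq PoszM mulrA mulrC.
Qed.

Lemma pt_lt m n : has_idx A m -> has_idx A n ->
  ((pt A m < pt A n)%E = (m < n)).
Proof.
move=> hm hn; apply/idP/idP => [|mn]; first exact: pt_ltW.
by apply: cA_pt_incr => //; rewrite lte_fin.
Qed.

Lemma pt_le m n : has_idx A m -> has_idx A n ->
  ((pt A m <= pt A n)%E = (m <= n)).
Proof. by move=> hm hn; rewrite !leNgt pt_lt. Qed.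

Lemma idx_between m n i : has_idx A m -> has_idx A n -> m <= i -> i <= n ->
  has_idx A i.
Proof.
by move=> hm hn mi i_n; apply: (cA_idx_convex hm hn); rewrite lee_fin.
Qed.

Lemma pinfty_idx : exists2 i, cA_idx A i & cA_pt A i = +oo%E.
Proof.
have : ((EFin @` cA_S A) `|` [set -oo%E; +oo%E]) +oo%E by right; right.
by rewrite -cA_pt_image => -[i hi pi]; exists i.
Qed.

Lemma ninfty_idx : exists2 i, cA_idx A i & cA_pt A i = -oo%E.
Proof.
have : ((EFin @` cA_S A) `|` [set -oo%E; +oo%E]) -oo%E by right; left.
by rewrite -cA_pt_image => -[i hi pi]; exists i.
Qed.

Lemma idx_succ n : has_idx A n -> (pt A n < +oo)%E -> has_idx A (n + 1).
Proof.
move=> hn n_oo; have [i hi pi] := pinfty_idx.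
have ni : (n%:E < i)%O.
  rewrite ltNge le_eqVlt; apply/negP => /predU1P[ni|ni].
    by move: n_oo; rewrite /pt -ni pi ltxx.
  by have := cA_pt_incr hi hn ni; rewrite pi ltNge leey.
apply: (cA_idx_convex hn hi); first by rewrite lee_fin lerDl.
by case: i ni {hi pi} => [i| |] // ni; rewrite ?leey // lee_fin lezD1 -lte_fin.
Qed.

Lemma idx_pred n : has_idx A n -> (-oo < pt A n)%E -> has_idx A (n - 1).
Proof.
move=> hn n_oo; have [i hi pi] := ninfty_idx.
have ni : (i < n%:E)%O.
  rewrite ltNge le_eqVlt; apply/negP => /predU1P[ni|ni].
    by move: n_oo; rewrite /pt ni pi ltxx.
  by have := cA_pt_incr hn hi ni; rewrite pi ltNge leNye.
apply: (cA_idx_convex hi hn); last by rewrite lee_fin gerBl.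
case: i ni {hi pi} => [i| |] // ni; rewrite ?leNye // lee_fin.
by rewrite -ltzD1 subrK -lte_fin.
Qed.

Lemma pt_S n r : has_idx A n -> pt A n = r%:E -> cA_S A r.
Proof.
move=> hn pn; have : (cA_pt A @` cA_idx A) r%:E by exists n%:E.
by rewrite cA_pt_image => -[[s Ss [<-]]//|[]].
Qed.

Lemma S_pt r : cA_S A r -> exists2 n, has_idx A n & pt A n = r%:E.
Proof.
move=> Sr; have : (cA_pt A @` cA_idx A) r%:E.
  by rewrite cA_pt_image; left; exists r.
move=> [[n| |] hn pn]; first by exists n.
  have [i hi pi] := pinfty_idx.
  have [ip|ip] := leP (+oo%E : \bar int) i.
    by move: ip pi; rewrite leye_eq => /eqP ->; rewrite pn.
  by have := cA_pt_incr hi hn ip; rewrite pn pi ltNge leey.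
have [i hi pi] := ninfty_idx.
have [ip|ip] := leP i (-oo%E : \bar int).
  by move: ip pi; rewrite leeNy_eq => /eqP ->; rewrite pn.
by have := cA_pt_incr hn hi ip; rewrite pn pi ltNge leNye.
Qed.

Lemma ereal_between (a : \bar R) x y : (x%:E <= a)%E -> (a <= y%:E)%E ->
  exists r, a = r%:E /\ x <= r <= y.
Proof.
by case: a => [r| |] //; rewrite !lee_fin => xr ry; exists r; rewrite xr.
Qed.

(** The supremum of such a sequence would be a limit point of S. *)
Lemma no_incr (u : nat -> R) x : (forall i : nat, cA_S A (u i)) ->
  (forall i : nat, u i < u i.+1) -> (forall i : nat, u i <= x) -> False.
Proof.
move=> uS ui ux; set E := range u.
have hE : has_sup E by split; [exists (u 0%N); exists 0%N | exists x => _ [n _ <-]].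
have : limit_point (cA_S A) (sup E); last by rewrite cA_no_acc.
move=> U /nbhs_ballP[e /= e0 eU].
have [_ [n _ <-] eu] := sup_adherent e0 hE.
have uE (m : nat) : u m <= sup E by apply: ub_le_sup; [exact: hE.2 | exists m].
have usup : u n < sup E by apply: lt_le_trans (uE n.+1).
exists (u n); split => //; first by rewrite lt_eqF.
apply: eU; rewrite /ball /= ger0_norm ?subr_ge0 //.
by rewrite ltrBlDr -ltrBlDl.
Qed.

Lemma no_decr (u : nat -> R) x : (forall i : nat, cA_S A (u i)) ->
  (forall i : nat, u i.+1 < u i) -> (forall i : nat, x <= u i) -> False.
Proof.
move=> uS ui ux; set E := range u.
have hE : has_inf E by split; [exists (u 0%N); exists 0%N | exists x => _ [n _ <-]].
have : limit_point (cA_S A) (inf E); last by rewrite cA_no_acc.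
move=> U /nbhs_ballP[e /= e0 eU].
have [_ [n _ <-] eu] := inf_adherent e0 hE.
have uE (m : nat) : inf E <= u m by apply: ge_inf; [exact: hE.2 | exists m].
have usup : inf E < u n by apply: le_lt_trans (uE n.+1) _.
exists (u n); split => //; first by rewrite gt_eqF.
apply: eU; rewrite /ball /= distrC ger0_norm ?subr_ge0 //.
by rewrite ltrBlDr addrC.
Qed.

Definition inseg n x :=
  [/\ has_idx A n, has_idx A (n + 1) & (pt A n <= x%:E <= pt A (n + 1))%E].

(** Otherwise the elements of S met when walking from index 0 towards [x] would form an infinite
    bounded monotone sequence. The strict bound on the right singles out one segment when [x] lies
    in S. *)
Lemma seg_exists x : exists n, inseg n x /\ (x%:E < pt A (n + 1))%E.
Proof.
have [h0|h0] := leP (pt A 0) x%:E; apply: contrapT => nex.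
  have H (i : nat) : has_idx A i%:Z /\ (pt A i%:Z <= x%:E)%E.
    elim: i => [|i [hi ix]]; first by split=> //; exact: cA_idx0.
    have hi1 : has_idx A (i%:Z + 1).
      by apply: idx_succ => //; apply: le_lt_trans ix _; rewrite ltry.
    rewrite -addn1 PoszD; split=> //; rewrite leNgt; apply/negP => xi.
    by apply: nex; exists i%:Z; split=> //; split; rewrite ?ix ?ltW.
  (* The sequence starts at index 1, since [pt A 0] may be -oo. *)
  have uE i : pt A i.+1%:Z = (fine (pt A i.+1%:Z))%:E.
    rewrite fineK // fin_numElt; apply/andP; split; last first.
      by apply: le_lt_trans (H _).2 _; rewrite ltry.
    apply: le_lt_trans (_ : (pt A 0%:Z < _)%E); first exact: leNye.
    by rewrite pt_lt //; [exact: (H 0%N).1 | exact: (H i.+1).1].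
  apply: (@no_incr (fun i => fine (pt A i.+1%:Z)) x) => i.
  - by apply: (@pt_S i.+1%:Z); [exact: (H _).1 | exact: uE].
  - by rewrite -lte_fin -!uE pt_lt ?ltz_nat //; exact: (H _).1.
  - by rewrite -lee_fin -uE (H _).2.
have H (i : nat) : has_idx A (- i%:Z) /\ (x%:E < pt A (- i%:Z))%E.
  elim: i => [|i [hi ix]]; first by rewrite oppr0; split=> //; exact: cA_idx0.
  have hi1 : has_idx A (- i%:Z - 1).
    by apply: idx_pred => //; apply: le_lt_trans ix; exact: leNye.
  rewrite -addn1 PoszD opprD; split=> //; rewrite ltNge; apply/negP => xi.
  by apply: nex; exists (- i%:Z - 1); rewrite /inseg subrK; split=> //; split; rewrite ?xi ?ltW.
have uE i : pt A (- i.+1%:Z) = (fine (pt A (- i.+1%:Z)))%:E.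
  rewrite fineK // fin_numElt; apply/andP; split.
    by apply: le_lt_trans (H i.+1).2; exact: leNye.
  apply: lt_le_trans (_ : (_ < pt A (- 0%:Z))%E) (leey _).
  by rewrite pt_lt ?ltrN2 //; [exact: (H i.+1).1 | exact: (H 0%N).1].
apply: (@no_decr (fun i => fine (pt A (- i.+1%:Z))) x) => i.
- by apply: (@pt_S (- i.+1%:Z)); [exact: (H _).1 | exact: uE].
- by rewrite -lte_fin -!uE pt_lt ?ltrN2 ?ltz_nat //; exact: (H _).1.
- by rewrite -lee_fin -uE ltW // (H _).2.
Qed.

Lemma inseg_open n m x : has_idx A n -> has_idx A (n + 1) ->
  (pt A n < x%:E < pt A (n + 1))%E -> inseg m x -> m = n.
Proof.
move=> hn hn1 /andP[nx xn] [hm hm1 /andP[mx xm]].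
have : n < m + 1 by rewrite -pt_lt //; apply: lt_le_trans nx xm.
have : m < n + 1 by rewrite -pt_lt //; apply: le_lt_trans mx xn.
by rewrite !ltzD1 => mn nm; apply/eqP; rewrite eq_le mn.
Qed.

Lemma inseg_pt n m r : has_idx A n -> pt A n = r%:E -> inseg m r ->
  m = n \/ n = m + 1.
Proof.
move=> hn pn [hm hm1]; rewrite -pn !pt_le // => /andP[mn].
rewrite le_eqVlt ltzD1 => /predU1P[|nm]; [by right | left].
by apply/eqP; rewrite eq_le mn.
Qed.

Lemma qle_witness x y : qle A x y -> exists n,
  [/\ inseg n x, inseg n y & if evenz n then x <= y else y <= x].
Proof. by move=> [n [hn hn1 xn yn e]]; exists n; split. Qed.

Lemma seg_qle n x y : inseg n x -> inseg n y ->
  (if evenz n then x <= y else y <= x) -> qle A x y.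
Proof. by move=> [? ? ?] [_ _ ?] ?; exists n; split. Qed.

Lemma qle_seg n x y : inseg n x -> inseg n y -> qle A x y ->
  if evenz n then x <= y else y <= x.
Proof.
move=> xn yn /qle_witness[m [xm ym e]].
have [->|mn] := eqVneq n m; first by [].
suff -> : x = y by case: ifP.
wlog : n m x y {e} xn yn xm ym mn / m < n.
  move=> H; case: (ltgtP m n) => [mn'|nm|//]; first exact: (H n m).
    by apply: (H m n) => //; rewrite eq_sym.
  by move=> E; rewrite E eqxx in mn.
move=> {}mn; have hmn : m + 1 <= n by rewrite lezD1.
case: xn yn xm ym => [hn hn1 /andP[nx _]] [_ _ /andP[ny _]].
move=> [hm hm1 /andP[_ xm]] [_ _ /andP[_ ym]].
have pmn : (pt A (m + 1) <= pt A n)%E by rewrite pt_le.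
have nxE : x%:E = pt A n by apply/le_anti; rewrite nx (le_trans xm).
have nyE : y%:E = pt A n by apply/le_anti; rewrite ny (le_trans ym).
by apply: EFin_inj; rewrite nxE nyE.
Qed.

Lemma qle_refl x : qle A x x.
Proof.
have [n [xn _]] := seg_exists x; apply: (seg_qle xn xn).
by case: ifP.
Qed.

Lemma qle_anti x y : qle A x y -> qle A y x -> x = y.
Proof.
move=> xy yx; have := qle_between xy yx.
by rewrite -!(andbC (_ <= x)) => /orP[] /le_anti.
Qed.

Lemma inseg_between n x y z : inseg n x -> inseg n y ->
  (x <= z <= y) || (y <= z <= x) -> inseg n z.
Proof.
move=> [hn hn1 /andP[nx xn]] [_ _ /andP[ny yn]].
case/orP=> /andP[h1 h2]; split=> //; apply/andP; split.
- by apply: le_trans nx _; rewrite lee_fin.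
- by apply: le_trans yn; rewrite lee_fin.
- by apply: le_trans ny _; rewrite lee_fin.
- by apply: le_trans xn; rewrite lee_fin.
Qed.

Lemma qle_mid x y z : qle A x y -> (x <= z <= y) || (y <= z <= x) ->
  qle A x z /\ qle A z y.
Proof.
move=> /qle_witness[n [xn yn e]] xzy; have zn := inseg_between xn yn xzy.
split; [apply: (seg_qle xn zn) | apply: (seg_qle zn yn)];
by case: ifP e => _ e; case/orP: xzy => /andP[h1 h2] //; lra.
Qed.

Lemma sink_min n r y : has_idx A n -> pt A n = r%:E -> evenz n ->
  qle A y r -> y = r.
Proof.
move=> hn pn en /qle_witness[m [ym rm e]].
apply/le_anti; case: (inseg_pt hn pn rm) => mn.
  by move: e; rewrite mn en => ->; case: ym => _ _; rewrite mn pn lee_fin => /andP[].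
move: e en; rewrite mn evenzS => /[swap] /negPf -> ->.
by case: ym => _ _; rewrite -mn pn lee_fin andbT => /andP[].
Qed.

Lemma source_max n r y : has_idx A n -> pt A n = r%:E -> ~~ evenz n ->
  qle A r y -> y = r.
Proof.
move=> hn pn en /qle_witness[m [rm ym e]].
apply/le_anti; case: (inseg_pt hn pn rm) => mn.
  by move: e; rewrite mn (negPf en) => ->; case: ym => _ _; rewrite mn pn lee_fin => /andP[].
move: e en; rewrite mn evenzS negbK => /[swap] -> ->.
by case: ym => _ _; rewrite -mn pn lee_fin andbT => /andP[].
Qed.

(** Two proper relations in different segments would meet in an element y of S lying strictly
    between them in the order, while y is a sink or a source. *)
Lemma qle_trans x y z : qle A x y -> qle A y z -> qle A x z.
Proof.
move=> xy yz; have [->//|xny] := eqVneq x y; have [<-//|ynz] := eqVneq y z.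
have [n [xn yn e]] := qle_witness xy; have [m [ym zm e']] := qle_witness yz.
have [nm|nm] := eqVneq n m.
  rewrite -nm in zm e'; apply: (seg_qle xn zm).
  by case: ifP e e' => _ h1 h2; [apply: le_trans h1 h2 | apply: le_trans h2 h1].
have [r pr] : exists n', has_idx A n' /\ pt A n' = y%:E.
  case: yn ym => [hn hn1 /andP[ny yn]] [hm hm1 /andP[my ym]].
  case: (ltgtP n m) nm => // mn _.
    exists m; split=> //; apply/le_anti; rewrite my (le_trans yn) // pt_le //.
    by rewrite lezD1.
  exists n; split=> //; apply/le_anti; rewrite ny (le_trans ym) // pt_le //.
  by rewrite lezD1.
case: (boolP (evenz r)) => er.
  by have := sink_min pr.1 pr.2 er xy => yx; rewrite yx eqxx in xny.
by have := source_max pr.1 pr.2 er yz => yx; rewrite yx eqxx in ynz.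
Qed.

(** Convex sets are connected for comparability. The induction is on the number of segments between
    x and y: two points of one segment are comparable, and the step to the next segment goes through
    their common end, which lies in C by convexity. *)
Lemma qle_connected (T : Type) (f : R -> T) (C : R -> Prop) :
  (forall x y z, C x -> C z -> x <= y <= z -> C y) ->
  (forall x y, qle A y x -> C x -> C y -> f x = f y) ->
  forall x y, C x -> C y -> f x = f y.
Proof.
move=> Cc fC x y Cx Cy; wlog xy : x y Cx Cy / x <= y.
  move=> H; case/orP: (le_total x y) => xy; first exact: H.
  by apply/esym/H.
have [n [xn _]] := seg_exists x; have [m [ym _]] := seg_exists y.
have [nm|nm] := leP m n.
  have yn : inseg n y.
    case: xn ym => [hn hn1 /andP[nx _]] [hm hm1 /andP[_ ym]]; split=> //.
    rewrite (le_trans nx) ?lee_fin // (le_trans ym) // pt_le //.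
    by rewrite lerD2r.
  case e: (evenz n).
    by apply/esym/fC => //; apply: (seg_qle xn yn); rewrite e.
  by apply/fC => //; apply: (seg_qle yn xn); rewrite e.
have [d md] : exists d : nat, m = n + 1 + d%:Z.
  by exists (absz (m - (n + 1))%R); rewrite gez0_abs ?subr_ge0 ?lezD1 // addrC subrK.
elim: d n x Cx xn md xy {nm} => [|d IH] n x Cx xn md xy.
  case: (xn) (ym) => [hn hn1 /andP[nx xn']] [hm hm1 /andP[ym' _]].
  rewrite addr0 in md; rewrite md in ym'.
  have [r [E /andP[xr ry]]] := ereal_between xn' ym'.
  have rn : inseg n r.
    by split=> //; rewrite E lexx andbT (le_trans nx) ?lee_fin.
  have rm : inseg m r by split=> //; rewrite md E lexx /= -E pt_le -?md ?lerDl.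
  have Cr : C r by apply: Cc Cx Cy _; rewrite xr.
  apply: (@eq_trans _ _ (f r)).
    case e: (evenz n).
      by apply/esym/fC => //; apply: (seg_qle xn rn); rewrite e.
    by apply/fC => //; apply: (seg_qle rn xn); rewrite e.
  case e: (evenz m).
    by apply/esym/fC => //; apply: (seg_qle rm ym); rewrite e.
  by apply/fC => //; apply: (seg_qle ym rm); rewrite e.
case: (xn) (ym) => [hn hn1 /andP[nx xn']] [hm hm1 /andP[ym' _]].
have n1m : n + 1 < m by rewrite md ltrDl.
have n1y : (pt A (n + 1) <= y%:E)%E.
  by apply: le_trans ym'; rewrite pt_le // ltW.
have hn2 : has_idx A (n + 1 + 1).
  by apply: idx_succ => //; apply: le_lt_trans n1y _; rewrite ltry.
have [r [E /andP[xr ry]]] := ereal_between xn' n1y.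
have rn : inseg n r.
  by split=> //; rewrite E lexx andbT (le_trans nx) ?lee_fin.
have rn1 : inseg (n + 1) r.
  by split=> //; rewrite E lexx /= -E pt_le ?lerDl.
have Cr : C r by apply: Cc Cx Cy _; rewrite xr.
apply: (@eq_trans _ _ (f r)).
  case e: (evenz n).
    by apply/esym/fC => //; apply: (seg_qle xn rn); rewrite e.
  by apply/fC => //; apply: (seg_qle rn xn); rewrite e.
apply: (IH (n + 1)) => //.
by rewrite md -[d.+1]add1n PoszD !addrA.
Qed.

End OrderTheory.

(** * Interval representations *)

Section IntervalReps.
Variables (k : fieldType) (R : realType) (A : contA R).
Implicit Types (I J K : interval R) (V W X : rep k A).

Lemma itv_convex I (x y z : R) : x \in I -> z \in I -> x <= y <= z -> y \in I.
Proof. by move=> xI zI; apply: (@interval_is_interval _ I x z). Qed.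

(** The coordinate of a vector of k^1, and 0 on k^0; as a sum it needs no case distinction on
    [b]. *)
Definition cf (b : bool) (v : 'rV[k]_b) : k := \sum_j v ord0 j.

Lemma cf_linear b : linear (@cf b : _ -> k^o).
Proof.
move=> c u v; rewrite /cf scaler_sumr -big_split.
by apply: eq_bigr => j _; rewrite !mxE.
Qed.

Lemma cf_const (b : bool) c : cf (const_mx c : 'rV_b) = if b then c else 0.
Proof.
rewrite /cf; under eq_bigr do rewrite mxE.
by rewrite sumr_const card_ord; case: b.
Qed.

Lemma cfK (b : bool) (v : 'rV_b) : const_mx (cf v) = v.
Proof.
apply/rowP; case: b v => v [j hj] //; rewrite mxE /cf.
rewrite big_ord_recl big_ord0 addr0.
by congr (v _ _); apply/val_inj; case: j hj.
Qed.

Lemma can_mapE I J x y (v : 'rV_(x \in I)) :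
  can_map k I J x y v = const_mx (cf v).
Proof.
rewrite lfunE /=; apply/rowP => j; rewrite !mxE /cf.
by apply: eq_bigr => i _; rewrite mxE mulr1.
Qed.

Lemma rmapME I x y (v : M k A I x) : rmap (M k A I) x y v = const_mx (cf v).
Proof. exact: can_mapE. Qed.

Lemma row_false (b : bool) (u v : 'rV[k]_b) : ~~ b -> u = v.
Proof. by case: b u v => u v // _; apply/rowP => -[]. Qed.

Lemma cf_false (b : bool) (v : 'rV_b) : ~~ b -> cf v = 0.
Proof. by case: b v => // v _; rewrite /cf big_ord0. Qed.

Lemma row_const (b : bool) (c d : k) :
  (const_mx c = const_mx d :> 'rV_b) <-> (b -> c = d).
Proof.
split=> [E bT|E]; last by case: b E => E; [rewrite E | exact: row_false].
by have := congr1 (@cf b) E; rewrite !cf_const bT.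
Qed.

(** This is the condition for the family of canonical maps M_I -> M_J to be a morphism: going from k
    at x to k at y, one of the two composites is the identity exactly when the other is. *)
Definition hom I J := forall x y, qle A y x -> x \in I -> y \in J ->
  (y \in I) = (x \in J).

Definition can I J : fam (M k A I) (M k A J) := fun x => can_map k I J x x.
Arguments can : clear implicits.

Lemma canE I J x (v : M k A I x) : can I J x v = const_mx (cf v).
Proof. exact: can_mapE. Qed.

Lemma can_mor I J : hom I J -> is_mor (can I J).
Proof.
move=> IJ x y yx v; rewrite !canE rmapME !rmapME; apply/row_const => yJ.
rewrite !cf_const; have /orP[xI|xI] := orbN (x \in I).
  by rewrite (IJ x y).
by rewrite cf_false // !if_same.
Qed.

Lemma can_id I x (v : M k A I x) : can I I x v = v.
Proof. by rewrite canE; exact: cfK. Qed.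

Lemma can_comp I J K x (v : M k A I x) : (x \in I -> x \in K -> x \in J) ->
  can J K x (can I J x v) = can I K x v.
Proof.
move=> IKJ; rewrite !canE; apply/row_const => xK; rewrite cf_const.
case: ifP => // /negP xJ; rewrite cf_false //.
by apply/negP => xI; apply/xJ/IKJ.
Qed.

(** On the intersection of I and J a morphism is multiplication by a scalar at each point, and
    naturality makes this scalar constant along comparable points; the intersection is convex, hence
    connected. A nonzero scalar turns naturality into the condition [hom]. *)
Lemma mor_scalar I J (f : fam (M k A I) (M k A J)) : is_mor f ->
  exists c : k, (forall x v, f x v = c *: can I J x v) /\
    (c != 0 -> (exists2 x, x \in I & x \in J) -> hom I J).
Proof.
move=> fm; pose g x := cf (f x (const_mx 1)).
have fE x v : f x v = const_mx (g x * cf v).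
  have vE : v = cf v *: (const_mx 1 : M k A I x).
    by rewrite -[LHS]cfK -[in LHS](mulr1 (cf v)) -scalemx_const.
  rewrite {1}vE linearZ /= -[f x _]cfK -/(g x).
  by rewrite -[LHS]/(_ *: const_mx _ : 'rV_(x \in J)) scalemx_const mulrC.
have gmor x y : qle A y x -> x \in I -> y \in J ->
    (if y \in I then g y else 0) = (if x \in J then g x else 0).
  move=> yx xI yJ; have := fm x y yx (const_mx 1).
  rewrite rmapME [RHS]rmapME !fE => /row_const /(_ yJ).
  by rewrite !cf_const xI mulr1; case: ifP; case: ifP; rewrite ?mulr1 ?mulr0.
have gc x y : x \in I -> x \in J -> y \in I -> y \in J -> g x = g y.
  move=> xI xJ yI yJ.
  apply: (qle_connected (f := g) (C := fun x => x \in I /\ x \in J)) => //.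
    by move=> a b c [aI aJ] [cI cJ] abc; split; apply: itv_convex abc.
  move=> a b ba [aI aJ] [bI bJ].
  by have := gmor a b ba aI bJ; rewrite bI aJ => ->.
have [[x0 [x0I x0J]]|nex] := pselect (exists x, x \in I /\ x \in J); last first.
  exists 0; split; last by rewrite eqxx.
  move=> x v; rewrite scale0r fE; have /orP[xI|xI] := orbN (x \in I).
    by apply: row_false; apply/negP => xJ; apply: nex; exists x.
  by rewrite cf_false // mulr0; apply/rowP => j; rewrite !mxE.
exists (g x0); split=> [x v|c0 _ x y yx xI yJ].
  rewrite fE canE scalemx_const; apply/row_const => xJ.
  have /orP[xI|xI] := orbN (x \in I); last by rewrite cf_false // !mulr0.
  by rewrite (gc x x0).
have := gmor x y yx xI yJ; case: ifP => yI; case: ifP => xJ //.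
  by rewrite (gc y x0) // => E; rewrite E eqxx in c0.
by rewrite (gc x x0) // => E; rewrite -E eqxx in c0.
Qed.

(** For comparable points of K the two conditions together say that one lies in L if and only if the
    other does; K is connected and meets L. *)
Lemma hom_antisym I J x : hom I J -> hom J I -> x \in I -> x \in J ->
  forall y, (y \in I) = (y \in J).
Proof.
move=> IJ JI xI xJ.
suff H K L : hom K L -> hom L K -> x \in K -> x \in L ->
    forall y, y \in K -> y \in L.
  by move=> y; apply/idP/idP; apply: H.
move=> {IJ JI xI xJ} KL LK xK xL y yK.
rewrite -(@qle_connected _ A _ (fun z => z \in L) (fun z => z \in K) _ _ x) //.
  by move=> a b c aK cK; apply: itv_convex.
move=> a b ba aK bK; apply/idP/idP => [aL|bL].
  by rewrite -(LK a b) // aL in aK *; rewrite ?bK.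
by rewrite -(KL a b).
Qed.

(** Equality of intervals as pairs of bounds, needed since uniqueness is stated for equality of
    sequences: a nonempty interval is the hull of its points. *)
Lemma set_itv_inj I J x : x \in I -> (forall y, (y \in I) = (y \in J)) -> I = J.
Proof.
move=> xI IJ; have E : [set` I] = [set` J].
  by apply/seteqP; split=> y /=; rewrite IJ.
have nI : neitv I.
  by apply/set0P; exists x.
have nJ : neitv J by rewrite /neitv -E.
by rewrite -(set_itvK nI) -(set_itvK nJ) E.
Qed.

End IntervalReps.
Arguments can {k R A} I J.
Arguments hom {R} A I J.

(** * Morphisms and sums *)

Section RepTheory.
Variables (k : fieldType) (R : realType) (A : contA R).
Implicit Types (I J K : interval R) (U V W X Y Z : rep k A).

Definition fam_id V : fam V V := fun x => \1%VF.
Definition fam_zero V W : fam V W := fun x => 0.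
Definition fam_comp U V W (g : fam V W) (f : fam U V) : fam U W :=
  fun x => (g x \o f x)%VF.
Definition fam_add V W (f g : fam V W) : fam V W := fun x => f x + g x.
Definition fam_scale V W c (f : fam V W) : fam V W := fun x => c *: f x.

Lemma rmap_sumE V W x y (v : rsum V W x) :
  rmap (rsum V W) x y v = (rmap V x y v.1, rmap W x y v.2).
Proof. exact: lfunE. Qed.

Lemma pair_linear X V W (f : fam X V) (g : fam X W) x :
  linear (fun v => (f x v, g x v) : rsum V W x).
Proof. by move=> a u v; rewrite !linearP. Qed.

Definition fam_pair X V W (f : fam X V) (g : fam X W) : fam X (rsum V W) :=
  fun x => lfun_of (@pair_linear X V W f g x).

Lemma fam_pairE X V W (f : fam X V) (g : fam X W) x v :
  fam_pair f g x v = (f x v, g x v).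
Proof. exact: lfun_ofE. Qed.

Lemma copair_linear X V W (f : fam V X) (g : fam W X) x :
  linear (fun v : rsum V W x => f x v.1 + g x v.2).
Proof. by move=> a u v; rewrite !linearP /= scalerDr addrACA. Qed.

Definition fam_copair X V W (f : fam V X) (g : fam W X) : fam (rsum V W) X :=
  fun x => lfun_of (@copair_linear X V W f g x).

Lemma fam_copairE X V W (f : fam V X) (g : fam W X) x v :
  fam_copair f g x v = f x v.1 + g x v.2.
Proof. exact: lfun_ofE. Qed.

Definition fam_inl V W : fam V (rsum V W) := fam_pair (fam_id V) (fam_zero V W).
Definition fam_inr V W : fam W (rsum V W) := fam_pair (fam_zero W V) (fam_id W).
Definition fam_fst V W : fam (rsum V W) V := fam_copair (fam_id V) (fam_zero W V).
Definition fam_snd V W : fam (rsum V W) W := fam_copair (fam_zero V W) (fam_id W).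

Lemma fam_inlE V W x v : fam_inl V W x v = (v, 0).
Proof. by rewrite fam_pairE id_lfunE zero_lfunE. Qed.
Lemma fam_inrE V W x v : fam_inr V W x v = (0, v).
Proof. by rewrite fam_pairE id_lfunE zero_lfunE. Qed.
Lemma fam_fstE V W x v : fam_fst V W x v = v.1.
Proof. by rewrite fam_copairE id_lfunE zero_lfunE addr0. Qed.
Lemma fam_sndE V W x v : fam_snd V W x v = v.2.
Proof. by rewrite fam_copairE id_lfunE zero_lfunE add0r. Qed.

Lemma mor_id V : is_mor (fam_id V).
Proof. by move=> x y _ v; rewrite !id_lfunE. Qed.

Lemma mor_zero V W : is_mor (fam_zero V W).
Proof. by move=> x y _ v; rewrite !zero_lfunE linear0. Qed.

Lemma mor_comp U V W (g : fam V W) (f : fam U V) :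
  is_mor g -> is_mor f -> is_mor (fam_comp g f).
Proof. by move=> gm fm x y yx v; rewrite !comp_lfunE fm // gm. Qed.

Lemma mor_add V W (f g : fam V W) :
  is_mor f -> is_mor g -> is_mor (fam_add f g).
Proof. by move=> fm gm x y yx v; rewrite !add_lfunE linearD fm // gm. Qed.

Lemma mor_scale V W c (f : fam V W) : is_mor f -> is_mor (fam_scale c f).
Proof. by move=> fm x y yx v; rewrite !scale_lfunE linearZ fm. Qed.

Lemma mor_pair X V W (f : fam X V) (g : fam X W) :
  is_mor f -> is_mor g -> is_mor (fam_pair f g).
Proof.
by move=> fm gm x y yx v; rewrite rmap_sumE !fam_pairE fm // gm.
Qed.

Lemma mor_copair X V W (f : fam V X) (g : fam W X) :
  is_mor f -> is_mor g -> is_mor (fam_copair f g).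
Proof.
by move=> fm gm x y yx v; rewrite !fam_copairE rmap_sumE linearD /= fm // gm.
Qed.

Lemma mor_inl V W : is_mor (fam_inl V W).
Proof. by apply: mor_pair; [exact: mor_id | exact: mor_zero]. Qed.
Lemma mor_inr V W : is_mor (fam_inr V W).
Proof. by apply: mor_pair; [exact: mor_zero | exact: mor_id]. Qed.
Lemma mor_fst V W : is_mor (fam_fst V W).
Proof. by apply: mor_copair; [exact: mor_id | exact: mor_zero]. Qed.
Lemma mor_snd V W : is_mor (fam_snd V W).
Proof. by apply: mor_copair; [exact: mor_zero | exact: mor_id]. Qed.

Lemma bij_iso V W (f : fam V W) : is_mor f -> is_mono f -> is_epi f -> is_iso f.
Proof.
move=> fm fi fe; split=> //.
have fK x : cancel (f x) (f x)^-1%VF.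
  by apply/lker0_lfunK/lker0P; exact: fi.
have fVK x : cancel (f x)^-1%VF (f x).
  by move=> w; have [v <-] := fe x w; rewrite fK.
exists (fun x => (f x)^-1%VF); split=> // x y yx w.
by rewrite -[w in LHS]fVK -fm // fK.
Qed.

Lemma iso_mono V W (f : fam V W) : is_iso f -> is_mono f.
Proof. by move=> [_ [g [_ gf]]] x; apply: can_inj (gf x).1. Qed.

Lemma iso_sym V W : iso V W -> iso W V.
Proof.
move=> [f [fm [g [gm fg]]]]; exists g; split=> //; exists f; split=> // x.
by case: (fg x).
Qed.

Lemma iso_refl V : iso V V.
Proof.
exists (fam_id V); split; first exact: mor_id.
by exists (fam_id V); split; [exact: mor_id | split=> v; rewrite !id_lfunE].
Qed.

Lemma iso_trans U V W : iso U V -> iso V W -> iso U W.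
Proof.
move=> [f [fm [g [gm fg]]]] [f' [fm' [g' [gm' fg']]]].
exists (fam_comp f' f); split; first exact: mor_comp.
exists (fam_comp g g'); split; first exact: mor_comp.
move=> x; split=> v; rewrite !comp_lfunE.
  by rewrite (fg' x).1 (fg x).1.
by rewrite (fg x).2 (fg' x).2.
Qed.

Lemma iso_rsumC V W : iso (rsum V W) (rsum W V).
Proof.
exists (fam_pair (fam_snd V W) (fam_fst V W)); split.
  by apply: mor_pair; [exact: mor_snd | exact: mor_fst].
exists (fam_pair (fam_snd W V) (fam_fst W V)); split.
  by apply: mor_pair; [exact: mor_snd | exact: mor_fst].
by move=> x; split=> -[v w]; rewrite !fam_pairE !fam_sndE !fam_fstE.
Qed.

Lemma in_rep_epi V W (p : fam V W) : in_rep V -> is_mor p -> is_epi p -> in_rep W.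
Proof.
move=> [s [sP [q [qm qe]]]] pm pe; exists s; split=> //.
exists (fam_comp p q); split; first exact: mor_comp.
move=> x w; have [v <-] := pe x w; have [u <-] := qe x v.
by exists u; rewrite comp_lfunE.
Qed.

Lemma dirsum_join Z (s1 s2 : seq (interval R))
    (q1 : fam (dirsum k A s1) Z) (q2 : fam (dirsum k A s2) Z) :
  is_mor q1 -> is_mor q2 ->
  exists q : fam (dirsum k A (s1 ++ s2)) Z, is_mor q /\
    forall x v1 v2, exists v, q x v = q1 x v1 + q2 x v2.
Proof.
elim: s1 q1 => [|I s1 IH] q1 q1m q2m.
  exists q2; split=> // x v1 v2; exists v2.
  have -> : v1 = 0 by apply: thinmx0.
  by rewrite linear0 add0r.
have [] := IH (fam_comp q1 (@fam_inr (M k A I) (dirsum k A s1))).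
- by apply: mor_comp => //; exact: mor_inr.
- by [].
move=> q [qm qE].
exists (fam_copair (fam_comp q1 (@fam_inl (M k A I) (dirsum k A s1))) q); split.
  by apply: mor_copair => //; apply: mor_comp => //; exact: mor_inl.
move=> x [u v1] v2; have [v qv] := qE x v1 v2; exists (u, v).
rewrite fam_copairE /= qv !comp_lfunE addrA; congr (_ + _).
transitivity (q1 x (@fam_inl (M k A I) (dirsum k A s1) x u +
                    @fam_inr (M k A I) (dirsum k A s1) x v1)).
  by rewrite -linearD.
congr (q1 x _); rewrite fam_inlE fam_inrE.
by congr (_, _); rewrite ?addr0 ?add0r.
Qed.

Lemma in_rep_join Z V W (f : fam V Z) (g : fam W Z) :
  in_rep V -> in_rep W -> is_mor f -> is_mor g ->
  (forall x z, exists v w, z = f x v + g x w) -> in_rep Z.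
Proof.
move=> [s [sP [q [qm qe]]]] [t [tP [p [pm pe]]]] fm gm fg.
have [r [rm rE]] := dirsum_join (mor_comp fm qm) (mor_comp gm pm).
exists (s ++ t); split; first by move=> I; rewrite mem_cat => /orP[/sP|/tP].
exists r; split=> // x z; have [v [w ->]] := fg x z.
have [v' <-] := qe x v; have [w' <-] := pe x w.
by have [u uE] := rE x v' w'; exists u; rewrite uE !comp_lfunE.
Qed.

Lemma in_rep_sum V W : in_rep V -> in_rep W -> in_rep (rsum V W).
Proof.
move=> hV hW; apply: (in_rep_join hV hW (@mor_inl V W) (@mor_inr V W)).
move=> x [v w]; exists v, w; rewrite fam_inlE fam_inrE.
by congr (_, _); rewrite ?addr0 ?add0r.
Qed.

Lemma in_rep_cover J (s : seq (interval R)) :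
  (forall I, I \in s -> indec_projective_itv A I /\ hom A I J) ->
  (forall x, x \in J -> exists2 I, I \in s & x \in I) -> in_rep (M k A J).
Proof.
move=> sP sJ; exists s; split; first by move=> I /sP[].
suff [q [qm qe]] : exists q : fam (dirsum k A s) (M k A J), is_mor q /\
    forall x I, x \in J -> I \in s -> x \in I -> forall w, exists v, q x v = w.
  exists q; split=> // x w; have /orP[xJ|xJ] := orbN (x \in J).
    by have [I Is xI] := sJ x xJ; apply: qe xI w.
  by exists 0; apply: row_false.
have {sJ}: forall I, I \in s -> hom A I J by move=> I /sP[].
elim: s {sP} => [|I s IH] sH.
  by exists (fam_zero _ _); split=> //; exact: mor_zero.
have [|q [qm qe]] := IH; first by move=> K Ks; apply: sH; rewrite inE Ks orbT.
exists (fam_copair (can I J) q); split.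
  by apply: mor_copair => //; apply/can_mor/sH; rewrite mem_head.
move=> x K xJ; rewrite inE => /orP[/eqP-> xI w|Ks xK w].
  exists (const_mx (cf w) : 'rV_(x \in I), 0); rewrite fam_copairE linear0 addr0 canE.
  by rewrite [X in const_mx X]cf_const xI; exact: cfK.
have [v qv] := qe x K xJ Ks xK w; exists (0, v).
by rewrite fam_copairE qv /= linear0 add0r.
Qed.

Lemma dirsum_supp (s : seq (interval R)) x (v : dirsum k A s x) :
  v <> 0 -> exists2 I, I \in s & x \in I.
Proof.
elim: s v => [|I s IH] v v0; first by case: v0; apply: thinmx0.
case: v v0 => v w v0; have [xI|xI] := pselect (x \in I).
  by exists I; rewrite ?mem_head.
have [w0|w0] := pselect (w = 0).
  case: v0; rewrite w0; congr (_, _); apply: row_false; exact/negP.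
by have [K Ks xK] := IH w w0; exists K; rewrite // inE Ks orbT.
Qed.

End RepTheory.

(** * Finitely supported intervals *)

Section FiniteSupport.
Variables (k : fieldType) (R : realType) (A : contA R).
Implicit Types (I J K : interval R) (U V W X Y Z : rep k A) (x y z : R).

Lemma itv_of (X : set R) : is_interval X -> exists I : interval R, [set` I] = X.
Proof. by move=> /is_intervalP XE; exists (Rhull X); rewrite [RHS]XE. Qed.

Lemma inseg_qle_total n x y : inseg A n x -> inseg A n y ->
  qle A x y \/ qle A y x.
Proof.
move=> xn yn; case e: (evenz n); case/orP: (le_total x y) => xy.
- by left; apply: (seg_qle xn yn); rewrite e.
- by right; apply: (seg_qle yn xn); rewrite e.
- by right; apply: (seg_qle yn xn); rewrite e.
- by left; apply: (seg_qle xn yn); rewrite e.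
Qed.

(** The segment is a chain, so the down closure of J is convex and depends only on how J ends at the
    top: a largest element gives P_a, a missing bound gives P_a) or P_(a, and an unbounded J gives
    the projective at an infinite source. *)
Lemma seg_generator n (J : set R) :
  (forall x, J x -> inseg A n x) -> J !=set0 ->
  exists I, indec_projective_itv A I /\
    forall x, x \in I <-> exists2 j, J j & qle A x j.
Proof.
move=> Jn [j0 Jj0]; pose P : set R := [set x | exists2 j, J j & qle A x j].
have [hn hn1 j0n] := Jn j0 Jj0.
have Pitv : is_interval P.
  move=> x y [j1 Jj1 xj1] [j2 Jj2 yj2] z /andP[xz zy].
  have [j Jj [xj yj]] : exists2 j, J j & qle A x j /\ qle A y j.
    case: (inseg_qle_total (Jn _ Jj1) (Jn _ Jj2)) => j12.
      by exists j2 => //; split=> //; apply: qle_trans j12.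
    by exists j1 => //; split=> //; apply: qle_trans j12.
  exists j => //; case/orP: (le_total z j) => zj.
    by apply: (qle_mid xj _).2; rewrite xz zj.
  by apply: (qle_mid yj _).2; rewrite zy zj orbT.
have [I IE] := itv_of Pitv.
have IP x : x \in I <-> P x by rewrite -IE.
exists I; split; last exact: IP.
split; first by exists j0; apply/IP; exists j0 => //; exact: qle_refl.
rewrite IE {IE IP I}; case: (boolP (evenz n)) => en.
  have [[b Jb bmax]|nmax] := pselect (exists2 b, J b & forall j, J j -> j <= b).
    suff -> : P = [set x | qle A x b] by exact: ProjPt.
    apply/seteqP; split=> x /=; last by exists b.
    move=> [j Jj xj]; apply: qle_trans xj _; apply: (seg_qle (Jn _ Jj) (Jn _ Jb)).
    by rewrite en bmax.
  have gt j : J j -> exists2 i, J i & j < i.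
    move=> Jj; apply: contrapT => H; apply: nmax; exists j => // i Ji.
    by rewrite leNgt; apply/negP => ji; apply: H; exists i.
  have [[b bub]|nub] := pselect (exists b, forall j, J j -> j <= b).
    have hs : has_sup J by split; [exists j0 | exists b].
    have Js j : J j -> j < sup J.
      by move=> /gt[i Ji ji]; apply: lt_le_trans ji _; apply: ub_le_sup => //; exact: hs.2.
    have sn : inseg A n (sup J).
      split=> //; apply/andP; split.
        by case/andP: j0n => /le_trans + _; apply; rewrite lee_fin ltW // Js.
      case E: (pt A (n + 1)) => [r| |]; rewrite ?leey //.
        rewrite lee_fin; apply: ge_sup; first by exists j0.
        by move=> j /Jn[_ _]; rewrite E lee_fin => /andP[].
      by case/andP: j0n; rewrite E leeNy_eq.
    suff -> : P = [set x | qle A x (sup J) /\ x < sup J] by exact: ProjLt.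
    apply/seteqP; split=> x /=.
      move=> [j Jj xj]; have js : qle A j (sup J).
        by apply: (seg_qle (Jn _ Jj) sn); rewrite en ltW ?Js.
      split; first exact: qle_trans js.
      rewrite ltNge; apply/negP => sx.
      have [_ sj] : qle A x (sup J) /\ qle A (sup J) j.
        by apply: (qle_mid xj); rewrite sx (ltW (Js j Jj)) orbT.
      by have := Js j Jj; rewrite (qle_anti js sj) ltxx.
    move=> [xs xs']; have [j Jj xj] := sup_gt (ex_intro _ j0 Jj0) xs'.
    by exists j => //; apply: (qle_mid xs _).1; rewrite (ltW xj) ltW ?Js.
  (* Without an upper bound the segment ends at +oo, whose index n + 1 is odd, so that +oo is a
     source of finite index. *)
  have n1oo : pt A (n + 1) = +oo%E.
    case E: (pt A (n + 1)) => [r| |] //.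
      by case: nub; exists r => j /Jn[_ _]; rewrite E lee_fin => /andP[].
    by case/andP: j0n; rewrite E leeNy_eq.
  suff -> : P = [set x | (pt A (n + 1 - 1) <= x%:E)%E].
    by apply: ProjPy => //; rewrite evenzS en.
  rewrite addrK; apply/seteqP; split=> x /=.
    move=> [j Jj xj]; rewrite leNgt; apply/negP => xn.
    have [_ _ /andP[nj _]] := Jn j Jj.
    have [r [rE /andP[xr rj]]] := ereal_between (ltW xn) nj.
    have xr' : qle A x r by apply: (qle_mid xj _).1; rewrite xr rj.
    by have := sink_min hn rE en xr'; move: xn; rewrite rE lte_fin => /lt_eqF/eqP.
  move=> nx; have [j Jj xj] : exists2 j, J j & x <= j.
    apply: contrapT => H; apply: nub; exists x => j Jj.
    by rewrite leNgt; apply/negP => xj; apply: H; exists j => //; exact: ltW.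
  exists j => //; apply: (@seg_qle _ _ n) (Jn _ Jj) _; last by rewrite en.
  by split=> //; rewrite nx n1oo leey.
have [[b Jb bmin]|nmin] := pselect (exists2 b, J b & forall j, J j -> b <= j).
  suff -> : P = [set x | qle A x b] by exact: ProjPt.
  apply/seteqP; split=> x /=; last by exists b.
  move=> [j Jj xj]; apply: qle_trans xj _; apply: (seg_qle (Jn _ Jj) (Jn _ Jb)).
  by rewrite (negPf en) bmin.
have gt j : J j -> exists2 i, J i & i < j.
  move=> Jj; apply: contrapT => H; apply: nmin; exists j => // i Ji.
  by rewrite leNgt; apply/negP => ji; apply: H; exists i.
have [[b blb]|nlb] := pselect (exists b, forall j, J j -> b <= j).
  have hs : has_inf J by split; [exists j0 | exists b].
  have Js j : J j -> inf J < j.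
    by move=> /gt[i Ji ji]; apply: le_lt_trans ji; apply: ge_inf => //; exact: hs.2.
  have sn : inseg A n (inf J).
    split=> //; apply/andP; split; last first.
      by case/andP: j0n => _; apply: le_trans; rewrite lee_fin ltW // Js.
    case E: (pt A n) => [r| |]; rewrite ?leNye //.
      rewrite lee_fin; apply: lb_le_inf; first by exists j0.
      by move=> j /Jn[_ _]; rewrite E lee_fin => /andP[].
    by case/andP: j0n; rewrite E leye_eq.
  suff -> : P = [set x | qle A x (inf J) /\ inf J < x] by exact: ProjGt.
  apply/seteqP; split=> x /=.
    move=> [j Jj xj]; have js : qle A j (inf J).
      by apply: (seg_qle (Jn _ Jj) sn); rewrite (negPf en) ltW ?Js.
    split; first exact: qle_trans js.
    rewrite ltNge; apply/negP => sx.
    have [_ sj] : qle A x (inf J) /\ qle A (inf J) j.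
      by apply: (qle_mid xj); rewrite sx (ltW (Js j Jj)).
    by have := Js j Jj; rewrite (qle_anti js sj) ltxx.
  move=> [xs xs']; have [j Jj xj] := inf_lt (ex_intro _ j0 Jj0) xs'.
  by exists j => //; apply: (qle_mid xs _).1; rewrite (ltW xj) (ltW (Js _ _)) ?orbT.
have noo : pt A n = -oo%E.
  case E: (pt A n) => [r| |] //.
    by case: nlb; exists r => j /Jn[_ _]; rewrite E lee_fin => /andP[].
  by case/andP: j0n; rewrite E leye_eq.
suff -> : P = [set x | (x%:E <= pt A (n + 1))%E] by apply: ProjNy.
apply/seteqP; split=> x /=.
  move=> [j Jj xj]; rewrite leNgt; apply/negP => xn.
  have [_ _ /andP[_ jn]] := Jn j Jj.
  have [r [rE /andP[jr rx]]] := ereal_between jn (ltW xn).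
  have xr' : qle A x r by apply: (qle_mid xj _).1; rewrite jr rx orbT.
  have en1 : evenz (n + 1) by rewrite evenzS.
  by have := sink_min hn1 rE en1 xr'; move: xn; rewrite rE lte_fin => /gt_eqF/eqP.
move=> nx; have [j Jj xj] : exists2 j, J j & j <= x.
  apply: contrapT => H; apply: nlb; exists x => j Jj.
  by rewrite leNgt; apply/negP => xj; apply: H; exists j => //; exact: ltW.
exists j => //; apply: (@seg_qle _ _ n) (Jn _ Jj) _; last by rewrite (negPf en).
by split=> //; rewrite nx noo leNye.
Qed.

(** The indices are integers, so the support may be unbounded only on a side where the infinite
    element has a finite index. *)
Definition fin_supp (X : set R) := exists m n,
  [/\ has_idx A m, has_idx A n & forall x, X x -> (pt A m <= x%:E <= pt A n)%E].

Lemma hom_of_generated I J : (forall x y, x \in I -> qle A y x -> y \in I) ->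
  (forall x, x \in I -> exists2 j, j \in J & qle A x j) -> hom A I J.
Proof.
move=> Id IJ x y yx xI yJ; have [j jJ xj] := IJ x xI.
rewrite (Id x y) //; apply/esym.
by case/orP: (qle_between yx xj); apply: itv_convex.
Qed.

(** Each of the finitely many segments contributes one projective, the down closure of the part of J
    in it; these cover J and the canonical maps to M_J are morphisms. *)
Lemma in_rep_fin J : fin_supp [set` J] -> in_rep (M k A J).
Proof.
move=> [m [n [hm hn Jmn]]].
have [[x0 x0J]|Jempty] := pselect (exists x, x \in J); last first.
  apply: (@in_rep_cover _ _ _ J [::]) => // x xJ; case: Jempty; by exists x.
suff [s [sP sJ]] : exists s : seq (interval R),
    (forall I, I \in s -> indec_projective_itv A I /\ hom A I J) /\
    (forall x, x \in J -> (x%:E <= pt A n)%E -> exists2 I, I \in s & x \in I).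
  apply: (@in_rep_cover k R A J s) => // x xJ; apply: sJ => //.
  by case/andP: (Jmn x xJ).
have mn : m <= n.
  by have /andP[mx xn] := Jmn x0 x0J; rewrite -(pt_le hm hn) (le_trans mx xn).
have {mn} : exists d : nat, n = m + d%:Z.
  by exists (absz (n - m)%R); rewrite gez0_abs ?subr_ge0 // addrC subrK.
have {Jmn} : forall x, x \in J -> (pt A m <= x%:E)%E by move=> x /Jmn/andP[].
move=> Jm {x0 x0J} [d]; elim: d n hn => [|d IH] n hn nE.
  (* No segment is left: only the point s_m itself can remain, and its down closure supports a
     projective. *)
  rewrite addr0 in nE; have [[r rJ]|nex] := pselect (exists2 r, r \in J & pt A n = r%:E).
    move=> rE; pose P : set R := [set x | qle A x r].
    have Pitv : is_interval P.
      move=> x y /= xr yr z /andP[xz zy]; case/orP: (le_total z r) => zr.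
        by apply: (qle_mid xr _).2; rewrite xz zr.
      by apply: (qle_mid yr _).2; rewrite zr zy orbT.
    have [I IE] := itv_of Pitv.
    have IP x : x \in I <-> P x by rewrite -IE.
    exists [:: I]; split; last first.
      move=> x xJ xn; exists I; rewrite ?mem_head //; apply/IP.
      have : x%:E = r%:E by rewrite -rE; apply/le_anti; rewrite xn nE Jm.
      by move=> [->]; exact: qle_refl.
    move=> K; rewrite inE => /eqP ->; split.
      split; first by exists r; apply/IP; exact: qle_refl.
      by rewrite IE; exact: ProjPt.
    apply: hom_of_generated; last by move=> x /IP xr; exists r.
    by move=> x y /IP xr yx; apply/IP; apply: qle_trans xr.
  exists [::]; split=> // x xJ xn; case: nex; exists x => //.
  by apply/le_anti; rewrite xn nE Jm.
have mn : m <= n by rewrite nE lerDl.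
have hn' : has_idx A (m + d%:Z).
  by apply: (idx_between hm hn); rewrite ?lerDl // nE lerD2l lez_nat.
have [s [sP sJ]] := IH _ hn' erefl.
have nE' : n = m + d%:Z + 1 by rewrite nE -addn1 PoszD addrA.
have [[x0 x0J x0n]|nex] := pselect (exists2 x, x \in J & inseg A (m + d%:Z) x); last first.
  exists s; split=> // x xJ xn; have [|xm] := leP x%:E (pt A (m + d%:Z)); first exact: sJ.
  by case: nex; exists x => //; split; rewrite -?nE' // (ltW xm).
have [||I [Ip IE]] := @seg_generator (m + d%:Z) [set x | x \in J /\ inseg A (m + d%:Z) x].
- by move=> x [].
- by exists x0.
exists (I :: s); split.
  move=> K; rewrite inE => /orP[/eqP->|]; last exact: sP.
  split=> //; apply: hom_of_generated.
    by move=> x y /IE[j jJ xj] yx; apply/IE; exists j => //; apply: qle_trans xj.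
  by move=> x /IE[j [jJ _] xj]; exists j.
move=> x xJ xn; have [xm|xm] := leP x%:E (pt A (m + d%:Z)).
  by have [K Ks xK] := sJ x xJ xm; exists K; rewrite // inE Ks orbT.
exists I; rewrite ?mem_head //; apply/IE; exists x; last exact: qle_refl.
by split=> //; split; rewrite -?nE' // (ltW xm).
Qed.

Lemma fin_supp_sub (X Y : set R) : X `<=` Y -> fin_supp Y -> fin_supp X.
Proof.
by move=> XY [m [n [hm hn Ymn]]]; exists m, n; split=> // x /XY/Ymn.
Qed.

Lemma fin_suppU (X Y : set R) : fin_supp X -> fin_supp Y -> fin_supp (X `|` Y).
Proof.
move=> [m [n [hm hn Xmn]]] [m' [n' [hm' hn' Ymn]]].
exists (Num.min m m'), (Num.max n n').
have hm2 : has_idx A (Num.min m m') by rewrite /Num.min; case: ifP.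
have hn2 : has_idx A (Num.max n n') by rewrite /Num.max; case: ifP.
split=> // x [/Xmn|/Ymn] /andP[mx xn].
  rewrite (le_trans _ mx) ?(le_trans xn) ?pt_le ?ge_min ?le_max ?lexx //.
rewrite (le_trans _ mx) ?(le_trans xn) ?pt_le ?ge_min ?le_max ?lexx ?orbT //.
Qed.

Lemma fin_supp_comparable a : fin_supp [set x | qle A x a \/ qle A a x].
Proof.
have [n [[hn hn1 /andP[na an]] an']] := seg_exists A a.
(* If a = s_n, the points left of s_n are comparable to a as well; there are none when s_n = -oo. On
   the right s_(n+1) suffices because a < s_(n+1). *)
pose m := if (-oo < pt A n)%E then n - 1 else n.
have hm : has_idx A m by rewrite /m; case: ifP => // /(idx_pred hn).
exists m, (n + 1); split=> // x xa.
have [i [xi ai]] : exists i, inseg A i x /\ inseg A i a.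
  by case: xa => /qle_witness[i [? ? _]]; exists i.
case: xi ai => hi hi1 /andP[ix xi] [_ _ /andP[ia ai]].
have i_n : i <= n by rewrite -ltzD1 -(pt_lt hi hn1) (le_lt_trans ia an').
have ni : n <= i + 1 by rewrite -(pt_le hn hi1) (le_trans na ai).
have mi : m <= i.
  rewrite /m; case: ifP => [_|noo]; first by rewrite lerBlDr.
  rewrite leNgt; apply/negP => i_n'; move: noo.
  by rewrite (le_lt_trans _ (_ : pt A i < _)%E) ?leNye ?pt_lt.
rewrite (le_trans _ ix) ?pt_le //= (le_trans xi) // pt_le //.
by rewrite lerD2r.
Qed.

Lemma fin_supp_proj (X : set R) : proj_supp A X -> fin_supp X.
Proof.
case=> [a|a|a|n hn en noo|n hn en noo].
- by apply: fin_supp_sub (fin_supp_comparable a) => x /=; left.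
- by apply: fin_supp_sub (fin_supp_comparable a) => x /= []; left.
- by apply: fin_supp_sub (fin_supp_comparable a) => x /= []; left.
- exists n, (n + 1); split=> //; first by apply: idx_succ; rewrite // noo.
  by move=> x /= xn; rewrite noo leNye.
- exists (n - 1), n; split=> //; first by apply: idx_pred; rewrite // noo.
  by move=> x /= xn; rewrite noo leey andbT.
Qed.

Lemma in_rep_supp V : in_rep V -> fin_supp [set x | exists v : V x, v <> 0].
Proof.
move=> [s [sP [q [qm qe]]]].
have : fin_supp [set x | exists2 I, I \in s & x \in I].
  elim: s sP {q qm qe} => [|I s IH] sP.
    by exists 0, 0; split=> //; [exact: cA_idx0 | exact: cA_idx0 | move=> x []].
  have := fin_suppU (fin_supp_proj (sP I (mem_head _ _)).2)
    (IH (fun K Ks => sP K (mem_behead (s := I :: s) Ks))).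
  apply: fin_supp_sub => x [K]; rewrite inE => /orP[/eqP->|Ks xK]; first by left.
  by right; exists K.
apply: fin_supp_sub => x [v v0]; have [u uv] := qe x v.
by apply: (@dirsum_supp _ _ _ _ _ u) => u0; apply: v0; rewrite -uv u0 linear0.
Qed.

Lemma in_rep_itvP J : in_rep (M k A J) <-> fin_supp [set` J].
Proof.
split; last exact: in_rep_fin.
move=> /in_rep_supp; apply: fin_supp_sub => x xJ; exists (const_mx 1).
move=> E; have : cf (const_mx 1 : 'rV[k]_(x \in J)) = 0.
  rewrite (E : const_mx 1 = 0 :> 'rV_(x \in J)) /cf big1 // => i _.
  by rewrite mxE.
by rewrite cf_const (xJ : x \in J) => /eqP; rewrite oner_eq0.
Qed.

End FiniteSupport.

Lemma ex_argmin (T : Type) (P : set T) (f : T -> nat) : P !=set0 ->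
  exists2 x, P x & forall y, P y -> (f x <= f y)%N.
Proof.
move=> [x0 Px0]; have ex : exists n, `[< exists2 x, P x & f x = n >].
  by exists (f x0); apply/asboolP; exists x0.
case: (ex_minnP ex) => n /asboolP[x Px <-] H; exists x => // y Py.
by apply: H; apply/asboolP; exists y.
Qed.

Lemma ex_argmax (T : Type) (P : set T) (f : T -> nat) b : P !=set0 ->
  (forall x, P x -> (f x <= b)%N) ->
  exists2 x, P x & forall y, P y -> (f y <= f x)%N.
Proof.
move=> P0 fb; have [x Px H] := ex_argmin (fun x => b - f x)%N P0.
exists x => // y Py; have := H y Py; have := fb x Px; have := fb y Py; lia.
Qed.

(** * Local constancy *)

Section LinearBijections.
Variable k : fieldType.
Implicit Types U V : vectType k.

Lemma lfun_surj_dim U V (f : 'Hom(U, V)) : (forall w, exists v, f v = w) ->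
  (\dim {:V} <= \dim {:U})%N.
Proof.
move=> fs; have -> : {:V}%VS = limg f.
  apply/esym/eqP; rewrite eqEsubv subvf /=.
  by apply/subvP => w _; have [v <-] := fs w; rewrite memv_img ?memvf.
by rewrite -(limg_ker_dim f {:U}) leq_addl.
Qed.

Lemma lfun_surj_inj U V (f : 'Hom(U, V)) : (forall w, exists v, f v = w) ->
  (\dim {:U} <= \dim {:V})%N -> injective f.
Proof.
move=> fs UV; apply/lker0P; have fV : limg f = {:V}%VS.
  apply/eqP; rewrite eqEsubv subvf /=.
  by apply/subvP => w _; have [v <-] := fs w; rewrite memv_img ?memvf.
rewrite -dimv_eq0; have := limg_ker_dim f {:U}; rewrite fV capfv; lia.
Qed.

Lemma lfun_bij_inv U V (f : 'Hom(U, V)) : bijective f ->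
  cancel f f^-1%VF /\ cancel f^-1%VF f.
Proof.
move=> fb; have fK : cancel f f^-1%VF.
  by apply/lker0_lfunK/lker0P; exact: bij_inj.
split=> // w; have [g _ gK] := fb; by rewrite -[w in LHS]gK fK gK.
Qed.

End LinearBijections.

Section Tame.
Variables (k : fieldType) (R : realType) (A : contA R).
Implicit Types (I J K : interval R) (V W X : rep k A) (x y z : R).

(** Read [q z x] as z coming after x in C. Either I is left for good from some point on, or every
    point of C is followed by a point of I; in the second case any point after a point of I lies
    between two points of I. *)
Lemma itv_stable (q : R -> R -> Prop) (C : set R) I :
  (forall x y z, q x y -> q y z -> (x <= y <= z) || (z <= y <= x)) ->
  (forall x, q x x) -> C !=set0 ->
  exists2 z0, C z0 & forall z, C z -> q z z0 -> (z \in I) = (z0 \in I).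
Proof.
move=> qb qr [c Cc].
have [[z0 Cz0 H]|H] := pselect (exists2 z0, C z0 & forall z, C z -> q z z0 -> ~ z \in I).
  exists z0 => // z Cz zz0; apply/idP/idP => [zI|zI]; first by case: (H z Cz zz0).
  by case: (H z0 Cz0 (qr _)).
have {}H z : C z -> exists w, [/\ C w, q w z & w \in I].
  move=> Cz; apply: contrapT => nw; apply: H; exists z => // w Cw wz wI.
  by apply: nw; exists w.
have [w [Cw _ wI]] := H c Cc.
exists w => // z Cz zw; have [w' [_ w'z w'I]] := H z Cz.
by rewrite wI; case/orP: (qb _ _ _ w'z zw); apply: itv_convex.
Qed.

(* Membership in an interval is eventually constant along a directed set, so
   a quotient of finitely many M_I is eventually constant as well. *)
Lemma seq_itv_stable (q : R -> R -> Prop) (C : set R) (s : seq (interval R)) :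
  (forall x y z, q x y -> q y z -> (x <= y <= z) || (z <= y <= x)) ->
  (forall x y z, q x y -> q y z -> q x z) ->
  (forall x, q x x) -> C !=set0 ->
  (forall x y, C x -> C y -> exists2 z, C z & q z x /\ q z y) ->
  exists2 z0, C z0 & forall z, C z -> q z z0 ->
    forall I, I \in s -> (z \in I) = (z0 \in I).
Proof.
move=> qb qt qr C0 qd; elim: s => [|I s [z1 Cz1 H1]].
  by have [c Cc] := C0; exists c.
have [z2 Cz2 H2] := itv_stable I qb qr C0.
have [z3 Cz3 [z31 z32]] := qd _ _ Cz1 Cz2.
exists z3 => // z Cz zz3 J; rewrite inE => /orP[/eqP->|Js].
  by rewrite (H2 z) ?(H2 z3) //; apply: qt z32.
by rewrite (H1 z) ?(H1 z3) //; apply: qt z31.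
Qed.

Lemma dirsum_surj (s : seq (interval R)) x y :
  (forall I, I \in s -> (x \in I) = (y \in I)) ->
  forall w, exists v, rmap (dirsum k A s) x y v = w.
Proof.
elim: s => [|I s IH] xy w; first by exists 0; apply: etrans (thinmx0 _) (esym (thinmx0 _)).
case: w => w1 w2; have [v2 <-] := IH (fun K Ks => xy K (mem_behead (s := I :: s) Ks)) w2.
exists (const_mx (cf w1) : 'rV_(x \in I), v2); rewrite rmap_sumE; congr (_, _).
rewrite rmapME [X in const_mx X]cf_const.
have /orP[yI|yI] := orbN (y \in I); last exact: row_false.
by have -> : x \in I by [rewrite (xy I) ?mem_head]; exact: cfK.
Qed.

Lemma dirsum_dim (s : seq (interval R)) x : (\dim {:dirsum k A s x} <= size s)%N.
Proof.
elim: s => [|I s IH]; first by rewrite dimvf.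
move: IH; rewrite !dimvf /= => IH.
have -> : dim (rsum (M k A I) (dirsum k A s) x) =
    (dim (M k A I x) + dim (dirsum k A s x))%N by [].
have : (dim (M k A I x) <= 1)%N by rewrite /dim /=; case: (x \in I).
lia.
Qed.

Lemma rep_surj V (s : seq (interval R)) (q : fam (dirsum k A s) V) x y :
  is_mor q -> is_epi q -> qle A y x ->
  (forall I, I \in s -> (x \in I) = (y \in I)) ->
  forall w, exists v, rmap V x y v = w.
Proof.
move=> qm qe yx xy w; have [u <-] := qe y w.
have [v <-] := dirsum_surj xy u; exists (q x v).
by rewrite qm.
Qed.

Lemma lfun_bij (U' W' : vectType k) (f : 'Hom(U', W')) : (forall w, exists v, f v = w) ->
  injective f -> bijective f.
Proof.
move=> fs fi; exists f^-1%VF; first by apply/lker0_lfunK/lker0P.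
move=> w; have [v <-] := fs w; rewrite lker0_lfunK //; exact/lker0P.
Qed.

Lemma qle_between_conv x y z : qle A y x -> qle A z y ->
  (x <= y <= z) || (z <= y <= x).
Proof. by move=> yx zy; rewrite orbC; apply: qle_between zy yx. Qed.

(** Once all summands of the covering sum are stable, the maps of V are onto. The dimension then
    decreases downwards, and from its minimum on the maps are bijective. *)
Lemma tame_down V (C : set R) : in_rep V -> C !=set0 ->
  (forall x y, C x -> C y -> exists2 z, C z & qle A z x /\ qle A z y) ->
  exists2 z1, C z1 & forall z, C z -> qle A z z1 -> bijective (rmap V z1 z).
Proof.
move=> [s [_ [q [qm qe]]]] C0 Cd.
have [z0 Cz0 H] := @seq_itv_stable (qle A) C s
  (fun x y z xy yz => qle_between xy yz) (@qle_trans _ A) (@qle_refl _ A) C0 Cd.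
have surj z z' : C z -> C z' -> qle A z z0 -> qle A z' z ->
    forall w, exists v, rmap V z z' v = w.
  move=> Cz Cz' zz0 zz'; apply: (rep_surj qm qe zz') => I Is.
  by rewrite (H z) // (H z') //; apply: qle_trans zz0.
have [] := @ex_argmin _ [set z | C z /\ qle A z z0] (fun z => \dim {:V z}).
  by exists z0; split=> //; exact: qle_refl.
move=> z1 [Cz1 z10] zmin; exists z1 => // z Cz zz1.
have sz := surj z1 z Cz1 Cz z10 zz1.
apply: lfun_bij sz (lfun_surj_inj sz _).
by apply: zmin; split=> //; apply: qle_trans z10.
Qed.

(** Upwards, eventual surjectivity makes the dimension grow, so a maximum is needed; the number of
    summands of the covering sum bounds it. *)
Lemma tame_up V (C : set R) : in_rep V -> C !=set0 ->
  (forall x y, C x -> C y -> exists2 z, C z & qle A x z /\ qle A y z) ->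
  exists2 z1, C z1 & forall z, C z -> qle A z1 z -> bijective (rmap V z z1).
Proof.
move=> [s [_ [q [qm qe]]]] C0 Cd.
have [z0 Cz0 H] := @seq_itv_stable (fun x y => qle A y x) C s
  (fun x y z yx zy => qle_between_conv yx zy)
  (fun x y z yx zy => qle_trans zy yx) (@qle_refl _ A) C0 Cd.
have surj z z' : C z -> C z' -> qle A z0 z' -> qle A z' z ->
    forall w, exists v, rmap V z z' v = w.
  move=> Cz Cz' zz0 zz'; apply: (rep_surj qm qe zz') => I Is.
  by rewrite (H z) ?(H z') //; apply: qle_trans zz'.
have [||z1 [Cz1 z10] zmax] := @ex_argmax _ [set z | C z /\ qle A z0 z]
    (fun z => \dim {:V z}) (size s).
- by exists z0; split=> //; exact: qle_refl.
- move=> z _; apply: leq_trans (dirsum_dim s z).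
  by apply: (@lfun_surj_dim _ _ _ (q z)) => w; apply: qe.
exists z1 => // z Cz zz1.
have sz := surj z z1 Cz Cz1 z10 zz1.
apply: lfun_bij sz (lfun_surj_inj sz _).
by apply: zmax; split=> //; apply: qle_trans zz1.
Qed.

End Tame.

(** * Interval summands *)

Section Decomposition.
Variables (k : fieldType) (R : realType) (A : contA R).
Implicit Types (I J K : interval R) (V W : rep k A) (x y z : R).

Definition retract_of I V := Defs.nonempty I /\
  exists (h : fam (M k A I) V) (r : fam V (M k A I)),
    [/\ is_mor h, is_mor r & forall x v, r x (h x v) = v].

Section Families.
Variable X : rep k A.
Implicit Types (u w : forall x, X x) (f g : forall x, 'Hom(X x, k^o)).

Lemma rmapC x y z v : qle A y x -> qle A z y ->
  rmap X y z (rmap X x y v) = rmap X x z v.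
Proof. by move=> yx zy; rewrite (rmap_comp yx zy). Qed.

Definition compat_vec (C : set R) u := forall x y, qle A y x -> C x -> C y ->
  rmap X x y (u x) = u y.

Definition compat_fun (C : set R) f := forall x y, qle A y x -> C x -> C y ->
  forall v, f y (rmap X x y v) = f x v.

(** The family u is a morphism M_K -> X and f is a morphism X -> M_K. Their composite is a scalar
    that is constant on the connected set K, so its value 1 at x0 makes them split. *)
Lemma retract_of_compat K u f x0 : compat_vec [set` K] u ->
  compat_fun [set` K] f ->
  (forall x y, qle A y x -> x \in K -> ~ y \in K -> rmap X x y (u x) = 0) ->
  (forall x y, qle A y x -> ~ x \in K -> y \in K -> forall v, f y (rmap X x y v) = 0) ->
  x0 \in K -> f x0 (u x0) = 1 -> retract_of K X.
Proof.
move=> cu cf' bu bf x0K fu0.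
have fu x : x \in K -> f x (u x) = 1.
  move=> xK; rewrite -fu0.
  apply: (@qle_connected _ A _ (fun x => f x (u x)) (fun x => x \in K)) => //.
    by move=> a b c aK cK; apply: itv_convex.
  by move=> a b ba aK bK; rewrite -(cu a b) // (cf' a b).
have lh x : linear (fun v : M k A K x => cf v *: u x).
  by move=> a v w; rewrite (cf_linear a v w) scalerDl scalerA.
have lr x : linear (fun v : X x => const_mx (f x v) : M k A K x).
  move=> a v w; rewrite linearP; apply/rowP => j.
  by rewrite !mxE.
split; first by exists x0.
exists (fun x => lfun_of (lh x)), (fun x => lfun_of (lr x)); split.
- move=> x y yx v; rewrite (lfun_ofE (lh x)) (lfun_ofE (lh y)) rmapME linearZ /= cf_const.
  have /orP[xK|xK] := orbN (x \in K); last by rewrite cf_false // if_same !scale0r.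
  case: ifP => yK; first by rewrite cu.
  by rewrite scale0r bu ?scaler0 // yK.
- move=> x y yx v; rewrite (lfun_ofE (lr x)) (lfun_ofE (lr y)) rmapME; apply/row_const => yK.
  rewrite cf_const; case: ifP => xK; first by rewrite cf'.
  by rewrite bf // xK.
- move=> x v; rewrite !lfun_ofE linearZ /=.
  rewrite -[RHS]cfK; apply/row_const => xK.
  by rewrite fu // -[_ *: _]/(_ * _) mulr1.
Qed.

(** A relation between points on the two sides of p factors through p, because p lies between them
    on the line; agreement at p is therefore enough. The same holds for functionals. *)
Lemma glue_vec (P Y : set R) p u w :
  P p -> Y p -> (forall x, P x -> x <= p) -> (forall y, Y y -> p <= y) ->
  compat_vec P u -> compat_vec Y w -> u p = w p ->
  exists u', [/\ forall x, P x -> u' x = u x, forall y, Y y -> u' y = w y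
    & compat_vec (P `|` Y) u'].
Proof.
move=> Pp Yp Ple Yge cu cw uw.
pose u' x := if x <= p then u x else w x.
have u'P x : P x -> u' x = u x by move=> /Ple xp; rewrite /u' xp.
have u'Y y : Y y -> u' y = w y.
  move=> Yy; rewrite /u'; case: ifP => // yp.
  by have -> : y = p by apply/le_anti; rewrite yp Yge.
exists u'; split=> // x y yx [Px|Yx] [Py|Yy].
- by rewrite !u'P // cu.
- rewrite (u'P x) // (u'Y y) //.
  have [yp px] : qle A y p /\ qle A p x by apply: (qle_mid yx); rewrite (Ple x) ?(Yge y) ?orbT.
  by rewrite -(rmapC _ px yp) cu // uw cw.
- rewrite (u'Y x) // (u'P y) //.
  have [yp px] : qle A y p /\ qle A p x by apply: (qle_mid yx); rewrite (Ple y) ?(Yge x).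
  by rewrite -(rmapC _ px yp) cw // -uw cu.
- by rewrite !u'Y // cw.
Qed.

Lemma glue_fun (P Y : set R) p f g :
  P p -> Y p -> (forall x, P x -> x <= p) -> (forall y, Y y -> p <= y) ->
  compat_fun P f -> compat_fun Y g -> f p = g p ->
  exists f', [/\ forall x, P x -> f' x = f x, forall y, Y y -> f' y = g y
    & compat_fun (P `|` Y) f'].
Proof.
move=> Pp Yp Ple Yge cu cw uw.
pose u' x := if x <= p then f x else g x.
have u'P x : P x -> u' x = f x by move=> /Ple xp; rewrite /u' xp.
have u'Y y : Y y -> u' y = g y.
  move=> Yy; rewrite /u'; case: ifP => // yp.
  by have -> : y = p by apply/le_anti; rewrite yp Yge.
exists u'; split=> // x y yx [Px|Yx] [Py|Yy] v.
- by rewrite !u'P // cu.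
- rewrite (u'P x) // (u'Y y) //.
  have [yp px] : qle A y p /\ qle A p x by apply: (qle_mid yx); rewrite (Ple x) ?(Yge y) ?orbT.
  by rewrite -(rmapC _ px yp) cw // -uw cu.
- rewrite (u'Y x) // (u'P y) //.
  have [yp px] : qle A y p /\ qle A p x by apply: (qle_mid yx); rewrite (Ple y) ?(Yge x).
  by rewrite -(rmapC _ px yp) cu // uw cw.
- by rewrite !u'Y // cw.
Qed.

Variable l : set R.
Hypothesis l_up : forall x y, l x -> x <= y -> l y.
Hypothesis l_supp : forall x (v : X x), ~ l x -> v = 0.

(** The ray [l] contains the support of X; the summand built below begins at the left end of [l]. *)
Definition upto p : set R := [set x | l x /\ x <= p].

(* Glues the data found left of [p] to data on [Y], which starts at [p]; the
   right end of [Y] is the right end of the summand. *)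
Lemma stop_retract p (Y : set R) u f w g : l p -> Y p ->
  (forall y, Y y -> p <= y) ->
  (forall x y z, Y x -> Y z -> x <= y <= z -> Y y) ->
  compat_vec (upto p) u -> compat_fun (upto p) f ->
  compat_vec Y w -> compat_fun Y g -> u p = w p -> f p = g p ->
  f p (u p) = 1 ->
  (forall y z, Y y -> ~ Y z -> p < z -> qle A z y -> rmap X y z (w y) = 0) ->
  (forall y z, Y y -> ~ Y z -> p < z -> qle A y z ->
     forall v, g y (rmap X z y v) = 0) ->
  exists K, retract_of K X.
Proof.
move=> lp Yp Yge Yc cu cf' cw cg uw fg fu1 b1 b2.
have Pp : upto p p by split; rewrite /=.
have Ple x : upto p x -> x <= p by case.
have [u' [u'P u'Y cu']] := glue_vec Pp Yp Ple Yge cu cw uw.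
have [f' [f'P f'Y cf'']] := glue_fun Pp Yp Ple Yge cf' cg fg.
pose C : set R := [set x | l x /\ exists2 y, Y y & x <= y].
have [K KE] : exists I : interval R, [set` I] = C.
  apply: itv_of => x y [lx _] [ly [y' Yy' yy']] z /andP[xz zy].
  by split; [exact: l_up xz | exists y' => //; exact: le_trans yy'].
have KP x : x \in K <-> C x by rewrite -KE.
have Ksub x : x \in K -> (upto p `|` Y) x.
  move=> /KP[lx [y Yy xy]]; case: (leP x p) => xp; first by left.
  by right; apply: Yc Yp Yy _; rewrite xy ltW.
have KN x : l x -> ~ x \in K -> ~ Y x /\ p < x.
  move=> lx xK; split=> [Yx|].
    by apply: xK; apply/KP; split=> //; exists x.
  by rewrite ltNge; apply/negP => xp; apply: xK; apply/KP; split=> //; exists p.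
have pK : p \in K by apply/KP; split=> //; exists p.
exists K; apply: (@retract_of_compat K u' f' p) => //.
- by move=> x y yx /Ksub xK /Ksub yK; exact: cu'.
- by move=> x y yx /Ksub xK /Ksub yK; exact: cf''.
- move=> x y yx /Ksub[Px|Yx] yK.
    have [ly|ly] := pselect (l y); last exact: l_supp.
    have [nYy py] := KN y ly yK.
    have [yp px] : qle A y p /\ qle A p x.
      by apply: (qle_mid yx); rewrite (Ple x) // (ltW py) orbT.
    by rewrite -(rmapC _ px yp) cu' //; [rewrite u'Y // b1 | left | right].
  have [ly|ly] := pselect (l y); last exact: l_supp.
  have [nYy py] := KN y ly yK.
  by rewrite u'Y // b1.
- move=> x y yx xK /Ksub[Py|Yy] v.
    have [lx|lx] := pselect (l x); last by rewrite (l_supp v lx) !linear0.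
    have [nYx px] := KN x lx xK.
    have [yp px'] : qle A y p /\ qle A p x.
      by apply: (qle_mid yx); rewrite (Ple y) // (ltW px).
    rewrite -(rmapC _ px' yp) cf'' //; [|by right|by left].
    by rewrite f'Y // b2.
  have [lx|lx] := pselect (l x); last by rewrite (l_supp v lx) !linear0.
  by have [nYx px] := KN x lx xK; rewrite f'Y // b2.
- by rewrite u'P // f'P.
Qed.

End Families.
End Decomposition.

(** * Sweeping a representation from left to right *)

Section Walk.
Variables (k : fieldType) (R : realType) (A : contA R) (X : rep k A).
Implicit Types (x y z p q : R) (n : int).
Variable l : set R.
Hypothesis X_rep : in_rep X.
Hypothesis l_up : forall x y, l x -> x <= y -> l y.
Hypothesis l_supp : forall x (v : X x), ~ l x -> v = 0.

(* The part of [X] left of [p] is seen from [p] through a pair B <= A0 of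
   subspaces of [X p]: vectors of A0 extend to compatible families, and so do
   functionals killing B. *)
Definition left_state p (B A0 : {vspace X p}) := [/\ (B <= A0)%VS, ~~ (A0 <= B)%VS,
  forall v, v \in A0 -> exists u, u p = v /\ compat_vec (upto l p) u
  & forall psi : 'Hom(X p, k^o), (forall v, v \in B -> psi v = 0) ->
      exists f, f p = psi /\ compat_fun (upto l p) f].

(* On this segment [X y] maps to [X p] for y >= p.  If A0 is still reached,
   modulo B, from the far end, the pair is pulled back there; otherwise the
   summand ends where A0 stops being reached. *)
Lemma step_down n p (B A0 : {vspace X p}) :
  evenz n -> inseg A n p -> l p -> left_state B A0 ->
  (exists K, retract_of K X) \/
  exists q, [/\ pt A (n + 1) = q%:E, p <= q & exists B' A', @left_state q B' A'].
Proof.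
move=> en pn lp [BA AB vA fB].
pose E y := inseg A n y /\ p <= y.
have Eq y z : E y -> E z -> y <= z -> qle A y z.
  by move=> [yn _] [zn _] yz; apply: (seg_qle yn zn); rewrite en.
have Ep : E p by split.
have pE y : E y -> qle A p y by move=> Ey; apply: Eq => //; case: Ey.
have im_le y z : E y -> E z -> y <= z -> (limg (rmap X z p) <= limg (rmap X y p))%VS.
  move=> Ey Ez yz; apply/subvP => _ /memv_imgP[v _ ->].
  by rewrite -(rmapC v (Eq y z Ey Ez yz) (pE y Ey)) memv_img ?memvf.
pose surv y := (A0 <= limg (rmap X y p) + B)%VS.
have survP y : surv y -> forall a, a \in A0 ->
    exists w b, b \in B /\ a = rmap X y p w + b.
  move=> /subvP sy a /sy /memv_addP[_ /memv_imgP[w _ ->] [b bB ->]].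
  by exists w, b.
have surv_le y z : E y -> E z -> y <= z -> surv z -> surv y.
  move=> Ey Ez yz sz; apply: subv_trans sz _; apply: addvS => //; exact: im_le.
have surv_p : surv p.
  apply: subv_trans (addvSl _ _); apply/subvP => v _.
  by rewrite -[v](rmap_id v) memv_img ?memvf.
have [[q [qE Eq' sq]]|nwhole] := pselect (exists q, [/\ pt A (n + 1) = q%:E, E q & surv q]).
  right; exists q; split=> //; first by case: Eq'.
  have qp := pE _ Eq'; have pq := Eq'.2.
  exists (rmap X q p @^-1: B)%VS, (rmap X q p @^-1: A0)%VS; split.
  - by apply/subvP => v; rewrite -!memv_preim; apply/subvP.
  - apply/negP => /subvP H; case/subvPn: AB => a aA aB; case/negP: aB.
    have [w [b [bB aE]]] := survP q sq a aA; rewrite aE rpredD //.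
    rewrite memv_preim H // -memv_preim (_ : rmap X q p w = a - b).
      by rewrite rpredB // (subvP BA).
    by rewrite aE addrK.
  - move=> w; rewrite -memv_preim => /vA[u [up cu]].
    have [|||||u' [u'P u'Y cu']] := @glue_vec k R A X (upto l p)
      [set y | p <= y /\ y <= q] p u (fun x => rmap X q x w) _ _ _ _ cu _ up.
    + by split.
    + by split; rewrite /=.
    + by move=> x [].
    + by move=> x [].
    + move=> x y yx [px xq] [py yq].
      have Ey z : p <= z -> z <= q -> E z.
        by move=> pz zq; split=> //; apply: (inseg_between pn Eq'.1); rewrite pz zq.
      by rewrite (rmapC _ _ yx) //; apply: Eq => //; apply: Ey.
    exists u'; split; first by rewrite u'Y ?rmap_id //; split; rewrite /=.
    move=> x y yx [lx xq] [ly yq]; apply: cu' => //.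
      by case: (leP x p) => xp; [left | right; split=> //; apply: ltW].
    by case: (leP y p) => yp; [left | right; split=> //; apply: ltW].
  - move=> psi psiB.
    have [|phi [phiE phiB]] := @lfun_extend k _ _ (rmap X q p) B psi.
      by move=> w wB; apply: psiB; rewrite -memv_preim.
    have [f [fp cf']] := fB phi phiB.
    have [||||||f' [f'P f'Y cf'']] := @glue_fun k R A X (upto l p)
      [set y | p <= y /\ y <= q] p f (fun x => (phi \o rmap X x p)%VF) _ _ _ _ cf' _ _.
    + by split.
    + by split; rewrite /=.
    + by move=> x [].
    + by move=> x [].
    + move=> x y yx [px xq] [py yq] v.
      have Ey z : p <= z -> z <= q -> E z.
        by move=> pz zq; split=> //; apply: (inseg_between pn Eq'.1); rewrite pz zq.
      by rewrite !comp_lfunE rmapC //; apply: pE; apply: Ey.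
    + by rewrite fp; apply/lfunP => v; rewrite comp_lfunE rmap_id.
    exists f'; split.
      rewrite f'Y; last by split; rewrite /=.
      by apply/lfunP => v; rewrite comp_lfunE phiE.
    move=> x y yx [lx xq] [ly yq]; apply: cf'' => //.
      by case: (leP x p) => xp; [left | right; split=> //; apply: ltW].
    by case: (leP y p) => yp; [left | right; split=> //; apply: ltW].
left.
pose Y : set R := [set y | E y /\ surv y].
pose NS : set R := [set y | E y /\ ~ surv y].
(* If z lies past the whole segment, then s_(n+1) is a real point where A0 is no longer reached,
   since the case where it survives up to there has been settled. *)
have beyond z : ~ Y z -> p < z -> exists z', [/\ NS z', p < z' & z' <= z].
  move=> nYz pz; have [zn|zn] := pselect (inseg A n z).
    have Ez : E z by split=> //; exact: ltW.
    by exists z; split=> //; split=> // sz; apply: nYz.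
  case: (pn) => hn hn1 /andP[np pn1].
  have zn1 : (pt A (n + 1) <= z%:E)%E.
    rewrite leNgt; apply/negP => zn1; apply: zn; split=> //.
    by rewrite (ltW zn1) andbT (le_trans np) ?lee_fin ?ltW.
  have [q [qE /andP[pq qz]]] := ereal_between pn1 zn1.
  have Eq' : E q by split=> //; split=> //; rewrite qE lexx andbT (le_trans np) ?lee_fin.
  have nsq : ~ surv q by move=> sq; apply: nwhole; exists q.
  exists q; split=> //; rewrite lt_neqAle pq andbT; apply/eqP => pq'.
  by apply: nsq; rewrite -pq'.
(* The images in X p of the non-surviving points form a chain, and the one of largest dimension
   contains the others; so one subspace W accounts for everything that arrives from past the end of
   Y. *)
have [W [WA WN]] : exists W : {vspace X p}, ~~ (A0 <= W + B)%VS /\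
    forall z, NS z -> (limg (rmap X z p) <= W)%VS.
  have [[z0 NSz0]|N0] := pselect (exists z, NS z); last first.
    exists 0%VS; rewrite add0v; split=> // z NSz; case: N0; by exists z.
  have [||z [Ez nsz] zmax] := @ex_argmax _ NS (fun z => \dim (limg (rmap X z p))) (\dim {:X p}).
  - by exists z0.
  - by move=> z _; apply: dimvS; exact: subvf.
  exists (limg (rmap X z p)); split; first exact/negP.
  move=> y [Ey nsy]; case/orP: (le_total z y) => yz; first exact: im_le.
  have /eqP <- // : limg (rmap X z p) == limg (rmap X y p).
  rewrite eqEdim im_le //=; exact: zmax.
have Yp : Y p by split.
have Yc x y z : Y x -> Y z -> x <= y <= z -> Y y.
  move=> [Ex sx] [Ez sz] /andP[xy yz]; have Ey : E y.
    split; first by apply: (inseg_between Ex.1 Ez.1); rewrite xy yz.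
    by apply: le_trans xy; exact: Ex.2.
  by split=> //; apply: surv_le sz.
have Ydir x y : Y x -> Y y -> exists2 z, Y z & qle A x z /\ qle A y z.
  move=> Yx Yy; case/orP: (le_total x y) => xy.
    by exists y => //; split; [apply: Eq => //; [exact: Yx.1|exact: Yy.1] | exact: qle_refl].
  by exists x => //; split; [exact: qle_refl | apply: Eq => //; [exact: Yy.1|exact: Yx.1]].
(* Y may have no last point. Beyond z1 the maps of X are bijective on Y, so a preimage chosen at z1
   extends to all of Y. *)
have [z1 Yz1 z1b] := tame_up X_rep (ex_intro _ p Yp) Ydir.
have [Ez1 sz1] := Yz1.
have [a aA aW] := subvPn WA.
have [w1 [b [bB aE]]] := survP z1 sz1 a aA.
set v := rmap X z1 p w1 in aE.
have vA0 : v \in A0 by rewrite (_ : v = a - b) ?rpredB // ?(subvP BA) // aE addrK.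
have vW : v \notin (W + B)%VS.
  apply: contra aW => vW; rewrite aE rpredD //.
  by apply: subvP bB; exact: addvSr.
(* The functional has to kill B in order to extend to the left of p, and W in order to kill what
   comes from beyond Y. *)
have [psi [psiv psiW]] := lfun_separate vW.
have [u [up cu]] := vA v vA0.
have [f [fp cf']] : exists f, f p = psi /\ compat_fun (upto l p) f.
  by apply: fB => c cB; apply: psiW; apply: subvP cB; exact: addvSr.
pose w y := if y <= z1 then rmap X z1 y w1 else (rmap X y z1)^-1%VF w1.
have inv y : Y y -> z1 < y -> cancel (rmap X y z1) (rmap X y z1)^-1%VF /\
    cancel (rmap X y z1)^-1%VF (rmap X y z1).
  by move=> Yy zy; apply/lfun_bij_inv/z1b => //; apply: Eq => //; [exact: Yy.1 | exact: ltW].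
have Yq x y : Y x -> Y y -> x <= y -> qle A x y.
  by move=> [Ex _] [Ey _]; exact: Eq.
have Yle x y : E x -> E y -> qle A x y -> x <= y.
  by move=> [xn _] [yn _] /(qle_seg xn yn); rewrite en.
apply: (@stop_retract k R A X l l_up l_supp p Y u f w
         (fun x => (psi \o rmap X x p)%VF)) => //.
- by move=> y [[]].
- move=> x y yx Yx Yy; have yxle := Yle _ _ Yy.1 Yx.1 yx; rewrite /w.
  have [xz|xz] := leP x z1.
    by rewrite (le_trans yxle xz) rmapC //; exact: Yq.
  have [yz|yz] := leP y z1.
    by rewrite -(rmapC _ (Yq _ _ Yz1 Yx (ltW xz)) (Yq _ _ Yy Yz1 yz)) (inv x Yx xz).2.
  apply: (can_inj (inv y Yy yz).1).
  by rewrite (rmapC _ yx (Yq _ _ Yz1 Yy (ltW yz))) (inv x Yx xz).2 (inv y Yy yz).2.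
- move=> x y yx Yx Yy c; rewrite !comp_lfunE rmapC //; exact: pE Yy.1.
- by rewrite up /w Ez1.2.
- by rewrite fp; apply/lfunP => c; rewrite comp_lfunE rmap_id.
- by rewrite fp up.
- move=> y z Yy nYz pz zy; have [z' [[Ez' nsz'] pz' z'z]] := beyond z nYz pz.
  have yz' : y < z'.
    by rewrite ltNge; apply/negP => z'y; apply: nsz'; apply: surv_le z'y Yy.2 => //; exact: Yy.1.
  have [_ z'y] : qle A z z' /\ qle A z' y.
    by apply: (qle_mid zy); rewrite z'z (ltW yz') orbT.
  by have := Yle _ _ Ez' Yy.1 z'y; rewrite leNgt yz'.
- move=> y z Yy nYz pz yz c; rewrite comp_lfunE (rmapC _ yz (pE _ Yy.1)).
  have [z' [[Ez' nsz'] pz' z'z]] := beyond z nYz pz.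
  have pz'' : qle A p z by apply: qle_trans yz; exact: pE Yy.1.
  have [pz1 z'z1] : qle A p z' /\ qle A z' z.
    by apply: (qle_mid pz''); rewrite (ltW pz') z'z.
  rewrite -(rmapC _ z'z1 pz1); apply: psiW.
  apply: (subvP (addvSl _ _)); apply: (subvP (WN z' _)) => //.
  by rewrite memv_img ?memvf.
Qed.

(* On this segment [X p] maps to [X y] for y >= p: the pair is pushed forward
   to the far end, or the summand ends where a vector of A0 off B dies. *)
Lemma step_up n p (B A0 : {vspace X p}) :
  ~~ evenz n -> inseg A n p -> l p -> left_state B A0 ->
  (exists K, retract_of K X) \/
  exists q, [/\ pt A (n + 1) = q%:E, p <= q & exists B' A', @left_state q B' A'].
Proof.
move=> en pn lp [BA AB vA fB].
pose E y := inseg A n y /\ p <= y.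
have Eq y z : E y -> E z -> y <= z -> qle A z y.
  by move=> [yn _] [zn _] yz; apply: (seg_qle zn yn); rewrite (negPf en).
have Ep : E p by split.
have pE y : E y -> qle A y p by move=> Ey; apply: Eq => //; case: Ey.
have ker_le y z : E y -> E z -> y <= z -> (lker (rmap X p y) <= lker (rmap X p z))%VS.
  move=> Ey Ez yz; apply/subvP => v; rewrite !memv_ker => /eqP vy.
  by rewrite -(rmapC v (pE y Ey) (Eq y z Ey Ez yz)) vy linear0.
pose surv y := (A0 :&: lker (rmap X p y) <= B)%VS.
have survP y : surv y -> forall a, a \in A0 -> rmap X p y a = 0 -> a \in B.
  by move=> /subvP sy a aA a0; apply: sy; rewrite memv_cap aA memv_ker a0 eqxx.
have survB y : surv y -> forall a, a \in A0 -> a \notin B ->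
    rmap X p y a \notin (rmap X p y @: B)%VS.
  move=> sy a aA; apply: contra => /memv_imgP[b bB ab].
  have : a - b \in B.
    by apply: (survP y sy); rewrite ?linearB /= ?ab ?subrr // rpredB // (subvP BA).
  by move=> abB; rewrite -(subrK b a) rpredD.
have surv_le y z : E y -> E z -> y <= z -> surv z -> surv y.
  move=> Ey Ez yz; apply: subv_trans; apply: capvS => //; exact: ker_le.
have surv_p : surv p.
  apply/subvP => v; rewrite memv_cap memv_ker rmap_id => /andP[_ /eqP ->].
  exact: mem0v.
have [[q [qE Eq' sq]]|nwhole] := pselect (exists q, [/\ pt A (n + 1) = q%:E, E q & surv q]).
  right; exists q; split=> //; first by case: Eq'.
  have qp := pE _ Eq'; have pq := Eq'.2.
  have Ey z : p <= z -> z <= q -> E z.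
    by move=> pz zq; split=> //; apply: (inseg_between pn Eq'.1); rewrite pz zq.
  exists (rmap X p q @: B)%VS, (rmap X p q @: A0)%VS; split.
  - exact: limgS.
  - apply/negP => /subvP H; case/subvPn: AB => a aA aB.
    by case/negP: (survB q sq a aA aB); apply: H; exact: memv_img.
  - move=> w /memv_imgP[a aA ->]; have [u [up cu]] := vA a aA.
    have [||||||u' [u'P u'Y cu']] := @glue_vec k R A X (upto l p)
      [set y | p <= y /\ y <= q] p u (fun x => rmap X p x a) _ _ _ _ cu _ _.
    + by split.
    + by split; rewrite /=.
    + by move=> x [].
    + by move=> x [].
    + move=> x y yx [px xq] [py yq].
      by rewrite (rmapC _ _ yx) //; apply: pE; apply: Ey.
    + by rewrite up rmap_id.
    exists u'; split; first by rewrite u'Y //; split; rewrite /=.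
    move=> x y yx [lx xq] [ly yq]; apply: cu' => //.
      by case: (leP x p) => xp; [left | right; split=> //; apply: ltW].
    by case: (leP y p) => yp; [left | right; split=> //; apply: ltW].
  - move=> psi psiB.
    have [f [fp cf']] := fB (psi \o rmap X p q)%VF
      (fun v vB => etrans (comp_lfunE _ _ _) (psiB _ (memv_img _ vB))).
    have [||||||f' [f'P f'Y cf'']] := @glue_fun k R A X (upto l p)
      [set y | p <= y /\ y <= q] p f (fun x => (psi \o rmap X x q)%VF) _ _ _ _ cf' _ _.
    + by split.
    + by split; rewrite /=.
    + by move=> x [].
    + by move=> x [].
    + move=> x y yx [px xq] [py yq] v.
      by rewrite !comp_lfunE rmapC //; apply: Eq => //; apply: Ey.
    + by rewrite fp.
    exists f'; split.
      rewrite f'Y; last by split; rewrite /=.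
      by apply/lfunP => v; rewrite comp_lfunE rmap_id.
    move=> x y yx [lx xq] [ly yq]; apply: cf'' => //.
      by case: (leP x p) => xp; [left | right; split=> //; apply: ltW].
    by case: (leP y p) => yp; [left | right; split=> //; apply: ltW].
left.
pose Y : set R := [set y | E y /\ surv y].
pose NS : set R := [set y | E y /\ ~ surv y].
have beyond z : ~ Y z -> p < z -> exists z', [/\ NS z', p < z' & z' <= z].
  move=> nYz pz; have [zn|zn] := pselect (inseg A n z).
    have Ez : E z by split=> //; exact: ltW.
    by exists z; split=> //; split=> // sz; apply: nYz.
  case: (pn) => hn hn1 /andP[np pn1].
  have zn1 : (pt A (n + 1) <= z%:E)%E.
    rewrite leNgt; apply/negP => zn1; apply: zn; split=> //.
    by rewrite (ltW zn1) andbT (le_trans np) ?lee_fin ?ltW.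
  have [q [qE /andP[pq qz]]] := ereal_between pn1 zn1.
  have Eq' : E q by split=> //; split=> //; rewrite qE lexx andbT (le_trans np) ?lee_fin.
  have nsq : ~ surv q by move=> sq; apply: nwhole; exists q.
  exists q; split=> //; rewrite lt_neqAle pq andbT; apply/eqP => pq'.
  by apply: nsq; rewrite -pq'.
(* The kernels towards the non-surviving points form a chain; the smallest is contained in all of
   them, so a single vector of A0 off B dies at every such point. *)
have [W [WA WN]] : exists W : {vspace X p}, ~~ (A0 :&: W <= B)%VS /\
    forall z, NS z -> (W <= lker (rmap X p z))%VS.
  have [[z0 NSz0]|N0] := pselect (exists z, NS z); last first.
    exists {:X p}%VS; rewrite capvf; split=> // z NSz; case: N0; by exists z.
  have [|z [Ez nsz] zmin] := @ex_argmin _ NS (fun z => \dim (lker (rmap X p z))).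
    by exists z0.
  exists (lker (rmap X p z)); split; first exact/negP.
  move=> y [Ey nsy]; case/orP: (le_total z y) => yz; first exact: ker_le.
  have /eqP <- // : lker (rmap X p y) == lker (rmap X p z).
  rewrite eqEdim ker_le //=; exact: zmin.
have Yp : Y p by split.
have Yc x y z : Y x -> Y z -> x <= y <= z -> Y y.
  move=> [Ex sx] [Ez sz] /andP[xy yz]; have Ey : E y.
    split; first by apply: (inseg_between Ex.1 Ez.1); rewrite xy yz.
    by apply: le_trans xy; exact: Ex.2.
  by split=> //; apply: surv_le sz.
have Ydir x y : Y x -> Y y -> exists2 z, Y z & qle A z x /\ qle A z y.
  move=> Yx Yy; case/orP: (le_total x y) => xy.
    by exists y => //; split; [apply: Eq => //; [exact: Yx.1|exact: Yy.1] | exact: qle_refl].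
  by exists x => //; split; [exact: qle_refl | apply: Eq => //; [exact: Yy.1|exact: Yx.1]].
(* Here it is the functional that has to be extended to a Y without last point: it is chosen at z1
   and carried on by the inverses of the bijections. *)
have [z1 Yz1 z1b] := tame_down X_rep (ex_intro _ p Yp) Ydir.
have [Ez1 sz1] := Yz1.
have [a + aB] := subvPn WA; rewrite memv_cap => /andP[aA aW].
have [psi1 [psi1a psi1B]] := lfun_separate (survB z1 sz1 a aA aB).
have [u [up cu]] := vA a aA.
have [f [fp cf']] := fB (psi1 \o rmap X p z1)%VF
  (fun v vB => etrans (comp_lfunE _ _ _) (psi1B _ (memv_img _ vB))).
pose g y : 'Hom(X y, k^o) :=
  if y <= z1 then (psi1 \o rmap X y z1)%VF else (psi1 \o (rmap X z1 y)^-1)%VF.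
have inv y : Y y -> z1 < y -> cancel (rmap X z1 y) (rmap X z1 y)^-1%VF /\
    cancel (rmap X z1 y)^-1%VF (rmap X z1 y).
  by move=> Yy zy; apply/lfun_bij_inv/z1b => //; apply: Eq => //; [exact: Yy.1 | exact: ltW].
have Yq x y : Y x -> Y y -> x <= y -> qle A y x.
  by move=> [Ex _] [Ey _]; exact: Eq.
have Yle x y : E x -> E y -> qle A x y -> y <= x.
  by move=> [xn _] [yn _] /(qle_seg xn yn); rewrite (negPf en).
apply: (@stop_retract k R A X l l_up l_supp p Y u f (fun x => rmap X p x a) g) => //.
- by move=> y [[]].
- by move=> x y yx Yx Yy; rewrite rmapC //; exact: pE Yx.1.
- move=> x y yx Yx Yy c; have xy := Yle _ _ Yy.1 Yx.1 yx; rewrite /g.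
  have [yz|yz] := leP y z1.
    by rewrite (le_trans xy yz) !comp_lfunE rmapC //; exact: Yq.
  have [xz|xz] := leP x z1; rewrite !comp_lfunE.
    by rewrite -(rmapC c (Yq _ _ Yx Yz1 xz) (Yq _ _ Yz1 Yy (ltW yz))) (inv y Yy yz).1.
  rewrite -[c](inv x Yx xz).2 (rmapC _ (Yq _ _ Yz1 Yx (ltW xz)) yx).
  by rewrite (inv y Yy yz).1 (inv x Yx xz).1.
- by rewrite up rmap_id.
- by rewrite fp /g Ez1.2.
- by rewrite fp up comp_lfunE.
- move=> y z Yy nYz pz zy; rewrite (rmapC _ (pE _ Yy.1) zy).
  have [z' [[Ez' nsz'] pz' z'z]] := beyond z nYz pz.
  have pz'' : qle A z p by apply: qle_trans zy _; exact: pE Yy.1.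
  have [z'z1 pz1] : qle A z z' /\ qle A z' p.
    by apply: (qle_mid pz''); rewrite (ltW pz') z'z orbT.
  rewrite -(rmapC _ pz1 z'z1); have /subvP/(_ a aW) := WN z' (conj Ez' nsz').
  by rewrite memv_ker => /eqP ->; rewrite linear0.
- move=> y z Yy nYz pz yz; have [z' [[Ez' nsz'] pz' z'z]] := beyond z nYz pz.
  have yz' : y < z'.
    by rewrite ltNge; apply/negP => z'y; apply: nsz'; apply: surv_le z'y Yy.2 => //; exact: Yy.1.
  have [yz1 _] : qle A y z' /\ qle A z' z.
    by apply: (qle_mid yz); rewrite z'z (ltW yz').
  by have := Yle _ _ Yy.1 Ez' yz1; rewrite leNgt yz'.
Qed.

(** The summand must end before the index passes N: otherwise p is right of the support, whereas a
    vector of A0 off B is nonzero. *)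
Lemma walk N d n p (B A0 : {vspace X p}) : has_idx A N ->
  (forall x (v : X x), v <> 0 -> (x%:E <= pt A N)%E) ->
  (N < n + d%:Z) -> inseg A n p -> l p -> left_state B A0 ->
  exists K, retract_of K X.
Proof.
move=> hN XN; elim: d n p B A0 => [|d IH] n p B A0 Nn pn lp st.
  have [_ AB _ _] := st; have [a aA aB] := subvPn AB.
  have a0 : a <> 0 by move=> a0; rewrite a0 mem0v in aB.
  have := XN p a a0; case: pn => hn hn1 /andP[np _] pN.
  by move: Nn; rewrite addr0 -(pt_lt hN hn) ltNge (le_trans np pN).
have [|[q [qE pq [B' [A' st']]]]] : (exists K, retract_of K X) \/
    exists q, [/\ pt A (n + 1) = q%:E, p <= q & exists B' A', @left_state q B' A'].
  by case en: (evenz n); [apply: step_down st | apply: step_up st]; rewrite ?en.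
  by [].
apply: (IH (n + 1) q B' A') => //.
- by move: Nn; rewrite -[d.+1]add1n PoszD addrA.
- case: pn => hn hn1 _; split=> //; first by apply: idx_succ; rewrite // qE ltry.
  by rewrite qE lexx -qE pt_le ?lerDl //; apply: idx_succ; rewrite // qE ltry.
- exact: l_up pq.
Qed.

End Walk.

(** * Existence of an interval summand *)

Section Decompose.
Variables (k : fieldType) (R : realType) (A : contA R).

(** X is constant on the part of [l] left of a suitable point z1, so every vector and every
    functional at z1 extends to the left; the sweep starts there with the pair of the zero space and
    all of X z1. *)
Lemma in_rep_retract (X : rep k A) : in_rep X -> ~ is_zero X ->
  exists K, retract_of K X.
Proof.
move=> X_rep X0.
have [m [N [hm hN Xsupp]]] := in_rep_supp X_rep.
pose L : set R := [set x | exists v : X x, v <> 0].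
have [x0 Lx0] : L !=set0.
  apply: contrapT => L0; apply: X0 => x v; apply: contrapT => v0.
  by apply: L0; exists x, v.
pose l : set R := [set x | exists2 y, L y & y <= x].
have l_up x y : l x -> x <= y -> l y.
  by move=> [z Lz zx] xy; exists z => //; apply: le_trans xy.
have Ll x : L x -> l x by exists x.
have l_supp x (v : X x) : ~ l x -> v = 0.
  by move=> lx; apply: contrapT => v0; apply: lx; apply: Ll; exists v.
(* The beginning of the support lies in one segment: the one that starts at or before the infimum of
   the support and ends after it, or the first one if the support is unbounded on the left, since
   then s_m = -oo. *)
have [n [x1 [Lx1 hn hn1 ln]]] : exists n x1, [/\ L x1, has_idx A n, has_idx A (n + 1)
    & forall x, l x -> x <= x1 -> inseg A n x].
  have [[b bL]|nb] := pselect (exists b, forall x, L x -> b <= x).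
    have hs : has_inf L by split; [exists x0 | exists b].
    have [n [[hn hn1 /andP[ns sn]] sn']] := seg_exists A (inf L).
    have [x1 Lx1 x1n] : exists2 x1, L x1 & (x1%:E < pt A (n + 1))%E.
      case E: (pt A (n + 1)) sn' => [r| |] // sr; last by exists x0; rewrite ?ltry.
      have [x1 Lx1 x1r] := inf_lt (ex_intro _ x0 Lx0) (sr : inf L < r).
      by exists x1.
    exists n, x1; split=> // x [y Ly yx] xx1; split=> //.
    rewrite (le_trans ns) /=; first by apply: le_trans (ltW x1n); rewrite lee_fin.
    by rewrite lee_fin; apply: le_trans yx; apply: ge_inf => //; exact: hs.2.
  have mE : pt A m = -oo%E.
    case E: (pt A m) => [r| |] //.
      by case: nb; exists r => x /Xsupp; rewrite E lee_fin => /andP[].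
    by have := Xsupp x0 Lx0; rewrite E leye_eq.
  have hm1 : has_idx A (m + 1) by apply: idx_succ; rewrite // mE.
  have [x1 Lx1 x1m] : exists2 x1, L x1 & (x1%:E <= pt A (m + 1))%E.
    apply: contrapT => H; case E: (pt A (m + 1)) => [r| |].
    - apply: nb; exists r => x Lx; rewrite leNgt; apply/negP => xr; apply: H.
      by exists x; rewrite // E lee_fin ltW.
    - by apply: H; exists x0; rewrite // E leey.
    - have : (pt A m < pt A (m + 1))%E by rewrite pt_lt // ltrDl.
      by rewrite mE E.
  exists m, x1; split=> // x _ xx1; split=> //; rewrite mE leNye /=.
  by apply: le_trans x1m; rewrite lee_fin.
pose C : set R := [set x | l x /\ x <= x1].
have Cn x : C x -> inseg A n x by case=> lx; exact: ln.
have Cx1 : C x1 by split; [exact: Ll | rewrite /=].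
have Cmin x y : C x -> C y -> C (Num.min x y).
  by rewrite /Num.min; case: ifP.
(* Moving left in C is moving down for n even and up for n odd, hence the two versions of the
   construction. *)
suff [p [np lp st]] : exists p, [/\ inseg A n p, l p &
    left_state l (0%VS : {vspace X p}) {:X p}%VS].
  apply: (@walk k R A X l X_rep l_up l_supp N (absz (N - n)%R + 1)%N n p _ _ hN _ _ np lp st).
  - by move=> x v v0; have /andP[] := Xsupp x (ex_intro _ v v0).
  - by move: (N) (n) => a b; lia.
have nz z y : L y -> (forall w, exists v, rmap X z y v = w) ->
    ~~ ({:X z} <= 0)%VS.
  move=> [w w0] s; have [v vw] := s w; apply/negP => /subvP/(_ v (memvf v)).
  by rewrite memv0 => /eqP v0; apply: w0; rewrite -vw v0 linear0.
case en: (evenz n).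
  have Cq x y : C x -> C y -> x <= y -> qle A x y.
    by move=> /Cn xn /Cn yn xy; apply: (seg_qle xn yn); rewrite en.
  have [|z1 [lz1 z1x1] zb] := tame_down X_rep (ex_intro _ x1 Cx1).
    move=> x y Cx Cy; exists (Num.min x y); first exact: Cmin.
    by split; apply: Cq => //; rewrite ?ge_min ?lexx ?orbT //; exact: Cmin.
  have Cz1 : C z1 by [].
  have uC x : upto l z1 x -> C x.
    by case=> lx xz; split=> //; apply: le_trans z1x1.
  have inv x : upto l z1 x -> cancel (rmap X z1 x) (rmap X z1 x)^-1%VF /\
      cancel (rmap X z1 x)^-1%VF (rmap X z1 x).
    by move=> ux; apply/lfun_bij_inv/zb; [exact: uC | apply: Cq => //; [exact: uC | case: ux]].
  have uz1 : upto l z1 z1 by split; rewrite /=.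
  have uq x : upto l z1 x -> qle A x z1.
    by move=> ux; apply: Cq => //; [exact: uC | case: ux].
  exists z1; split=> //; first exact: Cn.
  split; first exact: sub0v.
  - have [y Ly yz1] := lz1; have uy : upto l z1 y by split=> //; exact: Ll.
    by apply: (nz z1 y Ly) => w; exists ((rmap X z1 y)^-1%VF w); rewrite (inv y uy).2.
  - move=> v _; exists (fun x => rmap X z1 x v); split; first by rewrite rmap_id.
    by move=> x y yx ux uy; rewrite rmapC //; exact: uq.
  - move=> psi _; exists (fun x => (psi \o (rmap X z1 x)^-1)%VF); split.
      apply/lfunP => c; rewrite comp_lfunE -[in LHS](rmap_id c) (inv z1 uz1).1 //.
    move=> x y yx ux uy c; rewrite !comp_lfunE.
    by rewrite -[c](inv x ux).2 (rmapC _ (uq x ux) yx) (inv y uy).1 (inv x ux).1.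
have Cq x y : C x -> C y -> x <= y -> qle A y x.
  by move=> /Cn xn /Cn yn xy; apply: (seg_qle yn xn); rewrite en.
have [|z1 [lz1 z1x1] zb] := tame_up X_rep (ex_intro _ x1 Cx1).
  move=> x y Cx Cy; exists (Num.min x y); first exact: Cmin.
  by split; apply: Cq => //; rewrite ?ge_min ?lexx ?orbT //; exact: Cmin.
have Cz1 : C z1 by [].
have uC x : upto l z1 x -> C x.
  by case=> lx xz; split=> //; apply: le_trans z1x1.
have inv x : upto l z1 x -> cancel (rmap X x z1) (rmap X x z1)^-1%VF /\
    cancel (rmap X x z1)^-1%VF (rmap X x z1).
  by move=> ux; apply/lfun_bij_inv/zb; [exact: uC | apply: Cq => //; [exact: uC | case: ux]].
have uz1 : upto l z1 z1 by split; rewrite /=.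
have uq x : upto l z1 x -> qle A z1 x.
  by move=> ux; apply: Cq => //; [exact: uC | case: ux].
exists z1; split=> //; first exact: Cn.
split; first exact: sub0v.
- have [y [w w0] yz1] := lz1; have uy : upto l z1 y by split=> //; exists y => //; exists w.
  apply/negP => /subvP/(_ (rmap X y z1 w) (memvf _)); rewrite memv0 => /eqP v0.
  by apply: w0; rewrite -[w](inv y uy).1 v0 linear0.
- move=> v _; exists (fun x => (rmap X x z1)^-1%VF v); split.
    by rewrite -[in LHS](rmap_id v) (inv z1 uz1).1.
  move=> x y yx ux uy; apply: (can_inj (inv y uy).1).
  by rewrite (rmapC _ yx (uq y uy)) (inv x ux).2 (inv y uy).2.
- move=> psi _; exists (fun x => (psi \o rmap X x z1)%VF); split.
    by apply/lfunP => c; rewrite comp_lfunE rmap_id.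
  by move=> x y yx ux uy c; rewrite !comp_lfunE rmapC //; exact: uq.
Qed.

End Decompose.

(** * Indecomposables *)

Section KrullSchmidt.
Variables (k : fieldType) (R : realType) (A : contA R).
Implicit Types (I J K E : interval R) (V W X Y : rep k A).

Lemma M_neq0 I x : x \in I -> (const_mx 1 : M k A I x) <> 0.
Proof.
move=> xI E; have : cf (const_mx 1 : 'rV[k]_(x \in I)) = 0.
  rewrite (E : const_mx 1 = 0 :> 'rV_(x \in I)) /cf big1 // => i _.
  by rewrite mxE.
by rewrite cf_const xI => /eqP; rewrite oner_eq0.
Qed.

Lemma M_zero I x (v : M k A I x) : ~ x \in I -> v = 0.
Proof. by move=> /negP xI; exact: row_false. Qed.

Lemma mono_sub I J (f : fam (M k A I) (M k A J)) : is_mono f ->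
  forall x, x \in I -> x \in J.
Proof.
move=> fi x xI; apply/negPn/negP => /negP xJ; apply: (M_neq0 xI).
by apply: (fi x); rewrite linear0; exact: M_zero.
Qed.

Lemma iso_M_mem I J : iso (M k A I) (M k A J) -> forall x, (x \in I) = (x \in J).
Proof.
move=> h x; apply/idP/idP.
  by have [f fi] := h; apply: mono_sub (iso_mono fi) x.
by have [f fi] := iso_sym h; apply: mono_sub (iso_mono fi) x.
Qed.

Lemma can_scale_mem I J (f : fam (M k A I) (M k A J)) c x :
  (forall v, f x v = c *: can I J x v) -> x \in I ->
  f x (const_mx 1) <> 0 -> c != 0 /\ x \in J.
Proof.
move=> fE xI f0; split.
  by apply/eqP => c0; apply: f0; rewrite fE c0 scale0r.
by apply/negPn/negP => /negP xJ; apply: f0; exact: M_zero.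
Qed.

(** The projection onto X is an idempotent endomorphism of M_J, hence a scalar equal to 0 or 1;
    accordingly X or Y vanishes. *)
Lemma indecomposable_M J : in_rep (M k A J) -> Defs.nonempty J ->
  indecomposable (M k A J).
Proof.
move=> hJ [x0 x0J]; split=> //.
  by move=> /(_ x0 (const_mx 1)); exact: M_neq0.
move=> X Y _ _ [f [fm [g [gm fg]]]].
pose e := fam_comp g (fam_comp (@fam_inl _ _ _ X Y) (fam_comp (@fam_fst _ _ _ X Y) f)).
have em : is_mor e.
  by do !apply: mor_comp => //; [exact: mor_inl | exact: mor_fst].
have eE x v : e x v = g x ((f x v).1, 0).
  by rewrite !comp_lfunE fam_fstE fam_inlE.
have [c [ec _]] := mor_scalar em.
have {}ec x v : e x v = c *: v by rewrite ec can_id.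
have cc : c * c = c.
  have : e x0 (e x0 (const_mx 1)) = e x0 (const_mx 1).
    by rewrite !eE (fg x0).2.
  rewrite !ec scalerA => /eqP; rewrite -subr_eq0 -scalerBl => /eqP E.
  apply/eqP; rewrite -subr_eq0; apply/negPn/negP => c0.
  by apply: (M_neq0 x0J); rewrite -[LHS](scalerK c0) E scaler0.
have [c0|c0] := eqVneq c 0.
  left=> x v; have : e x (g x (v, 0)) = g x (v, 0) by rewrite eE (fg x).2.
  rewrite ec c0 scale0r => /(congr1 (f x)); rewrite (fg x).2 linear0 => E.
  by have := congr1 fst E.
have c1 : c = 1 by apply: (mulfI c0); rewrite mulr1.
right=> x v; have : e x (g x (0, v)) = 0.
  by rewrite eE (fg x).2 /= (_ : (0, 0) = 0) ?linear0.
rewrite ec c1 scale1r => /(congr1 (f x)); rewrite (fg x).2 linear0 => E.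
by have := congr1 snd E.
Qed.

Section Kernel.
Variables (V W : rep k A) (r : fam V W).
Hypothesis rm : is_mor r.

(** The restriction of [rmap V x y] lands in the kernel only for y \preceq x; [vsproj] makes the
    formula meaningful for all pairs. *)
Definition ker_map x y : 'Hom(subvs_of (lker (r x)), subvs_of (lker (r y))) :=
  (linfun (vsproj (lker (r y))) \o (rmap V x y \o linfun vsval))%VF.

Lemma ker_mapE x y v : qle A y x -> vsval (ker_map x y v) = rmap V x y (vsval v).
Proof.
move=> yx; rewrite !comp_lfunE !lfunE /= vsprojK // memv_ker rm //.
by have := subvsP v; rewrite memv_ker => /eqP ->; rewrite linear0.
Qed.

Lemma ker_id x v : ker_map x x v = v.
Proof. by apply/val_inj; rewrite /= ker_mapE ?rmap_id //; exact: qle_refl. Qed.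

Lemma ker_comp x y z : qle A y x -> qle A z y ->
  forall v, ker_map x z v = ker_map y z (ker_map x y v).
Proof.
move=> yx zy v; apply/val_inj; rewrite /= !ker_mapE //; last exact: qle_trans yx.
exact: rmap_comp.
Qed.

Definition rker : rep k A := @Rep k R A _ ker_map ker_id ker_comp.

Definition ker_in : fam rker V := fun x => linfun vsval.

Lemma ker_inE x (v : rker x) :
  ker_in x v = vsval (v : subvs_of (lker (r x))).
Proof. exact: lfunE. Qed.

Lemma mor_ker_in : is_mor ker_in.
Proof. by move=> x y yx v; rewrite !ker_inE; exact: ker_mapE. Qed.

Lemma mono_ker_in : is_mono ker_in.
Proof. by move=> x v w; rewrite !ker_inE; exact: val_inj. Qed.

Lemma ker_in_ker x v : r x (ker_in x v) = 0.
Proof.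
rewrite ker_inE; apply/eqP; rewrite -memv_ker; exact: subvsP.
Qed.

Lemma ker_lift U (p : fam U V) : is_mor p -> (forall x v, r x (p x v) = 0) ->
  exists p' : fam U rker, is_mor p' /\ forall x v, ker_in x (p' x v) = p x v.
Proof.
move=> pm rp.
pose p' : fam U rker := fun x => (linfun (vsproj (lker (r x))) \o p x)%VF.
have p'E x v : ker_in x (p' x v) = p x v.
  rewrite ker_inE comp_lfunE lfunE.
  by apply: vsprojK; rewrite memv_ker rp.
exists p'; split=> // x y yx v.
by apply: mono_ker_in; rewrite p'E (mor_ker_in yx) p'E pm.
Qed.
End Kernel.

(** The endomorphism 1 - h r maps X onto the kernel of r, which is therefore a quotient of X and
    belongs to the category. So X is the sum of M_K and this kernel, and indecomposability makes the
    kernel vanish. *)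
Lemma retract_indec K X : indecomposable X -> retract_of K X ->
  in_rep (M k A K) /\ iso (M k A K) X.
Proof.
move=> [X_rep X0 Xi] [[x0 x0K] [h [r [hm rm rh]]]].
have K_rep : in_rep (M k A K).
  apply: (in_rep_epi X_rep rm) => x v; by exists (h x v).
split=> //.
have [||p [pm pE]] := @ker_lift _ _ r rm X (fam_add (fam_id X) (fam_scale (-1) (fam_comp h r))).
- by apply: mor_add; [exact: mor_id | apply: mor_scale; exact: mor_comp].
- move=> x v; rewrite add_lfunE id_lfunE scale_lfunE comp_lfunE scaleN1r.
  by rewrite linearB /= rh subrr.
have {}pE x v : ker_in rm x (p x v) = v - h x (r x v).
  by rewrite pE add_lfunE id_lfunE scale_lfunE comp_lfunE scaleN1r.
have pi x (w : rker rm x) : p x (ker_in rm x w) = w.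
  by apply: (@mono_ker_in _ _ _ rm); rewrite pE ker_in_ker linear0 subr0.
have Y_rep : in_rep (rker rm).
  by apply: (in_rep_epi X_rep pm) => x w; exists (ker_in rm x w); exact: pi.
have [|K0|Y0] := Xi (M k A K) (rker rm) K_rep Y_rep.
- exists (fam_pair r p); apply: bij_iso; first exact: mor_pair.
    move=> x v w; rewrite !fam_pairE => -[rvw /(congr1 (ker_in rm x))].
    by rewrite !pE rvw => /addIr.
  move=> x [a w]; exists (h x a + ker_in rm x w); rewrite fam_pairE.
  congr (_, _).
    transitivity (r x (h x a) + r x (ker_in rm x w)); first exact: linearD.
    by rewrite rh ker_in_ker addr0.
  transitivity (p x (h x a) + p x (ker_in rm x w)); first exact: linearD.
  rewrite pi (_ : p x (h x a) = 0) ?add0r //.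
  by apply: (@mono_ker_in _ _ _ rm); rewrite pE rh subrr linear0.
- by case: (M_neq0 x0K); exact: K0.
exists h; apply: bij_iso => // x.
  by apply: can_inj (rh x).
move=> v; exists (r x v); apply/eqP; rewrite eq_sym -subr_eq0 -pE.
by rewrite (Y0 x (p x v)) linear0.
Qed.

Lemma indec_itv X : indecomposable X -> exists K,
  [/\ Defs.nonempty K, in_rep (M k A K) & iso (M k A K) X].
Proof.
move=> hX; have [X_rep X0 _] := hX; have [K hK] := in_rep_retract X_rep X0.
by have [K_rep KX] := retract_indec hX hK; exists K; split=> //; case: hK.
Qed.

(** The identity of M_I is the sum of its parts through the two summands, so one part is nonzero at
    x0; it provides nonzero morphisms in both directions between M_I and that summand. *)
Lemma retract_sum I E1 E2 (a : fam (M k A I) (rsum (M k A E1) (M k A E2)))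
    (b : fam (rsum (M k A E1) (M k A E2)) (M k A I)) :
  is_mor a -> is_mor b -> Defs.nonempty I -> (forall x v, b x (a x v) = v) ->
  (forall x, (x \in I) = (x \in E1)) \/ (forall x, (x \in I) = (x \in E2)).
Proof.
move=> am bm [x0 x0I] ba.
have H E (i : fam (M k A E) (rsum (M k A E1) (M k A E2)))
    (p : fam (rsum (M k A E1) (M k A E2)) (M k A E)) : is_mor i -> is_mor p ->
    b x0 (i x0 (p x0 (a x0 (const_mx 1)))) <> 0 -> forall x, (x \in I) = (x \in E).
  move=> im pm n0.
  have [c [cE ch]] := mor_scalar (mor_comp pm am).
  have [d [dE dh]] := mor_scalar (mor_comp bm im).
  have [|c0 x0E] := can_scale_mem (cE x0) x0I.
    by move=> E0; apply: n0; rewrite -[p x0 _]comp_lfunE E0 !linear0.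
  have d0 : d != 0.
    by apply/eqP => d0; apply: n0; rewrite -[b x0 _]comp_lfunE dE d0 scale0r.
  by apply: (hom_antisym (ch c0 _) (dh d0 _) x0I x0E); exists x0.
have E := ba x0 (const_mx 1).
set w := a x0 (const_mx 1) in E *.
have wE : w = fam_inl _ _ x0 (fam_fst _ _ x0 w) + fam_inr _ _ x0 (fam_snd _ _ x0 w).
  rewrite fam_inlE fam_inrE fam_fstE fam_sndE.
  by case: (w) => w1 w2; congr (_, _); rewrite /= ?addr0 ?add0r.
have [n1|n1] := pselect (b x0 (fam_inl _ _ x0 (fam_fst _ _ x0 w)) = 0); last first.
  by left; apply: H n1; [exact: mor_inl | exact: mor_fst].
right; apply: (H E2 (@fam_inr _ _ _ _ _) (@fam_snd _ _ _ _ _)) => [||n2].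
- exact: mor_inr.
- exact: mor_snd.
- by apply: (M_neq0 x0I); rewrite -E wE linearD /= n1 n2 addr0.
Qed.

Lemma rsum_iso_mem I J E1 E2 : Defs.nonempty I ->
  iso (rsum (M k A E1) (M k A E2)) (rsum (M k A I) (M k A J)) ->
  (forall x, (x \in I) = (x \in E1)) \/ (forall x, (x \in I) = (x \in E2)).
Proof.
move=> I0 [f [fm [g [gm fg]]]].
apply: (@retract_sum I E1 E2 (fam_comp g (@fam_inl _ _ _ _ _))
                             (fam_comp (@fam_fst _ _ _ _ _) f)) => //.
- by apply: mor_comp => //; exact: mor_inl.
- by apply: mor_comp => //; exact: mor_fst.
- by move=> x v; rewrite !comp_lfunE (fg x).2 fam_fstE fam_inlE.
Qed.

End KrullSchmidt.

(** * Toggling an end *)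

Section Cells.
Variables (R : realType) (A : contA R).
Implicit Types (I J K U E W : interval R) (D : set R) (x y z d : R) (b s : bool).

(* [ltb] and [qb] let one proof serve both ends of an interval ([b]) and both
   directions of morphisms ([s]). *)
Definition ltb b x y := if b then x < y else y < x.
Definition qb s x y := if s then qle A x y else qle A y x.

Lemma ltb_total b x y : [\/ ltb b x y, x = y | ltb b y x].
Proof.
by case: b; rewrite /ltb; case: (ltgtP x y) => xy;
  [exact: Or31 | exact: Or33 | exact: Or32 | exact: Or33 | exact: Or31 | exact: Or32].
Qed.

Lemma ltb_irr b x : ~ ltb b x x.
Proof. by case: b; rewrite /ltb ltxx. Qed.

Lemma ltb_trans b x y z : ltb b x y -> ltb b y z -> ltb b x z.
Proof.
by case: b; rewrite /ltb => xy yz; [apply: lt_trans yz | apply: lt_trans xy].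
Qed.

Lemma ltb_asym b x y : ltb b x y -> ~ ltb b y x.
Proof. by move=> xy yx; apply: (@ltb_irr b x); apply: ltb_trans yx. Qed.

Lemma ltbN b x y : ltb (~~ b) x y = ltb b y x.
Proof. by case: b. Qed.

Lemma qbN s x y : qb (~~ s) x y = qb s y x.
Proof. by case: s. Qed.

Lemma qb_refl s x : qb s x x.
Proof. by case: s; exact: qle_refl. Qed.

Lemma qb_anti s x y : qb s x y -> qb s y x -> x = y.
Proof. by case: s => /= xy yx; apply: qle_anti xy yx || apply: qle_anti yx xy. Qed.

Lemma qb_trans s x y z : qb s x y -> qb s y z -> qb s x z.
Proof. by case: s => /= xy yz; [apply: qle_trans yz | apply: qle_trans xy]. Qed.

Lemma qb_mid s b x y z : qb s x y -> ltb b x z -> ltb b z y ->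
  qb s x z /\ qb s z y.
Proof.
case: s b => -[] /= xy xz zy.
- by apply: (qle_mid xy); rewrite (ltW xz) (ltW zy).
- by apply: (qle_mid xy); rewrite (ltW xz) (ltW zy) orbT.
- by have [] := qle_mid xy (z := z) ltac:(by rewrite (ltW xz) (ltW zy) orbT).
- by have [] := qle_mid xy (z := z) ltac:(by rewrite (ltW xz) (ltW zy)).
Qed.

Lemma itv_ltb I b x y z : x \in I -> z \in I -> ltb b x y -> ltb b y z -> y \in I.
Proof.
case: b => xI zI xy yz; first by apply: itv_convex xI zI _; rewrite (ltW xy) (ltW yz).
by apply: itv_convex zI xI _; rewrite (ltW xy) (ltW yz).
Qed.

Definition homq s I J := forall x y, qb s y x -> x \in I -> y \in J ->
  (y \in I) = (x \in J).

Lemma homqN s I J : homq (~~ s) I J <-> homq s J I.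
Proof.
split=> H x y yx xI yJ; apply/esym/H => //; first by rewrite qbN.
by rewrite -qbN.
Qed.

Definition beyond b D x := forall d, D d -> ltb b x d.

(* [cellP b s D] collects what the factorization argument needs of a cell [D]
   seen from side [b]; the last clause says that past a first point of [D] the
   order turns around. *)
Definition cellP b s D := [/\ D !=set0,
  forall x y z, D x -> D z -> ltb b x y -> ltb b y z -> D y,
  forall d y, D d -> qb s y d -> ~ beyond b D y -> D y,
  forall x d, D x -> D d -> ltb b x d -> qb s d x
  & forall x, beyond b D x -> exists x' lo, [/\ x' = x \/ ltb b x x',
      beyond b D x', D lo, forall d, D d -> d = lo \/ ltb b lo d & qb s x' lo]].

(** For [s] true the canonical map is M_U -> M_E: it is onto when D is taken away from U and
    injective when D is added to U. For [s] false it goes the other way. *)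
Definition end_move b s D U E :=
  [/\ cellP b s D, forall x, x \in U <-> D x \/ x \in E
    & forall x, x \in E -> beyond (~~ b) D x] \/
  [/\ cellP b (~~ s) D, forall x, x \in E <-> D x \/ x \in U
    & forall x, x \in U -> beyond (~~ b) D x].

Definition same_end b K U := exists p, [/\ p \in K, p \in U &
  forall x, ltb b x p -> (x \in K) = (x \in U)].

Lemma end_moveN b s D U E : end_move b s D U E -> end_move b (~~ s) D E U.
Proof. by rewrite /end_move negbK => -[]; [right | left]. Qed.

Lemma not_beyond2 b D x : D !=set0 -> beyond b D x -> ~ beyond (~~ b) D x.
Proof.
by move=> [d Dd] /(_ d Dd) xd /(_ d Dd); rewrite ltbN; exact: ltb_asym.
Qed.

Lemma not_beyond b D x : D x -> ~ beyond b D x.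
Proof. by move=> Dx /(_ x Dx); exact: ltb_irr. Qed.

Lemma beyond_cases b s D x : cellP b s D ->
  [\/ beyond b D x, D x | beyond (~~ b) D x].
Proof.
move=> [_ Dc _ _ _]; have [Dx|nDx] := pselect (D x); first exact: Or32.
have [bx|nbx] := pselect (beyond b D x); first exact: Or31.
have [d Dd dx] : exists2 d, D d & ltb b d x.
  apply: contrapT => H; apply: nbx => d Dd.
  case: (ltb_total b x d) => // [xd|dx]; first by case: nDx; rewrite xd.
  by case: H; exists d.
apply: Or33 => e De; rewrite ltbN.
case: (ltb_total b e x) => // [ex|xe]; first by case: nDx; rewrite -ex.
by case: nDx; apply: Dc Dd De dx xe.
Qed.

Lemma end_move_hom b s D U E : end_move b s D U E -> homq s U E.
Proof.
case=> -[cD UE Er] x y yx.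
  move=> xU yE; rewrite ((UE y).2 (or_intror yE)); apply/esym.
  case: ((UE x).1 xU) => // Dx; have [D0 _ P1 _ _] := cD.
  case: (@not_beyond (~~ b) D y); last exact: Er.
  by apply: (P1 x) => // lb; apply: not_beyond2 D0 lb (Er y yE).
move=> xU yE; rewrite ((UE x).2 (or_intror xU)).
case: ((UE y).1 yE) => // Dy; have [D0 _ P1 _ _] := cD.
case: (@not_beyond (~~ b) D x); last exact: Er.
by apply: (P1 y); rewrite ?qbN // => lb; apply: not_beyond2 D0 lb (Er x xU).
Qed.

Lemma end_move_mem b s D U E x : end_move b s D U E -> ~ D x ->
  (x \in U) = (x \in E).
Proof.
move=> H nDx; case: H => -[_ UE _]; apply/idP/idP.
- by move=> /UE[].
- by move=> xE; apply/UE; right.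
- by move=> xU; apply/UE; right.
- by move=> /UE[].
Qed.

Lemma end_move_neq b s D U E : end_move b s D U E ->
  ~ forall x, (x \in U) = (x \in E).
Proof.
move=> H UE; case: H => -[[[d Dd] _ _ _ _] IE r]; have dd : d \in U.
- by apply/IE; left.
- by have := r d; rewrite -UE dd => /(_ isT); exact: not_beyond.
- by rewrite UE; apply/IE; left.
- by have := r d dd; exact: not_beyond.
Qed.

(** If D is taken away, the map factors when K misses D; when K meets D, the turn of the order at
    the outer end of D prevents K from extending beyond it. If D is added, the only obstruction is a
    point of D outside K, and it forces K and U to end alike. *)
Lemma end_move_factor b s D U E K : end_move b s D U E -> homq s U K ->
  (exists2 p, p \in U & p \in K) ->
  (homq s E K /\ forall x, x \in U -> x \in K -> x \in E) \/ same_end b K U.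
Proof.
case=> -[cD UE Er] UK [p0 p0U p0K].
  have [D0 Dc P1 P2 P3] := cD.
  have [[d [Dd dK]]|nD] := pselect (exists d, D d /\ d \in K); last first.
    left; split=> [x y yx xE yK|x xU xK]; last first.
      by case: ((UE x).1 xU) => // Dx; case: nD; exists x.
    rewrite -(UK x y yx) //; last by apply/UE; right.
    apply/idP/idP => [yE|yU]; first by apply/UE; right.
    by case: ((UE y).1 yU) => // Dy; case: nD; exists y.
  right; have dU : d \in U by apply/UE; left.
  exists d; split=> // x xd; apply/idP/idP => [xK|xU]; last first.
    case: ((UE x).1 xU) => [Dx|xE]; last first.
      by have := Er x xE d Dd; rewrite ltbN => /(ltb_asym xd).
    by rewrite -(UK x d) //; exact: P2.
  case: (beyond_cases x cD) => [lx|Dx|rx].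
  (* If K went beyond D, it would contain both x' and the first point of D, and the morphism
     condition would put x' into U. *)
  - have [x' [lo [xx' lx' Dlo lomin x'lo]]] := P3 x lx.
    have x'K : x' \in K.
      by case: xx' => [->//|xx']; apply: itv_ltb xK dK xx' (lx' d Dd).
    have loK : lo \in K.
      by case: (lomin d Dd) => [<-//|lod]; apply: itv_ltb xK dK (lx lo Dlo) lod.
    have : x' \in U by rewrite (UK lo x') //; apply/UE; left.
    case/UE => [Dx'|/Er x'r]; first by case: (not_beyond Dx' lx').
    by case: (not_beyond2 D0 lx' x'r).
  - by apply/UE; left.
  - by have := rx d Dd; rewrite ltbN => /(ltb_asym xd).
have [D0 Dc P1 P2 P3] := cD.
have {}P1 d y : D d -> qb s d y -> ~ beyond b D y -> D y by rewrite -qbN; exact: P1.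
have {}P2 x d : D x -> D d -> ltb b x d -> qb s x d by rewrite -qbN; exact: P2.
have [|nse] := pselect (same_end b K U); [by right | left].
have UD x : x \in U -> ~ D x by move=> /Er r Dx; case: (not_beyond Dx r).
have UnB x : x \in U -> ~ beyond b D x.
  by move=> /Er r lb; exact: not_beyond2 D0 lb r.
have dU d x : D d -> x \in U -> ltb b d x.
  by move=> Dd /Er /(_ d Dd); rewrite ltbN.
have ED x : D x -> x \in E by move=> Dx; apply/UE; left.
have EU x : x \in U -> x \in E by move=> xU; apply/UE; right.
split; last by move=> x xU _; exact: EU.
move=> x y yx xE yK; apply/idP/idP => [yE|xK].
  case: ((UE y).1 yE) ((UE x).1 xE) => [Dy|yU] [Dx|xU].
  - case: (ltb_total b x y) => [xy|->//|yx']; first by rewrite (qb_anti (P2 x y Dx Dy xy) yx).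
    by apply: itv_ltb yK p0K yx' (dU _ _ Dx p0U).
  - by case: (UD x xU); apply: (P1 y) => //; exact: UnB.
  (* As x is outside K, convexity keeps K on the inner side of x; between x and y it agrees with
     U. *)
  - apply: contrapT => nxK; apply: nse; exists y; split=> // z zy.
    apply/idP/idP => [zK|zU].
      apply: contrapT => nzU.
      case: (ltb_total b z x) => [zx|zx|xz].
      + by apply: nxK; apply: itv_ltb zK yK zx (dU _ _ Dx yU).
      + by apply: nxK; rewrite -zx.
      have zE : z \in E by apply: itv_ltb xE yE xz zy.
      case: ((UE z).1 zE) => // Dz.
      have [_ zx] : qb s y z /\ qb s z x by apply: (qb_mid (b := ~~ b) yx); rewrite ltbN.
      by apply: (@ltb_irr b x); rewrite -{2}(qb_anti zx (P2 x z Dx Dz xz)).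
    have [yz _] : qb s y z /\ qb s z x.
      by apply: (qb_mid (b := ~~ b) yx); rewrite ltbN // dU.
    by rewrite -(UK z y).
  - by rewrite -(UK x y).
case: ((UE x).1 xE) => [Dx|xU]; last by apply: EU; rewrite (UK x y).
case: (beyond_cases y cD) => [ly|Dy|ry]; last 2 first.
- exact: ED.
- have xy : ltb b x y by have := ry x Dx; rewrite ltbN.
  case: (ltb_total b y p0) => [yp|->|py]; [|exact: EU|].
    by apply: itv_ltb xE (EU _ p0U) xy yp.
  have [yp _] : qb s y p0 /\ qb s p0 x.
    by apply: (qb_mid (b := ~~ b) yx); rewrite ltbN // dU.
  by apply: EU; rewrite (UK p0 y).
have [y' [lo [yy' ly' Dlo lomin y'lo]]] := P3 y ly.
rewrite qbN in y'lo.
have y'x : qb s y' x.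
  case: yy' => [->//|yy']; exact: (qb_mid yx yy' (ly' x Dx)).2.
have loy' : qb s y' lo.
  case: (lomin x Dx) => [<-//|lox]; exact: (qb_mid y'x (ly' lo Dlo) lox).1.
by case: (@not_beyond b D lo Dlo); rewrite -(qb_anti loy' y'lo).
Qed.

Lemma same_ends K U : same_end true K U -> same_end false K U ->
  forall x, (x \in K) = (x \in U).
Proof.
move=> [p [pK pU Hp]] [r [rK rU Hr]] x.
have [xp|px] := ltP x p; first exact: Hp.
have [rx|xr] := ltP r x; first exact: Hr.
have pxr : p <= x <= r by rewrite px.
by rewrite (itv_convex pK rK pxr) (itv_convex pU rU pxr).
Qed.

End Cells.

(** * Almost split squares *)

Section Squares.
Variables (k : fieldType) (R : realType) (A : contA R).
Implicit Types (I J K U E W : interval R) (X Y : rep k A).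

Record square (D1 D2 : set R) U E1 E2 W : Prop := {
  sq_UE2 : end_move A true true D1 U E2;
  sq_E1W : end_move A true true D1 E1 W;
  sq_UE1 : end_move A false true D2 U E1;
  sq_E2W : end_move A false true D2 E2 W;
  sq_disj : forall x, D1 x -> ~ D2 x }.

Section FixSquare.
Variables (D1 D2 : set R) (U E1 E2 W : interval R).
Hypothesis sq : square D1 D2 U E1 E2 W.
Let s := itv_ses k A U E1 E2 W.

(** The two cells are disjoint, so at each point at most one of the two ends is moved. This is the
    whole reason for exactness: at each point two opposite sides of the square are identities. *)
Lemma square_mem x : (x \in U = (x \in E1) /\ x \in E2 = (x \in W)) \/
  (x \in U = (x \in E2) /\ x \in E1 = (x \in W)).
Proof.
have [UE2 E1W UE1 E2W disj] := sq; have [D2x|D2x] := pselect (D2 x); last first.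
  by left; split; [apply: end_move_mem UE1 _ | apply: end_move_mem E2W _].
have D1x : ~ D1 x by move=> /disj; apply.
by right; split; [apply: end_move_mem UE2 _ | apply: end_move_mem E1W _].
Qed.

Lemma square_fE x v : ses_f s x v = fam_pair (can U E1) (can U E2) x v.
Proof. by rewrite fam_pairE lfunE. Qed.

Lemma square_gE x v : ses_g s x v =
  fam_copair (can E1 W) (fam_scale (-1) (can E2 W)) x v.
Proof. by rewrite fam_copairE lfunE /= scale_lfunE scaleN1r. Qed.

Lemma square_mor : is_mor (ses_f s) /\ is_mor (ses_g s).
Proof.
have [/end_move_hom UE2 /end_move_hom E1W /end_move_hom UE1 /end_move_hom E2W _] := sq.
have fm : is_mor (fam_pair (can U E1) (can U E2) : fam (M k A U) _).
  by apply: mor_pair; exact: can_mor.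
have gm : is_mor (fam_copair (can E1 W) (fam_scale (-1) (can E2 W)) : fam _ (M k A W)).
  by apply: mor_copair; [|apply: mor_scale]; exact: can_mor.
by split=> x y yx v; [rewrite !square_fE; exact: fm | rewrite !square_gE; exact: gm].
Qed.

Lemma square_exact : short_exact s.
Proof.
have [fm gm] := square_mor; split=> //.
- move=> x v w; rewrite !square_fE !fam_pairE !canE => -[h1 h2].
  rewrite -[v]cfK -[w]cfK; apply/row_const => xU.
  move: h1 h2; rewrite !row_const => h1 h2.
  by case: (square_mem x) => -[UE _]; [apply: h1 | apply: h2]; rewrite -UE.
- move=> x w; case: (square_mem x) => -[_ EW].
    exists (0, const_mx (- cf w)); rewrite square_gE fam_copairE linear0 add0r /=.
    rewrite scale_lfunE scaleN1r canE -[RHS]cfK; apply/rowP => j; rewrite !mxE.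
    rewrite [X in - X]cf_const EW.
    have /orP[xW|xW] := orbN (x \in W); first by rewrite ifT // opprK.
    by rewrite cf_false // oppr0 if_same oppr0.
  exists (const_mx (cf w), 0); rewrite square_gE fam_copairE linear0 addr0 /=.
  rewrite canE -[RHS]cfK; apply/row_const => xW.
  by rewrite [LHS]cf_const EW ifT.
move=> x; apply/eqP; rewrite eqEsubv; apply/andP; split; apply/subvP.
  move=> _ /memv_imgP[v _ ->]; rewrite memv_ker; apply/eqP.
  rewrite square_gE square_fE fam_copairE fam_pairE /= scale_lfunE scaleN1r !canE.
  apply/rowP => j; rewrite !mxE [X in X - _]cf_const [X in _ - X]cf_const.
  case: (square_mem x) => -[UE EW].
    rewrite EW -UE; case: (x \in W) j => [[]|[]] // _ _.
    have /orP[xU|xU] := orbN (x \in U); first by rewrite ifT // subrr.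
    by rewrite cf_false // if_same subrr.
  rewrite EW -UE; case: (x \in W) j => [[]|[]] // _ _.
  have /orP[xU|xU] := orbN (x \in U); first by rewrite ifT // subrr.
  by rewrite cf_false // if_same subrr.
move=> [a b]; rewrite memv_ker square_gE fam_copairE /= scale_lfunE scaleN1r !canE.
rewrite subr_eq0 => /eqP/row_const ab.
case: (square_mem x) => -[UE EW].
  have -> : (a, b) = ses_f s x (const_mx (cf a)).
    rewrite square_fE fam_pairE !canE [cf (const_mx _)]cf_const -[a in LHS]cfK -[b in LHS]cfK.
    congr (_, _); apply/row_const => xE; first by rewrite ifT // UE.
    rewrite -ab -?EW //; have /orP[xU|xU] := orbN (x \in U); first by rewrite ifT.
    by rewrite cf_false -?UE // if_same.
  exact: memv_img (memvf _).
have -> : (a, b) = ses_f s x (const_mx (cf b)).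
  rewrite square_fE fam_pairE !canE [cf (const_mx _)]cf_const -[a in LHS]cfK -[b in LHS]cfK.
  congr (_, _); apply/row_const => xE; last by rewrite ifT // UE.
  rewrite ab -?EW //; have /orP[xU|xU] := orbN (x \in U); first by rewrite ifT.
  by rewrite cf_false -?UE // if_same.
exact: memv_img (memvf _).
Qed.

Hypotheses (U_rep : in_rep (M k A U)) (E1_rep : in_rep (M k A E1))
  (E2_rep : in_rep (M k A E2)) (W_rep : in_rep (M k A W)).
Hypotheses (U0 : Defs.nonempty U) (W0 : Defs.nonempty W).

Lemma hom_meets I J (f : fam (M k A I) (M k A J)) c :
  (forall x v, f x v = c *: can I J x v) -> nontrivial f ->
  c != 0 /\ exists2 x, x \in I & x \in J.
Proof.
move=> fE [x [v fv]]; split.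
  by apply/eqP => c0; apply: fv; rewrite fE c0 scale0r.
exists x; apply/negPn/negP => /negP xN; apply: fv; last exact: M_zero.
by rewrite (M_zero v xN) linear0.
Qed.

Lemma square_AR : AR_seq s.
Proof.
have [UE2 E1W UE1 E2W disj] := sq; have [fm gm] := square_mor.
split.
- by split=> //; [exact: in_rep_sum | exact: square_exact].
- split=> [[r [rm rf]]|[r [rm rg]]].
    by have [] := retract_sum fm rm U0 rf; [exact: end_move_neq UE1 | exact: end_move_neq UE2].
  have [] := retract_sum rm gm W0 rg => H.
    by apply: (end_move_neq E1W) => x; rewrite H.
  by apply: (end_move_neq E2W) => x; rewrite H.
- by split; apply: indecomposable_M.
- move=> X h X_indec XU hm hn.
  have [K [K0 K_rep [t [tm [t' [tm' tt']]]]]] := indec_itv X_indec.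
  have [c [cE ch]] := mor_scalar (mor_comp tm' hm).
  have [|c0 [p pU pK]] := hom_meets cE.
    have [x [v hv]] := hn; exists x, v; rewrite comp_lfunE => E; apply: hv.
    by rewrite -[LHS](tt' x).2 E linear0.
  have UK : homq A true U K by apply: ch c0 _; exists p.
  have KU : ~ (forall x, (x \in K) = (x \in U)).
    move=> KU; apply: XU; apply: iso_trans (iso_sym _) _; first by exists t; split=> //; exists t'.
    by rewrite (set_itv_inj pK KU); exact: iso_refl.
  have fac E (pr : fam (rsum (M k A E1) (M k A E2)) (M k A E)) :
      is_mor pr -> (forall x v, pr x (ses_f s x v) = can U E x v) ->
      hom A E K -> (forall x, x \in U -> x \in K -> x \in E) ->
      exists h' : fam (ses_E s) X, is_mor h' /\ forall x v, h' x (ses_f s x v) = h x v.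
    move=> prm prE EK UKE.
    exists (fam_comp t (fam_comp (fam_scale c (can E K)) pr)); split.
      by apply: mor_comp => //; apply: mor_comp => //; apply/mor_scale/can_mor.
    move=> x v; rewrite !comp_lfunE prE scale_lfunE can_comp //; last exact: UKE.
    by rewrite -cE comp_lfunE (tt' x).2.
  case: (end_move_factor UE2 UK); first by exists p.
    move=> [EK UKE]; apply: (fac E2 (@fam_snd _ _ _ _ _)) => //; first exact: mor_snd.
    by move=> x v; rewrite square_fE fam_sndE fam_pairE.
  move=> sl; case: (end_move_factor UE1 UK); first by exists p.
    move=> [EK UKE]; apply: (fac E1 (@fam_fst _ _ _ _ _)) => //; first exact: mor_fst.
    by move=> x v; rewrite square_fE fam_fstE fam_pairE.
  by move=> sr; case: KU; exact: same_ends.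
- move=> X h X_indec XW hm hn.
  have [K [K0 K_rep [t [tm [t' [tm' tt']]]]]] := indec_itv X_indec.
  have [c [cE ch]] := mor_scalar (mor_comp hm tm).
  have [|c0 [p pK pW]] := hom_meets cE.
    have [x [v hv]] := hn; exists x, (t' x v); rewrite comp_lfunE (tt' x).2.
    exact: hv.
  have KW : homq A (~~ true) W K by apply/homqN; apply: ch c0 _; exists p.
  have nKW : ~ (forall x, (x \in K) = (x \in W)).
    move=> KW'; apply: XW; apply: iso_trans (iso_sym _) _; first by exists t; split=> //; exists t'.
    by rewrite (set_itv_inj pK KW'); exact: iso_refl.
  have fac E d (i : fam (M k A E) (rsum (M k A E1) (M k A E2))) :
      is_mor i -> (forall x v, d *: ses_g s x (i x v) = can E W x v) ->
      homq A (~~ true) E K -> (forall x, x \in W -> x \in K -> x \in E) ->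
      exists h' : fam X (ses_E s), is_mor h' /\ forall x v, ses_g s x (h' x v) = h x v.
    move=> im iE /homqN EK WKE.
    exists (fam_comp i (fam_comp (fam_scale (d * c) (can K E)) t')); split.
      by apply: mor_comp => //; apply: mor_comp => //; apply/mor_scale/can_mor.
    move=> x v; rewrite !comp_lfunE scale_lfunE !linearZ /= mulrC -scalerA iE.
    rewrite can_comp; last by move=> xK xW; exact: WKE.
    by rewrite -cE comp_lfunE (tt' x).2.
  case: (end_move_factor (end_moveN E1W) KW); first by exists p.
    move=> [EK UKE]; apply: (fac E1 1 (@fam_inl _ _ _ _ _)) => //; first exact: mor_inl.
    move=> x v; rewrite scale1r square_gE fam_copairE fam_inlE /= linear0.
    by rewrite addr0.
  (* The scalar -1 for E2 cancels the sign in the epimorphism [1, -1]. *)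
  move=> sl; case: (end_move_factor (end_moveN E2W) KW); first by exists p.
    move=> [EK UKE]; apply: (fac E2 (-1) (@fam_inr _ _ _ _ _)) => //; first exact: mor_inr.
    move=> x v; rewrite square_gE fam_copairE fam_inrE /= linear0 add0r.
    by rewrite scale_lfunE scalerA mulrNN mulr1 scale1r.
  by move=> sr; case: nKW; exact: same_ends.
Qed.

End FixSquare.
End Squares.

(** * Left almost split maps *)

Section LeftAlmostSplit.
Variables (k : fieldType) (R : realType) (A : contA R).
Implicit Types (I J K : interval R) (V X Y : rep k A) (x y z c : R) (b : bool).

Lemma itv_of_ltb b (X : set R) :
  (forall x y z, X x -> X z -> ltb b x y -> ltb b y z -> X y) ->
  exists I : interval R, forall x, x \in I <-> X x.
Proof.
move=> Xc; have [I IE] : exists I : interval R, [set` I] = X.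
  apply: itv_of => x y Xx Xy z; rewrite !le_eqVlt => /andP[/predU1P[<-//|xz]].
  move=> /predU1P[->//|zy]; case: b Xc => Xc; first exact: Xc Xx Xy xz zy.
  exact: Xc Xy Xx zy xz.
by exists I => x; rewrite -IE.
Qed.

Definition cfl (b : bool) : 'Hom('rV[k]_b, k^o) := lfun_of (@cf_linear k b).

Lemma cflE (b : bool) (v : 'rV_b) : cfl b v = cf v.
Proof. exact: lfun_ofE. Qed.

Lemma mor_cf J V (phi : fam V (M k A J)) x y v : is_mor phi -> qle A y x ->
  y \in J -> cf (phi y (rmap V x y v)) = if x \in J then cf (phi x v) else 0.
Proof.
move=> pm yx yJ; rewrite pm // rmapME [LHS]cf_const yJ.
have /orP[xJ|xJ] := orbN (x \in J); first by rewrite ifT.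
by rewrite ifN // cf_false.
Qed.

Lemma mor_of_functionals K V (g : forall x, 'Hom(V x, k^o)) :
  (forall x y, qle A y x -> y \in K -> forall v,
     g y (rmap V x y v) = if x \in K then g x v else 0) ->
  exists r : fam V (M k A K), is_mor r /\ forall x v, r x v = const_mx (g x v).
Proof.
move=> gE; have lr x : linear (fun v : V x => const_mx (g x v) : M k A K x).
  by move=> a v w; rewrite linearP; apply/rowP => j; rewrite !mxE.
exists (fun x => lfun_of (lr x)); split=> [|x v]; last exact: lfun_ofE.
move=> x y yx v; rewrite (lfun_ofE (lr x)) (lfun_ofE (lr y)) rmapME.
by apply/row_const => yK; rewrite cf_const gE.
Qed.

(** The factorization property of the first map of an almost split sequence, tested on interval
    modules and their canonical maps only. *)
Definition left_almost K V (f : fam (M k A K) V) :=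
  forall J, in_rep (M k A J) -> (exists2 x, x \in K & x \in J) -> hom A K J ->
    ~ (forall x, (x \in J) = (x \in K)) ->
    exists phi : fam V (M k A J), is_mor phi /\
      forall x v, phi x (f x v) = can K J x v.

Lemma ltb_dense b x y : ltb b x y -> exists2 z, ltb b x z & ltb b z y.
Proof.
by case: b => /= xy; exists ((x + y) / 2); rewrite ?midf_lt //;
  rewrite addrC midf_lt.
Qed.

Lemma qle_midb b x y z : qle A x y -> ltb b x z -> ltb b z y ->
  qle A x z /\ qle A z y.
Proof. exact: (@qb_mid _ _ true). Qed.

(* K is extended past its end [c] to J, which starts just inside the point [x1]
   where V x -> V c has maximal rank; the map V -> M_J then vanishes at [c] on
   all that comes from J \ K, so it restricts to a retraction onto M_K. *)
Lemma left_almost_enlarge b K c x0 V (f : fam (M k A K) V) :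
  in_rep (M k A K) -> c \in K -> (forall x, x \in K -> x = c \/ ltb b c x) ->
  ltb b x0 c -> qle A c x0 -> is_mor f -> left_almost f -> is_section f.
Proof.
move=> K_rep cK Kc x0c cx0 fm fl.
pose S : set R := [set x | (x = x0 \/ ltb b x0 x) /\ ltb b x c].
have Sq x y : S x -> S y -> ltb b x y -> qle A y x.
  move=> [[->|x0x] xc] [[y0|x0y] yc] xy.
  - by rewrite y0; exact: qle_refl.
  - by have [] := @qle_midb (~~ b) c x0 y cx0; rewrite ?ltbN.
  - by case: (ltb_asym x0x); rewrite -y0.
  - have [cx _] : qle A c x /\ qle A x x0 by apply: (@qle_midb (~~ b)); rewrite ?ltbN.
    by have [] := @qle_midb (~~ b) c x y cx; rewrite ?ltbN.
have Sc x : S x -> qle A c x.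
  move=> [[->//|x0x] xc].
  by have [] := @qle_midb (~~ b) c x0 x cx0; rewrite ?ltbN.
have [||x1 Sx1 xmax] := @ex_argmax _ S (fun x => \dim (limg (rmap V x c))) (\dim {:V c}).
- by exists x0; split=> //; left.
- by move=> x _; apply: dimvS; exact: subvf.
have [x2 x12 x2c] := ltb_dense Sx1.2.
have Sx2 : S x2.
  split=> //; right; case: Sx1.1 => [<-//|x01]; exact: ltb_trans x12.
have Kx2 y : y \in K -> ltb b x2 y.
  by move=> /Kc[->//|]; apply: ltb_trans.
have [J JE] : exists J : interval R, forall y, y \in J <->
    (y = x2 \/ ltb b x2 y) /\ (ltb b y c \/ y \in K).
  apply: (@itv_of_ltb b) => x y z [x2x xc] [x2z zc] xy yz; split.
    by right; case: x2x => [<-//|x2x]; exact: ltb_trans xy.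
  case: (ltb_total b y c) => [yc|->|cy]; [by left | by right | right].
  case: zc => [zc|zK]; last exact: itv_ltb cK zK cy yz.
  by case: (ltb_asym zc); exact: ltb_trans yz.
have KJ y : y \in K -> y \in J.
  by move=> yK; apply/JE; split; right=> //; exact: Kx2.
have JS y : y \in J -> ~ y \in K -> S y.
  move=> /JE[x2y [yc|//]] _; split=> //; right.
  have x02 : ltb b x0 x2 by case: Sx1.1 => [<-//|x01]; exact: ltb_trans x12.
  by case: x2y => [->//|]; apply: ltb_trans.
have cJ : c \in J by exact: KJ.
have x2J : x2 \in J by apply/JE; split; left.
have x2K : ~ x2 \in K by move=> /Kx2; exact: ltb_irr.
have J_rep : in_rep (M k A J).
  apply: in_rep_fin; apply: fin_supp_sub (fin_suppU ((in_rep_itvP _ _ _).1 K_rep)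
    (fin_supp_comparable A c)) => y /= yJ.
  have [yK|yK] := pselect (y \in K); first by left.
  by right; right; apply/Sc/JS.
have KJh : hom A K J.
  move=> x y yx xK yJ; rewrite (KJ x xK); apply/negPn/negP => /negP yK.
  have cy := Sc y (JS y yJ yK).
  have yc : qle A y c.
    case: (Kc x xK) => [<-//|cx].
    exact: (@qle_midb b y x c yx (JS y yJ yK).2 cx).1.
  by apply: yK; rewrite (qle_anti yc cy).
have [||phi [pm pf]] := fl J J_rep _ KJh.
- by exists c.
- by move=> /(_ x2); rewrite x2J => /esym.
(* The images of V x in V c form a chain whose largest member comes from x1. As x1 lies outside J,
   naturality makes phi vanish on that image, hence on all of them. *)
have kill x w : S x -> cf (phi c (rmap V x c w)) = 0.
  move=> Sx; have [v ->] : exists v, rmap V x c w = rmap V x1 c v.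
    suff : rmap V x c w \in limg (rmap V x1 c).
      by case/memv_imgP => v _ ->; exists v.
    case: (ltb_total b x x1) => [xx1|<-|x1x]; last 2 first.
    - by rewrite memv_img ?memvf.
    - have /eqP -> : limg (rmap V x1 c) == limg (rmap V x c).
        rewrite eqEdim xmax // andbT; apply/subvP => _ /memv_imgP[u _ ->].
        by rewrite -(rmapC u (Sq _ _ Sx1 Sx x1x) (Sc x Sx)) memv_img ?memvf.
      by rewrite memv_img ?memvf.
    - by rewrite -(rmapC w (Sq _ _ Sx Sx1 xx1) (Sc x1 Sx1)) memv_img ?memvf.
  rewrite mor_cf //; last exact: Sc.
  case: ifP => // /JE[[x21|x21] _]; last by case: (ltb_asym x12).
  by case: (@ltb_irr _ b x1); rewrite {2}x21.
have [x y yx yK v|r [rm rE]] :=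
    @mor_of_functionals K V (fun y => (cfl (y \in J) \o phi y)%VF).
  rewrite !comp_lfunE !cflE mor_cf //; last exact: KJ.
  have [xK|/negP xK] := boolP (x \in K); first by rewrite ifT ?KJ.
  have /orP[xJ|xJ] := orbN (x \in J); last by rewrite ifN.
  have Sx := JS x xJ xK.
  have [yc cx] : qle A y c /\ qle A c x.
    case: (Kc y yK) => [->|cy]; first by split; [exact: qle_refl | exact: Sc].
    by apply: (@qle_midb (~~ b)); rewrite ?ltbN //; exact: Sx.2.
  have := mor_cf (phi := phi) v pm yx (KJ y yK); rewrite ifT // => <-.
  by rewrite -(rmapC v cx yc) mor_cf ?KJ // ifT // kill.
exists r; split=> // x v; rewrite rE comp_lfunE cflE pf canE.
rewrite -[RHS]cfK; apply/row_const => xK.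
by rewrite [LHS]cf_const ifT ?KJ.
Qed.

(* V is constant along K near its open end, so the map V -> M_J for the
   truncation J of K at [z1] extends back to a retraction onto M_K. *)
Lemma left_almost_shrink b K x1 V (f : fam (M k A K) V) :
  in_rep (M k A K) -> in_rep V -> x1 \in K ->
  (forall x, x \in K -> exists2 y, y \in K & ltb b y x) ->
  (forall x y, x \in K -> y \in K -> ltb b x y -> y = x1 \/ ltb b y x1 ->
     qle A x y) ->
  is_mor f -> left_almost f -> is_section f.
Proof.
move=> K_rep V_rep x1K Kopen Kq fm fl.
pose C : set R := [set y | y \in K /\ (y = x1 \/ ltb b y x1)].
have Cq x y : C x -> C y -> ltb b x y -> qle A x y.
  by move=> [xK _] [yK yx1] xy; exact: Kq.
have [||z1 [z1K z1x1] zb] := @tame_down _ _ _ V C V_rep.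
- by exists x1; split=> //; left.
- move=> x y Cx Cy; case: (ltb_total b x y) => xy.
  + by exists x => //; split; [exact: qle_refl | exact: Cq].
  + by exists x => //; rewrite -xy; split; exact: qle_refl.
  + by exists y => //; split; [exact: Cq | exact: qle_refl].
have Cz1 : C z1 by [].
have leC y : y \in K -> ltb b y z1 -> C y.
  move=> yK yz; split=> //; right; case: z1x1 => [<-//|]; exact: ltb_trans.
have ltq y : y \in K -> ltb b y z1 -> qle A y z1.
  by move=> yK yz; apply: Cq => //; exact: leC.
have inv y : y \in K -> ltb b y z1 -> cancel (rmap V z1 y) (rmap V z1 y)^-1%VF /\
    cancel (rmap V z1 y)^-1%VF (rmap V z1 y).
  by move=> yK yz; apply/lfun_bij_inv/zb; [exact: leC | exact: ltq].
have [J JE] : exists J : interval R, forall y, y \in J <->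
    y \in K /\ (y = z1 \/ ltb b z1 y).
  apply: (@itv_of_ltb b) => x y z [xK zx] [zK _] xy yz; split.
    exact: itv_ltb xK zK xy yz.
  by right; case: zx => [<-//|zx]; exact: ltb_trans xy.
have JK y : y \in J -> y \in K by move=> /JE[].
have z1J : z1 \in J by apply/JE; split=> //; left.
have KJc y : y \in K -> y \in J \/ ltb b y z1.
  move=> yK; case: (ltb_total b y z1) => h; [by right | left | left].
    by apply/JE; split=> //; left.
  by apply/JE; split=> //; right.
have noq x y : x \in K -> ltb b x z1 -> y \in J -> ~ qle A y x.
  move=> xK xz /JE[yK zy] yx; have z1x : qle A z1 x.
    case: zy => [yz|zy]; first by rewrite -yz.
    by have [] := @qle_midb (~~ b) y x z1 yx; rewrite ?ltbN.
  by apply: (@ltb_irr _ b x); rewrite {2}(qle_anti (ltq x xK xz) z1x).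
have J_rep : in_rep (M k A J).
  apply: in_rep_fin; apply: fin_supp_sub ((in_rep_itvP _ _ _).1 K_rep).
  by move=> y /= /JK.
have KJh : hom A K J.
  move=> x y yx xK yJ; rewrite (JK y yJ); apply/esym.
  by case: (KJc x xK) => // xz; case: (noq x y).
have [||phi [pm pf]] := fl J J_rep _ KJh.
- by exists z1.
- have [y yK yz] := Kopen z1 z1K; move=> /(_ y); rewrite yK => /JE[_ [yz1|zy]].
    by apply: (@ltb_irr _ b y); rewrite {2}yz1.
  exact: ltb_asym yz zy.
(* On the part of K cut off from J, vectors are first moved back to z1, where phi is available. *)
pose g y : 'Hom(V y, k^o) := if (y == z1) || ltb b z1 y then (cfl (y \in J) \o phi y)%VF
  else (cfl (z1 \in J) \o (phi z1 \o (rmap V z1 y)^-1))%VF.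
have gJ y v : y \in J -> g y v = cf (phi y v).
  move=> /JE[_ zy]; rewrite /g ifT ?comp_lfunE ?cflE //.
  by apply/orP; case: zy => [->|zy]; [left | right].
have gz y v : ltb b y z1 -> g y v = cf (phi z1 ((rmap V z1 y)^-1%VF v)).
  move=> yz; rewrite /g ifF ?comp_lfunE ?cflE ?comp_lfunE //.
  apply/negP => /orP[/eqP yz1|]; last exact: ltb_asym.
  by apply: (@ltb_irr _ b y); rewrite {2}yz1.
have [x y yx yK v|r [rm rE]] := @mor_of_functionals K V g.
  have [yJ|yz] := KJc y yK.
    rewrite gJ // mor_cf //; have [xK|xK] := boolP (x \in K).
      have [xJ|xz] := KJc x xK; first by rewrite ifT // gJ.
      by case: (noq x y).
    by rewrite ifN //; apply: contra xK => /JK.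
  rewrite gz //; have [xK|/negP xK] := boolP (x \in K).
    have [xJ|xz] := KJc x xK.
      rewrite gJ //; have z1x : qle A y z1 /\ qle A z1 x.
        case/JE: (xJ) => _ [->|zx]; last exact: (@qle_midb b).
        by split; [exact: ltq | exact: qle_refl].
      rewrite -(rmapC v z1x.2 z1x.1) (inv y yK yz).1 mor_cf ?ifT //.
      exact: z1x.2.
    rewrite gz // -[v in LHS](inv x xK xz).2 (rmapC _ (ltq x xK xz) yx).
    by rewrite (inv y yK yz).1.
  (* It remains to kill what enters K from a point x outside. If x lies beyond the open end, a point
     of K strictly between x and y contradicts the direction of the order there; if x lies on the
     other side, the map passes through z1, where phi vanishes on vectors coming from outside J. *)
  case: (ltb_total b x y) => [xy|xy|yx'].
  - have [z zK zy] := Kopen y yK.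
    have xz : ltb b x z.
      case: (ltb_total b x z) => [//|xz|zx]; first by case: xK; rewrite xz.
      by case: xK; exact: itv_ltb zK yK zx xy.
    have [yz' _] : qle A y z /\ qle A z x by apply: (@qle_midb (~~ b)); rewrite ?ltbN.
    have zy' : qle A z y by apply: Cq => //; apply: leC => //; exact: ltb_trans yz.
    by case: (@ltb_irr _ b z); rewrite {2}(qle_anti zy' yz').
  - by case: xK; rewrite xy.
  have zx : ltb b z1 x.
    case: (ltb_total b z1 x) => [//|zx|xz]; first by case: xK; rewrite -zx.
    by case: xK; exact: itv_ltb yK z1K yx' xz.
  have [yz1 z1x] := @qle_midb b y x z1 yx yz zx.
  rewrite -(rmapC v z1x yz1) (inv y yK yz).1 mor_cf // ifN //.
  by apply/negP => /JK.
exists r; split=> // x v; rewrite rE -[RHS]cfK; apply/row_const => xK.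
have [xJ|xz] := KJc x xK.
  by rewrite gJ // pf canE [LHS]cf_const ifT.
rewrite gz //; have vE : v = rmap (M k A K) z1 x (const_mx (cf v) : 'rV_(z1 \in K)).
  by rewrite rmapME [cf (const_mx _)]cf_const ifT // cfK.
rewrite {1}vE fm ?(inv x xK xz).1 ?pf ?canE; last exact: ltq.
by rewrite [LHS]cf_const ifT // [LHS]cf_const ifT.
Qed.

End LeftAlmostSplit.

(** * Cells *)

Section ConcreteCells.
Variables (R : realType) (A : contA R).
Implicit Types (x y z a r : R) (n m : int) (lo hi : \bar R) (e c : bool).

(* A cell is a pair of ends related by an irreducible change of that end: the
   point [a] off S, or a whole segment [s_n, s_(n+1)].  [e] is the parity for
   which the left end [lend e] is the one that occurs in the first term of an
   Auslander-Reiten sequence. *)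
Inductive cell : bool -> \bar R -> \bar R -> Prop :=
| CellPt n a : has_idx A n -> has_idx A (n + 1) ->
    (pt A n < a%:E < pt A (n + 1))%E -> cell (evenz n) a%:E a%:E
| CellSeg n : has_idx A n -> has_idx A (n + 1) ->
    cell (~~ evenz n) (pt A n) (pt A (n + 1)).

(** An interval with end [lend true] contains the cell, one with [lend false] begins right after it;
    negating [c] moves the end across the cell. *)
Definition lend c lo hi := if c then lbd true lo else lbd false hi.
Definition rend c lo hi := if c then ubd true hi else ubd false lo.
Definition dset lo hi : set R := [set x | (lo <= x%:E <= hi)%E].

Lemma lbdE c (a : \bar R) x :
  (lbd c a <= BLeft x)%O = if c then (a <= x%:E)%E else (a < x%:E)%E.
Proof.
by case: a c => [r| |] [] //=; rewrite ?bnd_simp ?lee_fin ?lte_fin ?leNye ?ltNyr.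
Qed.

Lemma ubdE c (a : \bar R) x :
  (BRight x <= ubd c a)%O = if c then (x%:E <= a)%E else (x%:E < a)%E.
Proof.
by case: a c => [r| |] [] //=; rewrite ?bnd_simp ?lee_fin ?lte_fin ?leey ?ltry.
Qed.

Lemma lendE c lo hi x :
  (lend c lo hi <= BLeft x)%O = if c then (lo <= x%:E)%E else (hi < x%:E)%E.
Proof. by case: c; rewrite /lend lbdE. Qed.

Lemma rendE c lo hi x :
  (BRight x <= rend c lo hi)%O = if c then (x%:E <= hi)%E else (x%:E < lo)%E.
Proof. by case: c; rewrite /rend ubdE. Qed.

Lemma seg_left m r x : has_idx A m -> has_idx A (m + 1) ->
  (pt A m < r%:E <= pt A (m + 1))%E -> x < r ->
  exists x', [/\ x <= x', x' < r & inseg A m x'].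
Proof.
move=> hm hm1 /andP[mr rm] xr; have [mx|xm] := leP (pt A m) x%:E.
  exists x; split=> //; split=> //; rewrite mx (le_trans _ rm) // lee_fin.
  exact: ltW.
have [r' [rE /andP[xr' r'r]]] := ereal_between (ltW xm) (ltW mr).
exists r'; split=> //; first by move: mr; rewrite rE lte_fin.
by split=> //; rewrite rE lexx -rE pt_le ?lerDl.
Qed.

Lemma seg_right m r x : has_idx A m -> has_idx A (m + 1) ->
  (pt A m <= r%:E < pt A (m + 1))%E -> r < x ->
  exists x', [/\ r < x', x' <= x & inseg A m x'].
Proof.
move=> hm hm1 /andP[mr rm] xr; have [mx|xm] := leP x%:E (pt A (m + 1)).
  exists x; split=> //; split=> //; rewrite mx (le_trans mr) // lee_fin.
  exact: ltW.
have [r' [rE /andP[xr' r'r]]] := ereal_between (ltW rm) (ltW xm).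
exists r'; split=> //; first by move: rm; rewrite rE lte_fin.
by split=> //; rewrite rE lexx -rE pt_le ?lerDl.
Qed.

Lemma seg_qb n x y : inseg A n x -> inseg A n y -> x <= y -> qb A (evenz n) x y.
Proof.
by move=> xn yn xy; rewrite /qb; case: ifP => e; apply: (@seg_qle _ _ n); rewrite ?e.
Qed.

(** A point off S lies in one segment only, so all its relations have the direction of that
    segment. *)
Lemma open_seg_qb n a y : has_idx A n -> has_idx A (n + 1) ->
  (pt A n < a%:E < pt A (n + 1))%E ->
  (qb A (evenz n) y a -> y <= a) /\ (qb A (evenz n) a y -> a <= y).
Proof.
move=> hn hn1 an; rewrite /qb.
have H x z : qle A x z -> (x = a \/ z = a) ->
    if evenz n then x <= z else z <= x.
  move=> /qle_witness[m [xm zm h]] xz; have mn : m = n.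
    by case: xz => E; apply: (inseg_open hn hn1 an); rewrite -E.
  by rewrite -mn.
by split; case: ifP (H) => e {}H h; have := H _ _ h; rewrite ?e; apply; [right|left|left|right].
Qed.

Lemma end_left n r y : has_idx A n -> pt A n = r%:E -> qb A (evenz n) y r -> y = r.
Proof.
rewrite /qb => hn nr; case: ifP => e; first exact: sink_min hn nr e.
by apply: source_max hn nr _; rewrite e.
Qed.

Lemma end_right n r y : has_idx A (n + 1) -> pt A (n + 1) = r%:E ->
  qb A (evenz n) r y -> y = r.
Proof.
rewrite /qb => hn nr; case: ifP => e; last by apply: sink_min hn nr _; rewrite evenzS e.
by apply: source_max hn nr _; rewrite evenzS e.
Qed.

Lemma pt_succ_lt n : has_idx A n -> has_idx A (n + 1) -> (pt A n < pt A (n + 1))%E.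
Proof. by move=> hn hn1; rewrite pt_lt ?ltrDl. Qed.

Lemma seg_nonempty n : has_idx A n -> has_idx A (n + 1) ->
  exists x, (pt A n < x%:E < pt A (n + 1))%E.
Proof.
move=> hn hn1; have := pt_succ_lt hn hn1.
case: (pt A n) (pt A (n + 1)) => [r| |] [s| |] // h.
- by exists ((r + s) / 2); rewrite !lte_fin !midf_lt.
- by exists (r + 1); rewrite lte_fin ltrDl ltr01 ltry.
- by exists (s - 1); rewrite lte_fin ltrBlDr ltrDl ltr01 ltNyr.
- by exists 0; rewrite ltry ltNyr.
Qed.

Lemma cell_lt lo hi e : cell e lo hi -> (lo <= hi)%E /\ (-oo < hi)%E /\ (lo < +oo)%E.
Proof.
case=> [n a _ _ _|n hn hn1]; first by rewrite lexx ltNyr ltry.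
have h := pt_succ_lt hn hn1; split; first exact: ltW.
by rewrite (le_lt_trans _ h) ?leNye // (lt_le_trans h) ?leey.
Qed.

Lemma cell_inv e lo hi : cell e lo hi ->
  (exists n a, [/\ has_idx A n, has_idx A (n + 1),
     (pt A n < a%:E < pt A (n + 1))%E, e = evenz n & lo = a%:E /\ hi = a%:E]) \/
  (exists n, [/\ has_idx A n, has_idx A (n + 1), e = ~~ evenz n,
     lo = pt A n & hi = pt A (n + 1)]).
Proof. by case=> [n a hn hn1 an|n hn hn1]; [left; exists n, a | right; exists n]. Qed.

(** The last clause of [cellP] concerns the order just outside the cell. For a point this is still
    its own segment; for a segment it is the neighbouring one, of opposite direction. This is why
    [CellPt] and [CellSeg] carry opposite parities. *)
Lemma cellP_of_cell e lo hi : cell e lo hi ->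
  cellP A true e (dset lo hi) /\ cellP A false (~~ e) (dset lo hi).
Proof.
have conv l h b x y z : dset l h x -> dset l h z -> ltb b x y -> ltb b y z -> dset l h y.
  move=> /andP[lx xh] /andP[lz zh]; case: b => /= xy yz; apply/andP; split.
  - by rewrite (le_trans lx) // lee_fin ltW.
  - by rewrite (le_trans _ zh) // lee_fin ltW.
  - by rewrite (le_trans lz) // lee_fin ltW.
  - by rewrite (le_trans _ xh) // lee_fin ltW.
case=> [n a hn hn1 an|n hn hn1].
  have [nea aen] := open_seg_qb a hn hn1 an.
  have /andP[na an'] := an.
  have an1 : (pt A n < a%:E <= pt A (n + 1))%E by rewrite na ltW.
  have an2 : (pt A n <= a%:E < pt A (n + 1))%E by rewrite an' ltW.
  have aD : dset a%:E a%:E a by rewrite /dset /= lexx.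
  have Da x : dset a%:E a%:E x -> x = a.
    by move=> /andP[ax xa]; apply/le_anti; rewrite -!lee_fin ax xa.
  have sa : inseg A n a by split=> //; rewrite !ltW.
  split; split.
  - by exists a.
  - exact: conv.
  - move=> d y /Da -> /(open_seg_qb y hn hn1 an).1 ya nb.
    suff -> : y = a by [].
    apply/le_anti; rewrite ya /= leNgt; apply/negP => h; apply: nb => d' /Da ->.
    exact: h.
  - by move=> x d /Da -> /Da -> /ltb_irr.
  - move=> x /(_ a aD) xa.
    have [x' [xx' x'a x'n]] := seg_left hn hn1 an1 xa.
    exists x', a; split=> //.
    + by move: xx'; rewrite le_eqVlt => /predU1P[->|]; [left | right].
    + by move=> d /Da ->.
    + by move=> d /Da ->; left.
    + by apply: seg_qb => //; exact: ltW.
  - by exists a.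
  - exact: conv.
  - move=> d y /Da ->; rewrite qbN => /(open_seg_qb y hn hn1 an).2 ya nb.
    suff -> : y = a by [].
    apply/le_anti; rewrite ya andbT leNgt; apply/negP => h; apply: nb => d' /Da ->.
    exact: h.
  - by move=> x d /Da -> /Da -> /ltb_irr.
  - move=> x /(_ a aD) xa.
    have [x' [xx' x'a x'n]] := seg_right hn hn1 an2 xa.
    exists x', a; split=> //.
    + by move: x'a; rewrite le_eqVlt => /predU1P[->|]; [left | right].
    + by move=> d /Da ->.
    + by move=> d /Da ->; left.
    + by rewrite qbN; apply: seg_qb => //; exact: ltW.
have [d0 /andP[nd0 d0n]] := seg_nonempty hn hn1.
have Dd0 : dset (pt A n) (pt A (n + 1)) d0 by apply/andP; rewrite !ltW.
have Din x : dset (pt A n) (pt A (n + 1)) x -> inseg A n x by split.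
split; split.
- by exists d0.
- exact: conv.
- move=> d y Dd; rewrite qbN => dy nb; apply/andP; split; rewrite leNgt; apply/negP => h.
    by apply: nb => d' /andP[nd' _] /=; rewrite -lte_fin; exact: lt_le_trans h nd'.
  have /andP[_ dn] := Dd.
  have [r [rE /andP[dr ry]]] := ereal_between dn (ltW h).
  have ry' : qb A (evenz n) r y.
    have [dr'|dr'] := eqVneq d r; first by rewrite -dr'.
    have [ry''|ry''] := eqVneq r y; first by rewrite ry''; exact: qb_refl.
    by apply: (@qb_mid _ _ _ true d y r dy _ _).2; rewrite /= lt_neqAle ?dr' ?ry''.
  by move: h; rewrite rE (end_right hn1 rE ry') ltxx.
- by move=> x d /Din xn /Din dn /ltW xd; rewrite qbN; exact: seg_qb.
- move=> x bx; have [r nr] : exists r, pt A n = r%:E.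
    case E: (pt A n) => [r| |]; first by exists r.
      by move: nd0; rewrite E.
    have xD : dset (pt A n) (pt A (n + 1)) x.
      apply/andP; rewrite E leNye; split=> //; apply: le_trans (ltW d0n).
      by rewrite lee_fin; exact/ltW/(bx d0 Dd0).
    by have := bx x xD => /ltb_irr.
  have hn' : has_idx A (n - 1) by apply: idx_pred; rewrite // nr ltNyr.
  have rD : dset (pt A n) (pt A (n + 1)) r.
    by apply/andP; rewrite nr lexx -nr ltW ?pt_succ_lt.
  have hn1' : has_idx A (n - 1 + 1) by rewrite subrK.
  have [||x' [xx' x'r x'n]] := @seg_left (n - 1) r x hn' hn1'.
  + by rewrite subrK nr lexx andbT -nr pt_lt // gtrBl.
  + exact: bx.
  exists x', r; split=> //.
  + by move: xx'; rewrite le_eqVlt => /predU1P[->|]; [left | right].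
  + move=> d /andP[nd _]; apply: lt_le_trans x'r _.
    by rewrite -lee_fin -nr.
  + move=> d /andP[nd _]; move: nd; rewrite nr lee_fin le_eqVlt => /predU1P[->|]; first by left.
    by right.
  + have -> : ~~ evenz n = evenz (n - 1) by rewrite -[n in LHS](subrK 1) evenzS negbK.
    apply: seg_qb => //; last exact: ltW.
    by split=> //; rewrite subrK nr lexx andbT -nr pt_le // gerBl.
- by exists d0.
- exact: conv.
- rewrite negbK => d y Dd dy nb; apply/andP; split; rewrite leNgt; apply/negP => h; last first.
    by apply: nb => d' /andP[_ nd'] /=; rewrite -lte_fin; exact: le_lt_trans nd' h.
  have /andP[dn _] := Dd.
  have [r [rE /andP[yr rd]]] := ereal_between (ltW h) dn.
  have ry' : qb A (evenz n) y r.
    have [dr'|dr'] := eqVneq r d; first by rewrite dr'.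
    have [ry''|ry''] := eqVneq y r; first by rewrite ry''; exact: qb_refl.
    by apply: (@qb_mid _ _ _ true y d r dy _ _).1; rewrite /= lt_neqAle ?dr' ?ry''.
  by move: h; rewrite rE (end_left hn rE ry') ltxx.
- by rewrite negbK => x d /Din xn /Din dn /ltW xd; exact: seg_qb.
- rewrite negbK => x bx; have [r nr] : exists r, pt A (n + 1) = r%:E.
    case E: (pt A (n + 1)) => [r| |]; first by exists r.
      have xD : dset (pt A n) (pt A (n + 1)) x.
        apply/andP; rewrite E leey; split=> //; apply: le_trans (ltW nd0) _.
        by rewrite lee_fin; exact/ltW/(bx d0 Dd0).
      by have := bx x xD => /ltb_irr.
    by move: d0n; rewrite E.
  have hn2 : has_idx A (n + 1 + 1) by apply: idx_succ; rewrite // nr ltry.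
  have rD : dset (pt A n) (pt A (n + 1)) r.
    by apply/andP; rewrite nr lexx -nr ltW ?pt_succ_lt.
  have [||x' [xx' x'r x'n]] := @seg_right (n + 1) r x hn1 hn2.
  + by rewrite -nr lexx pt_succ_lt.
  + exact: bx.
  exists x', r; split=> //.
  + by move: x'r; rewrite le_eqVlt => /predU1P[->|]; [left | right].
  + move=> d /andP[_ nd]; apply: le_lt_trans xx'.
    by rewrite -lee_fin -nr.
  + move=> d /andP[_ nd]; move: nd; rewrite nr lee_fin le_eqVlt => /predU1P[->|]; first by left.
    by right.
  + have -> : evenz n = ~~ evenz (n + 1) by rewrite evenzS negbK.
    rewrite qbN; apply: seg_qb => //; last exact: ltW.
    by split=> //; rewrite -nr lexx ltW ?pt_succ_lt.
Qed.

(** Right after the cell the order is monotone: on the rest of the segment for a point, on the next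
    segment for a segment. *)
Lemma chain_right e lo hi x0 : cell e lo hi -> (hi < x0%:E)%E ->
  exists x1, [/\ (hi < x1%:E)%E, x1 <= x0 &
    forall x y, (hi < x%:E)%E -> x < y -> y <= x1 -> qb A e x y].
Proof.
case=> [n a hn hn1 /andP[na an]|n hn hn1] hx.
  have [||x1 [ax1 x10 x1n]] := @seg_right n a x0 hn hn1.
  - by rewrite ltW.
  - by rewrite -lte_fin.
  exists x1; split=> //.
  move=> x y ax xy yx1; have [_ _ /andP[_ x1n']] := x1n.
  apply: seg_qb; last exact: ltW.
    split=> //; rewrite (le_trans (ltW na)) ?(le_trans _ x1n') ?lee_fin -?lee_fin ?(ltW ax) //.
    by rewrite lee_fin; apply: le_trans yx1; exact: ltW.
  split=> //; rewrite (le_trans (ltW na)) ?(le_trans _ x1n') ?lee_fin //.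
  by apply: ltW; apply: lt_trans xy; rewrite -lte_fin.
have [r nr] : exists r, pt A (n + 1) = r%:E.
  have := pt_succ_lt hn hn1; case: (pt A (n + 1)) hx => [r| |] //; first by exists r.
  by move=> _; case: (pt A n).
have hn2 : has_idx A (n + 1 + 1) by apply: idx_succ; rewrite // nr ltry.
have [||x1 [ax1 x10 x1n]] := @seg_right (n + 1) r x0 hn1 hn2.
- by rewrite -nr lexx pt_succ_lt.
- by rewrite -lte_fin -nr.
exists x1; split=> //; first by rewrite nr lte_fin.
move=> x y ax xy yx1; have [_ _ /andP[_ x1n']] := x1n.
rewrite -evenzS; apply: seg_qb; last exact: ltW.
  split=> //; rewrite (ltW ax) (le_trans _ x1n') // lee_fin.
  by apply: le_trans yx1; exact: ltW.
split=> //; rewrite (le_trans (ltW ax)) ?(le_trans _ x1n') ?lee_fin //.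
exact: ltW.
Qed.

Lemma chain_left e lo hi x0 : cell e lo hi -> (x0%:E < lo)%E ->
  exists x1, [/\ (x1%:E < lo)%E, x0 <= x1 &
    forall x y, (x%:E < lo)%E -> y < x -> x1 <= y -> qb A (~~ e) x y].
Proof.
case=> [n a hn hn1 /andP[na an]|n hn hn1] hx.
  have [||x1 [ax1 x10 x1n]] := @seg_left n a x0 hn hn1.
  - by rewrite na ltW.
  - by rewrite -lte_fin.
  exists x1; split=> //.
  move=> x y ax xy yx1; have [_ _ /andP[x1n' _]] := x1n.
  rewrite qbN; apply: seg_qb; last exact: ltW.
    split=> //; rewrite (le_trans x1n') ?lee_fin //= (le_trans _ (ltW an)) // lee_fin.
    by apply: ltW; apply: lt_trans xy _; rewrite -lte_fin.
  split=> //; rewrite (le_trans x1n') ?lee_fin /= ?(le_trans (ltW ax) (ltW an)) //.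
  by apply: le_trans yx1 _; exact: ltW.
have [r nr] : exists r, pt A n = r%:E.
  have := pt_succ_lt hn hn1; case: (pt A n) hx => [r| |] //; first by exists r.
  by move=> _; case: (pt A (n + 1)).
have hn' : has_idx A (n - 1) by apply: idx_pred; rewrite // nr ltNyr.
have hn1' : has_idx A (n - 1 + 1) by rewrite subrK.
have [||x1 [ax1 x10 x1n]] := @seg_left (n - 1) r x0 hn' hn1'.
- by rewrite subrK nr lexx andbT -nr pt_lt // gtrBl.
- by rewrite -lte_fin -nr.
exists x1; split=> //; first by rewrite nr lte_fin.
move=> x y ax xy yx1; have [_ _ /andP[x1n' _]] := x1n.
have -> : ~~ ~~ evenz n = ~~ evenz (n - 1) by rewrite -[n in LHS](subrK 1) evenzS negbK.
rewrite qbN; apply: seg_qb; last exact: ltW.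
  split=> //; rewrite subrK (le_trans x1n') ?lee_fin //= (le_trans _ (ltW ax)) //.
  by rewrite lee_fin ltW.
split=> //; rewrite subrK (le_trans x1n') ?(ltW ax) // lee_fin.
by apply: le_trans yx1 _; exact: ltW.
Qed.

(** An end off S gives a point cell; at s_q a closed bracket points to the segment starting there
    and an open one to the segment ending there. At -oo, finite support makes s_m = -oo, and the
    first segment is the cell, with its bracket read as closed. *)
Lemma cell_left_end (I : interval R) : Defs.nonempty I -> fin_supp A [set` I] ->
  exists c e lo hi, cell e lo hi /\ I = Interval (lend c lo hi) I.2.
Proof.
case: I => i j [x0 x0I] [m [n [hm hn Imn]]].
have real c r : exists c' e lo hi, cell e lo hi /\ BSide c r = lend c' lo hi.
  have [Sr|nS] := pselect (cA_S A r).
    have [q hq qr] := S_pt Sr; case: c.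
      exists true, (~~ evenz q), (pt A q), (pt A (q + 1)); rewrite /lend qr /=; split=> //.
      by rewrite -qr; apply: CellSeg => //; apply: idx_succ; rewrite // qr ltry.
    have hq1 : has_idx A (q - 1) by apply: idx_pred; rewrite // qr ltNyr.
    exists false, (~~ evenz (q - 1)), (pt A (q - 1)), (pt A (q - 1 + 1)).
    by split; [apply: CellSeg; rewrite ?subrK | rewrite subrK qr].
  have [q [[hq hq1 /andP[qr rq]] rq']] := seg_exists A r.
  exists c, (evenz q), r%:E, r%:E; split; last by case: c.
  apply: CellPt => //; rewrite rq' andbT lt_neqAle qr andbT; apply/eqP => E.
  by apply: nS; apply: pt_S E.
move: x0I; rewrite itv_boundlr; case: i Imn => [c r|[]] Imn /andP[ix xj] //=.
  have [c' [e [lo [hi [h E]]]]] := real c r.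
  by exists c', e, lo, hi; rewrite -E.
have mE : pt A m = -oo%E.
  have mem x : x <= x0 -> x \in Interval -oo%O j.
    by move=> xx0; rewrite itv_boundlr /= (le_trans _ xj).
  case E: (pt A m) => [r| |] //.
    have := Imn (Num.min x0 (r - 1)) (mem _ _); rewrite ge_min lexx => /(_ isT).
    by rewrite E lee_fin le_min => /andP[/andP[_]]; rewrite leNgt ltrBlDr ltrDl ltr01.
  by have := Imn x0 (mem _ (lexx _)); rewrite E leye_eq.
have hm1 : has_idx A (m + 1) by apply: idx_succ; rewrite // mE.
exists true, (~~ evenz m), (pt A m), (pt A (m + 1)); split; first exact: CellSeg.
by rewrite /lend mE.
Qed.

Lemma cell_right_end (I : interval R) : Defs.nonempty I -> fin_supp A [set` I] ->
  exists c e lo hi, cell e lo hi /\ I = Interval I.1 (rend c lo hi).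
Proof.
case: I => i j [x0 x0I] [m [n [hm hn Imn]]].
have real c r : exists c' e lo hi, cell e lo hi /\ BSide c r = rend c' lo hi.
  have [Sr|nS] := pselect (cA_S A r).
    have [q hq qr] := S_pt Sr; case: c.
      exists false, (~~ evenz q), (pt A q), (pt A (q + 1)); rewrite /rend qr /=; split=> //.
      by rewrite -qr; apply: CellSeg => //; apply: idx_succ; rewrite // qr ltry.
    have hq1 : has_idx A (q - 1) by apply: idx_pred; rewrite // qr ltNyr.
    exists true, (~~ evenz (q - 1)), (pt A (q - 1)), (pt A (q - 1 + 1)).
    by split; [apply: CellSeg; rewrite ?subrK | rewrite /rend subrK qr].
  have [q [[hq hq1 /andP[qr rq]] rq']] := seg_exists A r.
  exists (~~ c), (evenz q), r%:E, r%:E; split; last by case: c.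
  apply: CellPt => //; rewrite rq' andbT lt_neqAle qr andbT; apply/eqP => E.
  by apply: nS; apply: pt_S E.
move: x0I; rewrite itv_boundlr; case: j Imn => [c r|[]] Imn /andP[ix xj] //=.
  have [c' [e [lo [hi [h E]]]]] := real c r.
  by exists c', e, lo, hi; rewrite -E.
have nE : pt A n = +oo%E.
  have mem x : x0 <= x -> x \in Interval i +oo%O.
    by move=> xx0; rewrite itv_boundlr /= (le_trans ix).
  case E: (pt A n) => [r| |] //.
    have := Imn (Num.max x0 (r + 1)) (mem _ _); rewrite le_max lexx => /(_ isT).
    by rewrite E lee_fin ge_max => /andP[_ /andP[_]]; rewrite leNgt ltrDl ltr01.
  by have := Imn x0 (mem _ (lexx _)); rewrite E leeNy_eq andbF.
have hm1 : has_idx A (n - 1) by apply: idx_pred; rewrite // nE.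
exists true, (~~ evenz (n - 1)), (pt A (n - 1)), (pt A (n - 1 + 1)); split.
  by apply: CellSeg; rewrite ?subrK.
by rewrite /rend subrK nE.
Qed.

End ConcreteCells.

(** * Squares of cells and the 16 types *)

Section CellSquares.
Variables (k : fieldType) (R : realType) (A : contA R).
Implicit Types (x y z a r : R) (n m : int) (lo hi : \bar R) (e c : bool)
  (I K U E W : interval R).

Lemma mem_lend c lo hi (j : itv_bound R) x :
  (x \in Interval (lend c lo hi) j) =
  (if c then (lo <= x%:E)%E else (hi < x%:E)%E) && (BRight x <= j)%O.
Proof. by rewrite itv_boundlr lendE. Qed.

Lemma mem_rend c lo hi (i : itv_bound R) x :
  (x \in Interval i (rend c lo hi)) =
  (i <= BLeft x)%O && (if c then (x%:E <= hi)%E else (x%:E < lo)%E).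
Proof. by rewrite itv_boundlr rendE. Qed.

Lemma mem_cells c lo hi c2 lo2 hi2 x :
  (x \in Interval (lend c lo hi) (rend c2 lo2 hi2)) =
  (if c then (lo <= x%:E)%E else (hi < x%:E)%E) &&
  (if c2 then (x%:E <= hi2)%E else (x%:E < lo2)%E).
Proof. by rewrite mem_lend rendE. Qed.

Lemma left_move e lo hi (j : itv_bound R) : cell A e lo hi ->
  (forall x, dset lo hi x -> (BRight x <= j)%O) ->
  end_move A true true (dset lo hi) (Interval (lend e lo hi) j)
    (Interval (lend (~~ e) lo hi) j).
Proof.
move=> hc Dj; have [cP _] := cellP_of_cell hc; have [lohi _] := cell_lt hc.
have mE x : x \in Interval (lend true lo hi) j <->
    dset lo hi x \/ x \in Interval (lend false lo hi) j.
  rewrite !mem_lend; split=> [/andP[lx xj]|[Dx|/andP[hx xj]]].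
  - by case: (leP x%:E hi) => xh; [left; apply/andP | right; rewrite xj].
  - by rewrite Dj // andbT; case/andP: Dx.
  - by rewrite xj andbT (le_trans lohi) ?ltW.
have bE x : x \in Interval (lend false lo hi) j -> beyond (~~ true) (dset lo hi) x.
  rewrite mem_lend => /andP[hx _] d /andP[_ dh] /=.
  by rewrite -lte_fin; exact: le_lt_trans dh hx.
by case: e hc cP => hc cP; [left | right].
Qed.

Lemma right_move e lo hi (i : itv_bound R) : cell A e lo hi ->
  (forall x, dset lo hi x -> (i <= BLeft x)%O) ->
  end_move A false true (dset lo hi) (Interval i (rend (~~ e) lo hi))
    (Interval i (rend e lo hi)).
Proof.
move=> hc Di; have [_ cP] := cellP_of_cell hc; have [lohi _] := cell_lt hc.
have mE x : x \in Interval i (rend true lo hi) <->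
    dset lo hi x \/ x \in Interval i (rend false lo hi).
  rewrite !mem_rend; split=> [/andP[ix xh]|[Dx|/andP[ix hx]]].
  - by case: (leP lo x%:E) => lx; [left; apply/andP | right; rewrite ix].
  - by rewrite Di //; case/andP: Dx.
  - by rewrite ix (le_trans _ lohi) ?ltW.
have bE x : x \in Interval i (rend false lo hi) -> beyond (~~ false) (dset lo hi) x.
  rewrite mem_rend => /andP[_ hx] d /andP[dh _] /=.
  by rewrite -lte_fin; exact: lt_le_trans hx dh.
by case: e hc cP => hc cP; [right | left].
Qed.

Lemma cell_idx e lo hi : cell A e lo hi -> exists m,
  [/\ has_idx A m, has_idx A (m + 1), (pt A m <= lo)%E & (hi <= pt A (m + 1))%E].
Proof.
case=> [n a hn hn1 /andP[na an]|n hn hn1]; last by exists n.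
by exists n; rewrite !ltW.
Qed.

Lemma fin_supp_cells c e lo hi c2 e2 lo2 hi2 : cell A e lo hi -> cell A e2 lo2 hi2 ->
  fin_supp A [set` Interval (lend c lo hi) (rend c2 lo2 hi2)].
Proof.
move=> hc hc2; have [lohi _] := cell_lt hc; have [lohi2 _] := cell_lt hc2.
have [m [hm _ mlo _]] := cell_idx hc; have [n [_ hn _ hin]] := cell_idx hc2.
exists m, (n + 1); split=> // x; rewrite /= mem_cells => /andP[lx xr].
apply/andP; split.
  by case: c lx => lx; rewrite (le_trans mlo) // (le_trans lohi) // ltW.
by case: c2 xr => xr; rewrite (le_trans _ hin) // (le_trans _ lohi2) // ltW.
Qed.

Lemma between_cells e lo hi e2 lo2 hi2 : cell A e lo hi -> cell A e2 lo2 hi2 ->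
  (hi < lo2)%E -> exists x, (hi < x%:E < lo2)%E.
Proof.
move=> /cell_lt[_ [+ _]] /cell_lt[_ [_ +]].
case: hi lo2 => [r| |] [s| |] //; rewrite lte_fin => _ _ rs.
by exists ((r + s) / 2); rewrite !lte_fin !midf_lt.
Qed.

Definition cell_square U E1 E2 W := exists e lo hi e2 lo2 hi2,
  [/\ cell A e lo hi, cell A e2 lo2 hi2, (hi < lo2)%E &
   [/\ U = Interval (lend e lo hi) (rend (~~ e2) lo2 hi2),
       E1 = Interval (lend e lo hi) (rend e2 lo2 hi2),
       E2 = Interval (lend (~~ e) lo hi) (rend (~~ e2) lo2 hi2) &
       W = Interval (lend (~~ e) lo hi) (rend e2 lo2 hi2)]].

Lemma cell_squareP U E1 E2 W : cell_square U E1 E2 W ->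
  [/\ exists D1 D2, square A D1 D2 U E1 E2 W,
      exists x, [/\ x \in U, x \in E1, x \in E2 & x \in W] &
      [/\ in_rep (M k A U), in_rep (M k A E1), in_rep (M k A E2) & in_rep (M k A W)]].
Proof.
move=> [e [lo [hi [e2 [lo2 [hi2 [hc hc2 hl [-> -> -> ->]]]]]]]].
have [lohi _] := cell_lt hc; have [lohi2 _] := cell_lt hc2.
have r1 c2 x : dset lo hi x -> (BRight x <= rend c2 lo2 hi2)%O.
  move=> /andP[_ xh]; rewrite rendE; case: c2; last exact: le_lt_trans hl.
  by rewrite (le_trans xh) // (le_trans (ltW hl)).
have l2 c x : dset lo2 hi2 x -> (lend c lo hi <= BLeft x)%O.
  move=> /andP[lx _]; rewrite lendE; case: c; last exact: lt_le_trans lx.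
  by rewrite (le_trans _ lx) // (le_trans lohi) // ltW.
split; last by split; apply: in_rep_fin; exact: fin_supp_cells hc hc2.
  exists (dset lo hi), (dset lo2 hi2); split.
  - by apply: left_move => // x; exact: r1.
  - by apply: left_move => // x; exact: r1.
  - by apply: right_move => // x; exact: l2.
  - by apply: right_move => // x; exact: l2.
  - move=> x /andP[_ xh] /andP[lx _]; have := le_lt_trans xh hl.
    by rewrite ltNge lx.
have [x /andP[hx xl]] := between_cells hc hc2 hl; exists x.
have H c c2 : x \in Interval (lend c lo hi) (rend c2 lo2 hi2).
  rewrite mem_cells; apply/andP; split.
    by case: c => //; rewrite (le_trans lohi) // ltW.
  by case: c2 => //; rewrite (le_trans _ lohi2) // ltW.
by split; exact: H.
Qed.

Lemma cell_square_AR U E1 E2 W : cell_square U E1 E2 W ->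
  AR_seq (itv_ses k A U E1 E2 W).
Proof.
move=> /cell_squareP[[D1 [D2 sq]] [x [xU _ _ xW]] [hU hE1 hE2 hW]].
by apply: (square_AR sq); rewrite //; exists x.
Qed.

Lemma sink_cell a : (sink_lt A a -> cell A true a%:E a%:E) /\
  (sink_gt A a -> cell A false a%:E a%:E).
Proof.
split=> -[t [n [hn hn1 an ->]]]; have /andP[na an'] := an; case: ifP => en ta.
- by rewrite -en; exact: CellPt.
- by move: ta; rewrite ltNge ltW.
- by move: ta; rewrite ltNge ltW.
- by rewrite -en; exact: CellPt.
Qed.

Lemma cell_sink n a : has_idx A n -> has_idx A (n + 1) ->
  (pt A n < a%:E < pt A (n + 1))%E ->
  ~ cA_S A a /\ if evenz n then sink_lt A a else sink_gt A a.
Proof.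
move=> hn hn1 an; have /andP[na an'] := an; split.
  move=> /S_pt[m hm ma]; move: na an'; rewrite -ma !pt_lt // => nm.
  by rewrite ltzD1 leNgt nm.
by case: ifP => en; [exists (pt A n) => // | exists (pt A (n + 1)) => //]; exists n; rewrite en.
Qed.

Lemma cell_seg_odd n : has_idx A (2 * n - 1) -> has_idx A (2 * n) ->
  cell A true (pt A (2 * n - 1)) (pt A (2 * n)).
Proof.
move=> h1 h2; have := @CellSeg R A (2 * n - 1); rewrite subrK.
have -> : ~~ evenz (2 * n - 1) = true.
  by rewrite -evenzS subrK evenz2.
by apply.
Qed.

Lemma cell_seg_even n : has_idx A (2 * n) -> has_idx A (2 * n + 1) ->
  cell A false (pt A (2 * n)) (pt A (2 * n + 1)).
Proof. by move=> h1 h2; have := CellSeg h1 h2; rewrite evenz2. Qed.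

Lemma cellP_inv e lo hi : cell A e lo hi ->
  (exists a, [/\ lo = a%:E, hi = a%:E, ~ cA_S A a & if e then sink_lt A a else sink_gt A a]) \/
  (exists n, if e then
     [/\ has_idx A (2 * n - 1), has_idx A (2 * n), lo = pt A (2 * n - 1) & hi = pt A (2 * n)]
   else
     [/\ has_idx A (2 * n), has_idx A (2 * n + 1), lo = pt A (2 * n) & hi = pt A (2 * n + 1)]).
Proof.
case=> [n a hn hn1 an|n hn hn1].
  by left; exists a; have [aS sa] := cell_sink hn hn1 an.
right; case en: (evenz n); first by have [m nE] := evenz_half en; exists m; rewrite -nE.
have [|m nE] := @evenz_half (n + 1); first by rewrite evenzS en.
by exists m; rewrite -nE addrK.
Qed.

(** Each of the two cells is a point or a segment, of either parity: four kinds on the left times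
    four on the right. *)
Lemma ARtype_cells U E1 E2 W : ARtype A U E1 E2 W <-> cell_square U E1 E2 W.
Proof.
split.
  have sq e lo hi e2 lo2 hi2 : cell A e lo hi -> cell A e2 lo2 hi2 -> (hi < lo2)%E ->
     cell_square (Interval (lend e lo hi) (rend (~~ e2) lo2 hi2))
       (Interval (lend e lo hi) (rend e2 lo2 hi2))
       (Interval (lend (~~ e) lo hi) (rend (~~ e2) lo2 hi2))
       (Interval (lend (~~ e) lo hi) (rend e2 lo2 hi2)).
    by move=> hc hc2 hl; exists e, lo, hi, e2, lo2, hi2; split.
  have s1 a := (sink_cell a).1; have s2 a := (sink_cell a).2.
  case.
  - by move=> a b ab _ _ /s1 sa /s1 sb; apply: sq sa sb _; rewrite lte_fin.
  - by move=> a b ab _ _ /s1 sa /s2 sb; apply: sq sa sb _; rewrite lte_fin.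
  - by move=> a b ab _ _ /s2 sa /s1 sb; apply: sq sa sb _; rewrite lte_fin.
  - by move=> a b ab _ _ /s2 sa /s2 sb; apply: sq sa sb _; rewrite lte_fin.
  - by move=> n b h1 h2 nb _ /s1 sb; apply: sq (cell_seg_odd h1 h2) sb nb.
  - by move=> n b h1 h2 nb _ /s2 sb; apply: sq (cell_seg_odd h1 h2) sb nb.
  - by move=> n b h1 h2 nb _ /s1 sb; apply: sq (cell_seg_even h1 h2) sb nb.
  - by move=> n b h1 h2 nb _ /s2 sb; apply: sq (cell_seg_even h1 h2) sb nb.
  - by move=> a n h1 h2 an _ /s1 sa; apply: sq sa (cell_seg_even h1 h2) an.
  - by move=> a n h1 h2 an _ /s2 sa; apply: sq sa (cell_seg_even h1 h2) an.
  - by move=> a n h1 h2 an _ /s1 sa; apply: sq sa (cell_seg_odd h1 h2) an.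
  - by move=> a n h1 h2 an _ /s2 sa; apply: sq sa (cell_seg_odd h1 h2) an.
  - by move=> m n h1 h2 h3 h4 mn; apply: sq (cell_seg_even h1 h2) (cell_seg_even h3 h4) mn.
  - by move=> m n h1 h2 h3 h4 mn; apply: sq (cell_seg_odd h1 h2) (cell_seg_even h3 h4) mn.
  - by move=> m n h1 h2 h3 h4 mn; apply: sq (cell_seg_even h1 h2) (cell_seg_odd h3 h4) mn.
  - by move=> m n h1 h2 h3 h4 mn; apply: sq (cell_seg_odd h1 h2) (cell_seg_odd h3 h4) mn.
move=> [e [lo [hi [e2 [lo2 [hi2 [hc hc2 hl [-> -> -> ->]]]]]]]].
case: (cellP_inv hc) (cellP_inv hc2) hl => [[a [-> -> aS sa]]|[n +]]
  [[b [-> -> bS sb]]|[m +]].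
- rewrite lte_fin => ab; case: e e2 sa sb {hc hc2} => -[] sa sb.
  + exact: ART1. + exact: ART2. + exact: ART3. + exact: ART4.
- case: e e2 sa {hc hc2} => -[] sa [h1 h2 -> ->] am.
  + exact: ART11. + exact: ART9. + exact: ART12. + exact: ART10.
- case: e e2 sb {hc hc2} => -[] sb [h1 h2 -> ->] am.
  + exact: ART5. + exact: ART6. + exact: ART7. + exact: ART8.
- case: e e2 {hc hc2} => -[] [h1 h2 -> ->] [h3 h4 -> ->] nm.
  + exact: ART16. + exact: ART14. + exact: ART15. + exact: ART13.
Qed.

(** With the opposite kind of left end, either K is open there and the order descends towards the
    end, so that K can be truncated; or K starts at a real point lo with larger points directly to
    its left, so that K can be enlarged by a few of them. *)
Lemma start_left e lo hi (j : itv_bound R) (V : rep k A)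
    (K := Interval (lend (~~ e) lo hi) j) (f : fam (M k A K) V) :
  cell A e lo hi -> Defs.nonempty K -> in_rep (M k A K) -> in_rep V ->
  is_mor f -> left_almost f -> is_section f.
Proof.
move=> hc [p pK] K_rep V_rep fm fl; have [lohi [hioo looo]] := cell_lt hc.
have pj : (BRight p <= j)%O by move: pK; rewrite mem_lend => /andP[].
have memK x : x <= p -> (x \in K) = (if ~~ e then (lo <= x%:E)%E else (hi < x%:E)%E).
  by move=> xp; rewrite mem_lend (le_trans _ pj) ?andbT.
have pl := memK p (lexx _); rewrite pK in pl.
case: e hc @K f K_rep pK fm fl memK pl => hc K f K_rep pK fm fl memK /= pl.
  have [x1 [hx1 x1p H]] := chain_right hc (esym pl).
  apply: (@left_almost_shrink k R A true K x1 V f) => //.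
  - by rewrite memK.
  - move=> x xK; have hx : (hi < x%:E)%E by move: xK; rewrite mem_lend => /andP[].
    have [r hr] : exists r, hi = r%:E.
      by case: hi hioo hx {hc K f K_rep fm fl memK pK pl lohi hx1 H xK} => [r| |] //; exists r.
    exists ((r + x) / 2); last by rewrite /= midf_lt // -lte_fin -hr.
    have rx : (r + x) / 2 < x by rewrite midf_lt // -lte_fin -hr.
    rewrite mem_lend hr lte_fin midf_lt -?lte_fin -?hr //=.
    move: xK; rewrite mem_lend => /andP[_]; apply: le_trans.
    by rewrite bnd_simp ltW.
  - move=> x y xK yK xy yx1; apply: H => //.
      by move: xK; rewrite mem_lend => /andP[].
    by case: yx1 => [->|/ltW].
have [[r lr]|loN] : (exists r, lo = r%:E) \/ lo = -oo%E.
  by case: lo looo {hc K f K_rep fm fl memK pK pl lohi} => [r| |] //; [left; exists r | right].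
  have rp : r <= p by rewrite -lee_fin -lr.
  have rK : r \in K by rewrite memK // lr lexx.
  have [[_ _ _ _ P3] _] := cellP_of_cell hc.
  have [|x' [lo' [_ bx' Dlo' lomin x'lo]]] := P3 (r - 1).
    by move=> d /andP[ld _] /=; rewrite (lt_le_trans (_ : _ < r)) ?gtrBl // -lee_fin -lr.
  have rD : dset lo hi r by apply/andP; rewrite lr lexx -lr.
  have lo'r : lo' = r.
    case: (lomin r rD) => // h; case/andP: Dlo'; rewrite lr lee_fin.
    by rewrite leNgt (h : lo' < r).
  rewrite lo'r in x'lo bx' *; apply: (@left_almost_enlarge k R A true K r x' V f) => //.
    move=> x; rewrite mem_lend lr lee_fin => /andP[rx _].
    by move: rx; rewrite le_eqVlt => /predU1P[->|]; [left | right].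
  exact: bx'.
(* An end at -oo is open although [c] is true, so this case is a truncation too; n is even because
   of the parity in [CellSeg]. *)
have [n [hn hn1 nE en]] : exists n, [/\ has_idx A n, has_idx A (n + 1),
    pt A n = -oo%E & evenz n].
  case: (cell_inv hc) => [[n [a [_ _ _ _ [la _]]]]|[n [hn hn1 en nE _]]].
    by rewrite la in loN.
  by exists n; split=> //; [rewrite -nE | case: (evenz n) en].
have [x1 x1p x1n] : exists2 x1, x1 <= p & inseg A n x1.
  case E: (pt A (n + 1)) => [r| |].
  - exists (Num.min p r); first by rewrite ge_min lexx.
    by split=> //; rewrite nE leNye E lee_fin ge_min lexx orbT.
  - by exists p; rewrite // /inseg nE E leNye leey; split.
  - by have := pt_succ_lt hn hn1; rewrite nE E.
apply: (@left_almost_shrink k R A true K x1 V f) => //.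
- by rewrite memK // loN leNye.
- move=> x xK; exists (x - 1); last by rewrite /= gtrBl.
  rewrite mem_lend loN leNye /=; move: xK; rewrite mem_lend => /andP[_].
  by apply: le_trans; rewrite bnd_simp gerBl.
- move=> x y xK yK /= xy yx1.
  have yx1' : y <= x1 by case: yx1 => [->|/ltW].
  have [_ _ /andP[_ x1n']] := x1n.
  have ins z : z <= x1 -> inseg A n z.
    by move=> zx1; split=> //; rewrite nE leNye (le_trans _ x1n') // lee_fin.
  have := seg_qb (ins x (le_trans (ltW xy) yx1')) (ins y yx1') (ltW xy).
  by rewrite en.
Qed.

End CellSquares.

(** * Right ends of the wrong kind; ideals and filters *)

Section Ideals.
Variables (k : fieldType) (R : realType) (A : contA R).
Implicit Types (x y z a r w : R) (n m : int) (lo hi : \bar R) (e c b : bool)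
  (I J K U E W : interval R).

(** Seen from the right the order has the opposite direction, so here the end of the wrong kind
    carries [e] itself. *)
Lemma start_right e lo hi (i : itv_bound R) (V : rep k A)
    (K := Interval i (rend e lo hi)) (f : fam (M k A K) V) :
  cell A e lo hi -> Defs.nonempty K -> in_rep (M k A K) -> in_rep V ->
  is_mor f -> left_almost f -> is_section f.
Proof.
move=> hc [p pK] K_rep V_rep fm fl; have [lohi [hioo looo]] := cell_lt hc.
have pj : (i <= BLeft p)%O by move: pK; rewrite mem_rend => /andP[].
have memK x : p <= x -> (x \in K) = (if e then (x%:E <= hi)%E else (x%:E < lo)%E).
  by move=> xp; rewrite mem_rend (le_trans pj) ?bnd_simp.
have pl := memK p (lexx _); rewrite pK in pl.
case: e hc @K f K_rep pK fm fl memK pl => hc K f K_rep pK fm fl memK /= pl; last first.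
  have [x1 [hx1 x1p H]] := chain_left hc (esym pl).
  apply: (@left_almost_shrink k R A false K x1 V f) => //.
  - by rewrite memK.
  - move=> x xK; have hx : (x%:E < lo)%E by move: xK; rewrite mem_rend => /andP[].
    have [r hr] : exists r, lo = r%:E.
      by case: lo looo hx {hc K f K_rep fm fl memK pK pl lohi hx1 H xK} => [r| |] //; exists r.
    exists ((x + r) / 2); last by rewrite /= midf_lt // -lte_fin -hr.
    have rx : x < (x + r) / 2 by rewrite midf_lt // -lte_fin -hr.
    rewrite mem_rend hr lte_fin midf_lt -?lte_fin -?hr // andbT.
    move: xK; rewrite mem_rend => /andP[+ _] => /le_trans; apply.
    by rewrite bnd_simp ltW.
  - move=> x y xK yK /= xy yx1; apply: H => //.
      by move: xK; rewrite mem_rend => /andP[].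
    by case: yx1 => [->|/ltW].
have [[r lr]|loN] : (exists r, hi = r%:E) \/ hi = +oo%E.
  by case: hi hioo {hc K f K_rep fm fl memK pK pl lohi} => [r| |] //; [left; exists r | right].
  have rp : p <= r by rewrite -lee_fin -lr.
  have rK : r \in K by rewrite memK // lr lexx.
  have [_ [_ _ _ _ P3]] := cellP_of_cell hc.
  have [|x' [lo' [_ bx' Dlo' lomin x'lo]]] := P3 (r + 1).
    by move=> d /andP[_ ld] /=; rewrite (le_lt_trans (_ : _ <= r)) ?ltrDl // -lee_fin -lr.
  have rD : dset lo hi r by apply/andP; rewrite lr lexx -lr.
  have lo'r : lo' = r.
    case: (lomin r rD) => // h; case/andP: Dlo' => _; rewrite lr lee_fin.
    by rewrite leNgt (h : r < lo').
  rewrite lo'r in x'lo bx' *; apply: (@left_almost_enlarge k R A false K r x' V f) => //.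
    move=> x; rewrite mem_rend lr lee_fin => /andP[_ rx].
    by move: rx; rewrite le_eqVlt => /predU1P[->|]; [left | right].
  exact: bx'.
have [n [hn hn1 nE en]] : exists n, [/\ has_idx A n, has_idx A (n + 1),
    pt A (n + 1) = +oo%E & ~~ evenz n].
  case: (cell_inv hc) => [[n [a [_ _ _ _ [_ ha]]]]|[n [hn hn1 en _ nE]]].
    by rewrite ha in loN.
  by exists n; split=> //; rewrite -nE.
have [x1 x1p x1n] : exists2 x1, p <= x1 & inseg A n x1.
  case E: (pt A n) => [r| |].
  - exists (Num.max p r); first by rewrite le_max lexx.
    by split=> //; rewrite nE leey E lee_fin le_max lexx orbT.
  - by have := pt_succ_lt hn hn1; rewrite nE E.
  - by exists p; rewrite // /inseg nE E leNye leey; split.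
apply: (@left_almost_shrink k R A false K x1 V f) => //.
- by rewrite memK // loN leey.
- move=> x xK; exists (x + 1); last by rewrite /= ltrDl.
  rewrite mem_rend loN leey andbT; move: xK; rewrite mem_rend => /andP[+ _] => /le_trans.
  by apply; rewrite bnd_simp lerDl.
- move=> x y xK yK /= xy yx1.
  have yx1' : x1 <= y by case: yx1 => [->|/ltW].
  have [_ _ /andP[x1n' _]] := x1n.
  have ins z : x1 <= z -> inseg A n z.
    by move=> zx1; split=> //; rewrite nE leey andbT (le_trans x1n') // lee_fin.
  have := seg_qb (ins y yx1') (ins x (le_trans yx1' (ltW xy))) (ltW xy).
  by rewrite (negPf en).
Qed.

Lemma bij_of_comp (X : rep k A) x y z : qle A y x -> qle A z y ->
  bijective (rmap X x y) -> bijective (rmap X x z) -> bijective (rmap X y z).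
Proof.
move=> yx zy xy xz; have [xyK yxK] := lfun_bij_inv xy.
apply: (eq_bij (bij_comp xz (Bijective yxK xyK))) => v /=.
by rewrite -(rmapC _ yx zy) yxK.
Qed.

(** An upward directed order ideal for [b] true, a downward directed filter for [b] false. *)
Definition poset_ideal b K := (forall x y, x \in K -> qb A b y x -> y \in K) /\
  (forall x y, x \in K -> y \in K -> exists2 z, z \in K & qb A b x z /\ qb A b y z).

(** A morphism from X to M_K is a functional on the colimit of X over the filter K, and this colimit
    is X z for z far enough down. So the extension problem is that of a functional along the
    injection X z -> Y z. *)
Lemma ideal_injective K : in_rep (M k A K) -> Defs.nonempty K ->
  poset_ideal false K -> rep_injective (M k A K).
Proof.
move=> K_rep [p0 p0K] [Kup Kdir]; split=> // X Y X_rep Y_rep i f im imono fm.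
have C0 : [set` K] !=set0 by exists p0.
have [z1 z1K z1b] := tame_down X_rep C0 Kdir.
have [z2 z2K z2b] := tame_down Y_rep C0 Kdir.
have [z zK [zz1 zz2]] : exists2 z, z \in K & qle A z z1 /\ qle A z z2 := Kdir _ _ z1K z2K.
have Xb w : w \in K -> qle A w z -> bijective (rmap X z w).
  move=> wK wz; apply: (bij_of_comp zz1 wz (z1b z zK zz1) (z1b w wK _)).
  exact: qle_trans zz1.
have Yb w : w \in K -> qle A w z -> bijective (rmap Y z w).
  move=> wK wz; apply: (bij_of_comp zz2 wz (z2b z zK zz2) (z2b w wK _)).
  exact: qle_trans zz2.
have {}Yb w : w \in K -> qle A w z -> _ := fun wK wz => lfun_bij_inv (Yb w wK wz).
have {}Xb w : w \in K -> qle A w z -> _ := fun wK wz => lfun_bij_inv (Xb w wK wz).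
have [u|phi [phiE _]] := @lfun_extend k _ _ (i z) 0%VS (cfl k (z \in K) \o f z)%VF.
  rewrite memv0 => /eqP iu; have -> : u = 0 by apply: (imono z); rewrite iu linear0.
  by rewrite linear0.
(* The image of y in the colimit is read off at a point w of K below both y and z; the value does
   not depend on w by directedness. *)
pose val y w v := phi ((rmap Y z w)^-1%VF (rmap Y y w v)).
have val_low y w w' v : w \in K -> w' \in K -> qle A w y -> qle A w z -> qle A w' w ->
    val y w v = val y w' v.
  move=> wK w'K wy wz w'w; congr (phi _).
  have w'z : qle A w' z by exact: qle_trans wz.
  apply: (can_inj (Yb w' w'K w'z).1).
  by rewrite (Yb w' w'K w'z).2 -(rmapC _ wz w'w) (Yb w wK wz).2 rmapC.
have val_indep y w w' v : w \in K -> w' \in K -> qle A w y -> qle A w z ->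
    qle A w' y -> qle A w' z -> val y w v = val y w' v.
  move=> wK w'K wy wz w'y w'z; have [w0 w0K [w0w w0w']] := Kdir w w' wK w'K.
  by rewrite (val_low y w w0) // (val_low y w' w0).
have /choice[W HW] : forall y, exists w, y \in K ->
    [/\ w \in K, qle A w y & qle A w z].
  move=> y; have [yK|yK] := pselect (y \in K); last by exists y.
  by have [w wK [wy wz]] := Kdir y z yK zK; exists w.
have [x y yx yK v|h [hm hE]] := @mor_of_functionals k R A K Y
  (fun y => (phi \o ((rmap Y z (W y))^-1 \o rmap Y y (W y)))%VF).
  have xK : x \in K := Kup _ _ yK yx; rewrite ifT // !comp_lfunE.
  have [WyK Wyy Wyz] := HW y yK; have [WxK Wxx Wxz] := HW x xK.
  rewrite rmapC //; apply: (val_indep x (W y) (W x) v) => //.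
  exact: qle_trans yx.
exists h; split=> // y v; rewrite hE -[RHS]cfK; apply/row_const => yK.
have [WK Wy Wz] := HW y yK; rewrite !comp_lfunE -im //.
rewrite -[rmap X y (W y) v](Xb _ WK Wz).2 im // (Yb _ WK Wz).1 phiE.
set t := (rmap X z (W y))^-1%VF _.
have E1 := mor_cf (phi := f) t fm Wz WK.
have E2 := mor_cf (phi := f) v fm Wy WK.
rewrite ifT // in E1; rewrite ifT // in E2.
rewrite comp_lfunE cflE -[LHS]E1 -[RHS]E2; congr (cf (f _ _)).
by rewrite (Xb _ WK Wz).2.
Qed.

(** A morphism from M_K to X is an element of the limit of X over the ideal K, which is X z for z
    far enough up; lifting it means lifting one vector along the surjection X z -> Y z. *)
Lemma ideal_projective K : in_rep (M k A K) -> Defs.nonempty K ->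
  poset_ideal true K -> projective (M k A K).
Proof.
move=> K_rep [p0 p0K] [Kdn Kdir]; split=> // X Y X_rep Y_rep p f pm pe fm.
have C0 : [set` K] !=set0 by exists p0.
have [z1 z1K z1b] := tame_up X_rep C0 Kdir.
have [z2 z2K z2b] := tame_up Y_rep C0 Kdir.
have [z zK [zz1 zz2]] : exists2 z, z \in K & qle A z1 z /\ qle A z2 z := Kdir _ _ z1K z2K.
have bij2 (V : rep k A) a u w : qle A a u -> qle A u w -> bijective (rmap V u a) ->
    bijective (rmap V w a) -> bijective (rmap V w u).
  move=> au uw ua wa; have [uaK auK] := lfun_bij_inv ua.
  apply: (eq_bij (bij_comp (Bijective auK uaK) wa)) => v /=.
  by rewrite -(rmapC _ uw au) uaK.
have Xb w : w \in K -> qle A z w -> _ := fun wK zw =>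
  lfun_bij_inv (bij2 X z1 z w zz1 zw (z1b z zK zz1) (z1b w wK (qle_trans zz1 zw))).
have Yb w : w \in K -> qle A z w -> _ := fun wK zw =>
  lfun_bij_inv (bij2 Y z2 z w zz2 zw (z2b z zK zz2) (z2b w wK (qle_trans zz2 zw))).
pose one y : M k A K y := const_mx 1.
have rone y w : w \in K -> y \in K -> rmap (M k A K) w y (one w) = one y.
  by move=> wK yK; rewrite rmapME; apply/row_const => _; rewrite cf_const ifT.
have [x0 px0] := pe z (f z (one z)).
pose val y w := rmap X w y ((rmap X w z)^-1%VF x0).
have val_up y w w' : w \in K -> w' \in K -> qle A y w -> qle A z w -> qle A w w' ->
    val y w = val y w'.
  move=> wK w'K yw zw ww'; have zw' : qle A z w' by exact: qle_trans ww'.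
  rewrite /val -(rmapC _ ww' yw); congr (rmap X w y _).
  by apply: (can_inj (Xb w wK zw).1); rewrite (Xb w wK zw).2 rmapC // (Xb w' w'K zw').2.
have val_indep y w w' : w \in K -> w' \in K -> qle A y w -> qle A z w ->
    qle A y w' -> qle A z w' -> val y w = val y w'.
  move=> wK w'K yw zw yw' zw'; have [w0 w0K [ww0 w'w0]] := Kdir w w' wK w'K.
  by rewrite (val_up y w w0) // (val_up y w' w0).
have /choice[W HW] : forall y, exists w, y \in K ->
    [/\ w \in K, qle A y w & qle A z w].
  move=> y; have [yK|yK] := pselect (y \in K); last by exists y.
  by have [w wK [wy wz]] := Kdir y z yK zK; exists w.
have lh y : linear (fun v : M k A K y => cf v *: val y (W y)).
  by move=> a v w; rewrite (cf_linear a v w) scalerDl scalerA.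
exists (fun y => lfun_of (lh y)); split.
  move=> x y yx v; rewrite (lfun_ofE (lh x)) (lfun_ofE (lh y)) rmapME linearZ /= cf_const.
  have /orP[xK|xK] := orbN (x \in K); last by rewrite cf_false // if_same !scale0r.
  have yK : y \in K := Kdn _ _ xK yx; rewrite ifT //; congr (_ *: _).
  have [WxK xWx zWx] := HW x xK; have [WyK yWy zWy] := HW y yK.
  rewrite rmapC //; apply: (val_indep y (W y) (W x)) => //.
  exact: qle_trans xWx.
move=> y v; rewrite (lfun_ofE (lh y)).
have /orP[yK|yK] := orbN (y \in K); last first.
  by rewrite cf_false // scale0r linear0 (M_zero v (negP yK)) linear0.
have [WK yW zW] := HW y yK.
have pval : p y (val y (W y)) = f y (one y).
  rewrite pm // -(rone y (W y)) // fm //; congr (rmap Y _ _ _).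
  apply: (can_inj (Yb _ WK zW).1); rewrite -pm // (Xb _ WK zW).2 px0.
  by rewrite -(rone z (W y)) // fm.
have vE : v = cf v *: one y.
  by rewrite -[LHS]cfK -[in LHS](mulr1 (cf v)) -scalemx_const.
by rewrite linearZ /= pval {2}vE linearZ.
Qed.

End Ideals.

(** * Projectives, injectives and simples *)

Section Conditions.
Variables (k : fieldType) (R : realType) (A : contA R).
Implicit Types (x y z a r w : R) (n m : int) (lo hi : \bar R) (e c b : bool)
  (I J K U E W : interval R).

(* The support of P_x for [b = true], of I_x for [b = false]. *)
Lemma cone b x : exists C : interval R,
  in_rep (M k A C) /\ forall w, w \in C <-> qb A b w x.
Proof.
have [C CE] : exists C : interval R, forall w, w \in C <-> qb A b w x.
  apply: (@itv_of_ltb _ true) => u v w ux wx uv vw.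
  case: (ltb_total true v x) => [vx|->|xv]; [|exact: qb_refl|].
    exact: (qb_mid ux uv vx).2.
  by apply: (@qb_mid _ _ _ false w x v wx _ _).2.
exists C; split=> //; apply: in_rep_fin.
apply: fin_supp_sub (fin_supp_comparable A x) => w /CE.
by rewrite /qb; case: b {CE} => h; [left | right].
Qed.

Lemma can_one I J x : x \in I -> x \in J -> can I J x (const_mx 1 : M k A I x) = const_mx 1.
Proof. by move=> xI xJ; rewrite canE cf_const ifT. Qed.

(** Lift the canonical map from M_K to the injective at x along the surjection from the injective at
    y. The lift is nonzero at x, and a nonzero map to the latter cannot exist unless y is in K. *)
Lemma projective_closed K x y : projective (M k A K) -> x \in K -> qle A y x -> y \in K.
Proof.
move=> [_ Kp] xK yx; have [Cx [Cx_rep CxE]] := cone false x.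
have [Cy [Cy_rep CyE]] := cone false y.
have xCx : x \in Cx by apply/CxE; exact: qle_refl.
have yCy : y \in Cy by apply/CyE; exact: qle_refl.
have sub w : w \in Cx -> w \in Cy by move=> /CxE xw; apply/CyE; exact: qle_trans yx xw.
have xCy : x \in Cy by exact: sub.
have hyx : hom A Cy Cx.
  by move=> a d da aC /CxE dC; rewrite (sub d) ?CxE //; apply/esym/CxE; exact: qle_trans da.
have hKx : hom A K Cx.
  move=> a d da aK /CxE xd; have -> : a \in Cx by apply/CxE; exact: qle_trans da.
  by case/orP: (qle_between xd da); apply: itv_convex.
have [|h [hm hE]] := Kp (M k A Cy) (M k A Cx) Cy_rep Cx_rep (can Cy Cx) (can K Cx)
    (can_mor hyx) _ (can_mor hKx).
  move=> w v; exists (can Cx Cy w v); rewrite can_comp ?can_id // => wC _.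
  exact: sub.
have [c [cE ch]] := mor_scalar hm.
have c0 : c != 0.
  apply/eqP => c0; have := hE x (const_mx 1).
  by rewrite cE c0 scale0r linear0 can_one // => /esym; exact: M_neq0.
by rewrite (ch c0 _ x y) //; exists x.
Qed.

(** The injective at z maps onto the sum of those at x and y, whose supports are disjoint. A lift of
    the map with components the canonical one and 0 would be one scalar, nonzero because of x and
    zero because of y. *)
Lemma projective_no_sink K x z y : projective (M k A K) -> x < z -> z < y ->
  qle A z x -> qle A z y -> x \in K -> y \in K -> False.
Proof.
move=> [_ Kp] xz zy zx zy' xK yK.
have [Cx [Cx_rep CxE]] := cone false x; have [Cy [Cy_rep CyE]] := cone false y.
have [Cz [Cz_rep CzE]] := cone false z.
have xCx : x \in Cx by apply/CxE; exact: qle_refl.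
have yCy : y \in Cy by apply/CyE; exact: qle_refl.
have subx w : w \in Cx -> w \in Cz by move=> /CxE xw; apply/CzE; exact: qle_trans zx xw.
have suby w : w \in Cy -> w \in Cz by move=> /CyE xw; apply/CzE; exact: qle_trans zy' xw.
have disj w : w \in Cx -> ~ w \in Cy.
  move=> /CxE xw /CyE yw.
  case/orP: (qle_between zx xw) => /andP[h1 h2]; first by move: h1; rewrite leNgt xz.
  case/orP: (qle_between zy' yw) => /andP[h3 h4]; last by move: h4; rewrite leNgt zy.
  by have := lt_trans xz zy; rewrite ltNge (le_trans h4).
have hx : hom A Cz Cx.
  by move=> a d da aC /CxE dC; rewrite (subx d) ?CxE //; apply/esym/CxE; exact: qle_trans da.
have hy : hom A Cz Cy.
  by move=> a d da aC /CyE dC; rewrite (suby d) ?CyE //; apply/esym/CyE; exact: qle_trans da.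
have hKx : hom A K Cx.
  move=> a d da aK /CxE xd; have -> : a \in Cx by apply/CxE; exact: qle_trans da.
  by case/orP: (qle_between xd da); apply: itv_convex.
have [|h [hm hE]] := Kp (M k A Cz) (rsum (M k A Cx) (M k A Cy)) Cz_rep
    (in_rep_sum Cx_rep Cy_rep) (fam_pair (can Cz Cx) (can Cz Cy))
    (fam_pair (can K Cx) (@fam_zero _ _ _ _ _)) (mor_pair (can_mor hx) (can_mor hy)) _
    (mor_pair (can_mor hKx) (@mor_zero _ _ _ _ _)).
  move=> w [v1 v2]; exists (can Cx Cz w v1 + can Cy Cz w v2).
  have E1 : can Cy Cx w v2 = 0.
    have /orP[wC|wC] := orbN (w \in Cy); last by rewrite (M_zero v2 (negP wC)) linear0.
    by apply: M_zero => wx; exact: disj wC.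
  have E2 : can Cx Cy w v1 = 0.
    have /orP[wC|wC] := orbN (w \in Cx); last by rewrite (M_zero v1 (negP wC)) linear0.
    by apply: M_zero; exact: disj.
  have F1 : can Cz Cx w (can Cx Cz w v1) = v1 /\ can Cz Cy w (can Cx Cz w v1) = 0.
    by split; rewrite can_comp ?can_id // => *; exact: subx.
  have F2 : can Cz Cx w (can Cy Cz w v2) = 0 /\ can Cz Cy w (can Cy Cz w v2) = v2.
    by split; rewrite can_comp ?can_id // => *; exact: suby.
  by rewrite fam_pairE !linearD /= F1.1 F1.2 F2.1 F2.2 addr0 add0r.
have [c [cE _]] := mor_scalar hm.
have c0 : c != 0.
  apply/eqP => c0; have := hE x (const_mx 1).
  rewrite cE c0 scale0r linear0 fam_pairE can_one // => /esym /(congr1 fst) /=.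
  exact: M_neq0.
have := hE y (const_mx 1); rewrite !fam_pairE cE zero_lfunE !linearZ /=.
have yCz := suby y yCy.
rewrite [can K Cz y _]can_one // => /(congr1 snd) /= /eqP.
by rewrite scaler_eq0 (negPf c0) /= can_one // => /eqP; exact: M_neq0.
Qed.

(** Dually, the canonical map from the projective at x to M_K is extended along its inclusion into
    the projective at y. *)
Lemma injective_closed K x y : rep_injective (M k A K) -> x \in K -> qle A x y -> y \in K.
Proof.
move=> [_ Kp] xK xy; have [Cx [Cx_rep CxE]] := cone true x.
have [Cy [Cy_rep CyE]] := cone true y.
have xCx : x \in Cx by apply/CxE; exact: qle_refl.
have yCy : y \in Cy by apply/CyE; exact: qle_refl.
have sub w : w \in Cx -> w \in Cy by move=> /CxE xw; apply/CyE; exact: qle_trans xw xy.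
have xCy : x \in Cy by exact: sub.
have hxy : hom A Cx Cy.
  move=> a d da aC dC; rewrite (sub a) //; apply/CxE.
  by apply: qle_trans da _; exact/CxE.
have hxK : hom A Cx K.
  move=> a d da /CxE ax dK; have -> : d \in Cx by apply/CxE; exact: qle_trans ax.
  by apply/esym; case/orP: (qle_between da ax); apply: itv_convex.
have [|h [hm hE]] := Kp (M k A Cx) (M k A Cy) Cx_rep Cy_rep (can Cx Cy) (can Cx K)
    (can_mor hxy) _ (can_mor hxK).
  move=> w; apply: can_inj (can Cy Cx w) _ => v.
  by rewrite can_comp ?can_id // => wC _; exact: sub.
have [c [cE ch]] := mor_scalar hm.
have c0 : c != 0.
  apply/eqP => c0; have := hE x (const_mx 1).
  by rewrite cE c0 scale0r can_one // => /esym; exact: M_neq0.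
by rewrite -(ch c0 _ y x) //; exists x.
Qed.

(** Dually, the sum of the projectives at x and y embeds into the projective at z, and a map that is
    canonical on the first summand and 0 on the second does not extend. *)
Lemma injective_no_source K x z y : rep_injective (M k A K) -> x < z -> z < y ->
  qle A x z -> qle A y z -> x \in K -> y \in K -> False.
Proof.
move=> [_ Kp] xz zy zx zy' xK yK.
have [Cx [Cx_rep CxE]] := cone true x; have [Cy [Cy_rep CyE]] := cone true y.
have [Cz [Cz_rep CzE]] := cone true z.
have xCx : x \in Cx by apply/CxE; exact: qle_refl.
have yCy : y \in Cy by apply/CyE; exact: qle_refl.
have subx w : w \in Cx -> w \in Cz by move=> /CxE xw; apply/CzE; exact: qle_trans xw zx.
have suby w : w \in Cy -> w \in Cz by move=> /CyE xw; apply/CzE; exact: qle_trans xw zy'.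
have disj w : w \in Cx -> ~ w \in Cy.
  move=> /CxE xw /CyE yw.
  case/orP: (qle_between xw zx) => /andP[h1 h2]; last by move: h1; rewrite leNgt xz.
  case/orP: (qle_between yw zy') => /andP[h3 h4]; first by move: h4; rewrite leNgt zy.
  by have := lt_trans xz zy; rewrite ltNge (le_trans h4).
have hx : hom A Cx Cz.
  move=> a d da aC dC; rewrite (subx a) //; apply/CxE.
  by apply: qle_trans da _; exact/CxE.
have hy : hom A Cy Cz.
  move=> a d da aC dC; rewrite (suby a) //; apply/CyE.
  by apply: qle_trans da _; exact/CyE.
have hxK : hom A Cx K.
  move=> a d da /CxE ax dK; have -> : d \in Cx by apply/CxE; exact: qle_trans ax.
  by apply/esym; case/orP: (qle_between da ax); apply: itv_convex.
have [|h [hm hE]] := Kp (rsum (M k A Cx) (M k A Cy)) (M k A Cz)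
    (in_rep_sum Cx_rep Cy_rep) Cz_rep (fam_copair (can Cx Cz) (can Cy Cz))
    (fam_copair (can Cx K) (@fam_zero _ _ _ _ _)) (mor_copair (can_mor hx) (can_mor hy)) _
    (mor_copair (can_mor hxK) (@mor_zero _ _ _ _ _)).
  move=> w [v1 v2] [u1 u2]; rewrite !fam_copairE /= => E.
  have /orP[wx|wx] := orbN (w \in Cx).
    have wy := disj w wx; rewrite (M_zero v2 wy) (M_zero u2 wy) !linear0 !addr0 in E *.
    congr (_, _); have := congr1 (@can k R A Cz Cx w) E; rewrite /= !can_comp ?can_id //;
    by move=> *; exact: subx.
  rewrite (M_zero v1 (negP wx)) (M_zero u1 (negP wx)) !linear0 !add0r in E *.
  congr (_, _); have := congr1 (@can k R A Cz Cy w) E; rewrite /= !can_comp ?can_id //;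
  by move=> *; exact: suby.
have [c [cE _]] := mor_scalar hm.
have c0 : c != 0.
  apply/eqP => c0; have := hE x (const_mx 1, 0).
  rewrite cE c0 scale0r fam_copairE /= linear0 addr0 can_one // => /esym.
  exact: M_neq0.
have := hE y (0, const_mx 1); rewrite cE !fam_copairE /= !linear0 zero_lfunE !add0r.
have yCz := suby y yCy.
rewrite can_one // => /eqP; rewrite scaler_eq0 (negPf c0) /= can_one // => /eqP.
exact: M_neq0.
Qed.

(** The points of K below a given point of K support a nonzero subrepresentation, so all of K lies
    below each of its points. *)
Lemma simple_point K x y : simple (M k A K) -> x \in K -> y \in K -> x = y.
Proof.
move=> [K_rep _ Ks].
have H a d : a \in K -> d \in K -> qle A d a.
  move=> aK dK.
  have [J JE] : exists J : interval R, forall w, w \in J <-> w \in K /\ qle A w a.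
    apply: (@itv_of_ltb _ true) => u v w [uK ua] [wK wa] uv vw; split.
      exact: itv_ltb uK wK uv vw.
    case: (ltb_total true v a) => [va|->|av]; [|exact: qle_refl|].
      exact: (@qb_mid _ _ true _ _ _ _ ua uv va).2.
    by apply: (@qb_mid _ _ true false w a v wa _ _).2.
  have J_rep : in_rep (M k A J).
    apply: in_rep_fin; apply: fin_supp_sub ((in_rep_itvP _ _ _).1 K_rep).
    by move=> w /JE[].
  have JK : hom A J K.
    move=> u w wu /JE[uK ua] wK; rewrite uK.
    by apply/JE; split=> //; exact: qle_trans ua.
  have aJ : a \in J by apply/JE; split=> //; exact: qle_refl.
  have [|J0|Ji] := Ks (M k A J) (can J K) J_rep (can_mor JK).
  - move=> w; apply: can_inj (can K J w) _ => v.
    by rewrite can_comp ?can_id // => wJ _; case/JE: wJ.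
  - by case: (M_neq0 (k := k) (A := A) aJ); exact: J0.
  - have /(_ d) := iso_M_mem (ex_intro _ _ Ji).
    by rewrite dK => /JE[].
by move=> xK yK; apply: (@qle_anti _ A); exact: H.
Qed.

Lemma point_simple K x : in_rep (M k A K) -> x \in K ->
  (forall y, y \in K -> y = x) -> simple (M k A K).
Proof.
move=> K_rep xK Kx; split=> //.
  by move=> /(_ x (const_mx 1)); exact: M_neq0.
move=> X i X_rep im imono.
have [X0|/existsNP[v v0]] := pselect (forall v : X x, v = 0).
  left=> y v; have [E|yx] := eqVneq y x; first by move: v; rewrite E; exact: X0.
  apply: (imono y); rewrite linear0; apply: M_zero => /Kx E.
  by rewrite E eqxx in yx.
right; apply: bij_iso => // y w; have [yK|yK] := pselect (y \in K); last first.
  by exists 0; rewrite linear0 (M_zero w yK).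
have E := Kx y yK; rewrite E in w *; clear y yK E.
have iv0 : cf (i x v) != 0.
  apply/eqP => c0; apply: v0; apply: (imono x); rewrite linear0 -[LHS]cfK c0.
  by apply/rowP => j; rewrite !mxE.
exists ((cf w / cf (i x v)) *: v); rewrite linearZ /= -[RHS]cfK.
have iE : i x v = const_mx (cf (i x v)) by rewrite cfK.
rewrite [X in _ *: X]iE.
rewrite -[LHS]/(_ *: const_mx _ : 'rV_(x \in K)) scalemx_const.
by rewrite mulfVK.
Qed.

End Conditions.

(** * Intervals with disjoint cells; ideals inside one segment *)

Section Validity.
Variables (k : fieldType) (R : realType) (A : contA R).
Implicit Types (x y z a r w : R) (n m : int) (lo hi : \bar R) (e c b : bool)
  (I J K U E W : interval R).

Lemma pt_inj m n : has_idx A m -> has_idx A n -> pt A m = pt A n -> m = n.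
Proof.
move=> hm hn E; case: (ltgtP m n) => //.
  by rewrite -(pt_lt hm hn) E ltxx.
by rewrite -(pt_lt hn hm) E ltxx.
Qed.

Lemma not_strictly_between m n : has_idx A m -> has_idx A (m + 1) -> has_idx A n ->
  ~ (pt A m < pt A n < pt A (m + 1))%E.
Proof.
by move=> hm hm1 hn /andP[]; rewrite !pt_lt // ltzD1 => mn; rewrite leNgt mn.
Qed.

Lemma cell_lo e lo hi n : cell A e lo hi -> has_idx A n -> lo = pt A n ->
  [/\ has_idx A (n + 1), e = ~~ evenz n & hi = pt A (n + 1)].
Proof.
move=> hc hn ln; case: (cell_inv hc) => [[m [a [hm hm1 ma _ [la _]]]]|[m [hm hm1 -> lm ->]]].
  by case: (@not_strictly_between m n) => //; rewrite -ln la.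
by have <- : m = n by apply: (pt_inj hm hn); rewrite -lm -ln.
Qed.

Lemma cell_hi e lo hi n : cell A e lo hi -> has_idx A (n + 1) -> hi = pt A (n + 1) ->
  [/\ has_idx A n, e = ~~ evenz n & lo = pt A n].
Proof.
move=> hc hn ln; case: (cell_inv hc) => [[m [a [hm hm1 ma _ [_ la]]]]|[m [hm hm1 -> -> lm]]].
  by case: (@not_strictly_between m (n + 1)) => //; rewrite -ln la.
have E : m + 1 = n + 1 by apply: (pt_inj hm1 hn); rewrite -lm -ln.
by have <- : m = n by apply: (addIr 1).
Qed.

Lemma lt_above x (a : \bar R) : (x%:E < a)%E -> exists2 y, x < y & (y%:E < a)%E.
Proof.
case: a => [r| |] // xr; first by exists ((x + r) / 2); rewrite ?lte_fin midf_lt.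
by exists (x + 1); rewrite ?ltrDl ?ltry.
Qed.

Lemma lt_below x (a : \bar R) : (a < x%:E)%E -> exists2 y, y < x & (a < y%:E)%E.
Proof.
case: a => [r| |] // xr; first by exists ((r + x) / 2); rewrite ?lte_fin midf_lt.
by exists (x - 1); rewrite ?gtrBl ?ltNyr.
Qed.

Section Valid.
Variables (c e c2 e2 : bool) (lo hi lo2 hi2 : \bar R).
Let K := Interval (lend c lo hi) (rend c2 lo2 hi2).
Hypotheses (hc : cell A e lo hi) (hc2 : cell A e2 lo2 hi2) (hl : (hi < lo2)%E).

(** Take x in K between the cells, inside a segment. Closure under the order fills K from x to one
    end of the segment, and the second hypothesis forbids K to turn there. So K ends exactly at that
    end with a closed or infinite bracket; the cell there is the whole segment and contains x, a
    contradiction. *)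
Lemma valid_not_ideal b : (forall x y, x \in K -> qb A b y x -> y \in K) ->
  (forall x z y, x < z -> z < y -> qb A b z x -> qb A b z y ->
     x \in K -> y \in K -> False) -> False.
Proof.
move=> Kc Ks; have [x0 /andP[hx0 xl0]] := between_cells hc hc2 hl.
have [lohi _] := cell_lt hc; have [lohi2 _] := cell_lt hc2.
have [n [[hn hn1 /andP[nx0 _]] x0n]] := seg_exists A x0.
have [x [x0x xn xl]] : exists x, [/\ x0 < x, (x%:E < pt A (n + 1))%E & (x%:E < lo2)%E].
  have [y1 xy1 y1n] := lt_above x0n; have [y2 xy2 y2n] := lt_above xl0.
  exists (Num.min y1 y2); rewrite lt_min xy1 xy2; split=> //.
    by apply: le_lt_trans y1n; rewrite lee_fin ge_min lexx.
  by apply: le_lt_trans y2n; rewrite lee_fin ge_min lexx orbT.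
have hx : (hi < x%:E)%E by apply: lt_trans hx0 _; rewrite lte_fin.
have nx : (pt A n < x%:E)%E by apply: le_lt_trans nx0 _; rewrite lte_fin.
have memK y : (y \in K) = (if c then (lo <= y%:E)%E else (hi < y%:E)%E) &&
  (if c2 then (y%:E <= hi2)%E else (y%:E < lo2)%E) by exact: mem_cells.
have memKl y : y <= x -> (y \in K) = if c then (lo <= y%:E)%E else (hi < y%:E)%E.
  move=> yx; have yl : (y%:E < lo2)%E by apply: le_lt_trans xl; rewrite lee_fin.
  rewrite memK; case: (c2); rewrite ?yl ?andbT //.
  by rewrite (le_trans (ltW yl) lohi2) andbT.
have memKr y : x <= y -> (y \in K) = if c2 then (y%:E <= hi2)%E else (y%:E < lo2)%E.
  move=> yx; have yl : (hi < y%:E)%E by apply: lt_le_trans hx _; rewrite lee_fin.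
  rewrite memK; case: (c); rewrite ?yl //.
  by rewrite (le_trans lohi (ltW yl)).
have xK : x \in K by rewrite memKl // hx (le_trans lohi (ltW hx)) if_same.
have xin : inseg A n x by split=> //; rewrite !ltW.
have [eb|eb] := eqVneq (evenz n) b.
  have left y : inseg A n y -> y <= x -> y \in K.
    by move=> yn yx; apply: Kc xK _; rewrite -eb; exact: seg_qb.
  (* A cell that starts at s_n is the segment up to s_(n+1), while x lies right of the cell and left
     of s_(n+1). *)
  have lo_n : lo = pt A n -> False.
    by move=> /(cell_lo hc hn)[_ _ E]; move: hx; rewrite E ltNge ltW.
  have [[r nr]|nN] : (exists r, pt A n = r%:E) \/ pt A n = -oo%E.
    by case: (pt A n) nx => [r| |] //; [left; exists r | right].
    have rx : r < x by move: nx; rewrite nr lte_fin.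
    have rin : inseg A n r by split=> //; rewrite nr lexx -nr ltW // pt_succ_lt.
    have rK : r \in K by apply: left => //; exact: ltW.
    have nl y : y < r -> y \in K -> False.
      move=> yr yK; have hn' : has_idx A (n - 1) by apply: idx_pred; rewrite // nr ltNyr.
      have hn1' : has_idx A (n - 1 + 1) by rewrite subrK.
      have [|y' [yy' y'r y'n]] := @seg_left _ A (n - 1) r y hn' hn1' _ yr.
        by rewrite subrK nr lexx andbT -nr pt_lt // gtrBl.
      have y'K : y' \in K by apply: itv_convex yK rK _; rewrite yy' ltW.
      apply: (Ks y' r x) => //.
        have -> : b = ~~ evenz (n - 1) by rewrite -evenzS subrK.
        rewrite qbN; apply: seg_qb => //; last exact: ltW.
        by split=> //; rewrite subrK nr lexx andbT -nr pt_le // gerBl.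
      by rewrite -eb; apply: seg_qb => //; exact: ltW.
    have := memKl r (ltW rx); rewrite rK => /esym.
    case cE: c => lr; last first.
      have [y yr ly] := lt_below lr; apply: (nl y yr).
      by rewrite memKl ?cE // ltW // (lt_trans yr).
    move: lr; rewrite le_eqVlt => /predU1P[lr|lr]; first by apply: lo_n; rewrite lr.
    have [y yr ly] := lt_below lr; apply: (nl y yr).
    by rewrite memKl ?cE ltW // (lt_trans yr).
  have all y : y <= x -> y \in K.
    move=> yx; apply: left => //; split=> //; rewrite nN leNye (le_trans _ (ltW xn)) //.
  have [hioo looo] := (cell_lt hc).2.
  case cE: c.
    case loE: lo looo => [r| |] // _; last by apply: lo_n; rewrite loE nN.
    have := all (Num.min x (r - 1)); rewrite ge_min lexx => /(_ isT).
    rewrite memKl ?ge_min ?lexx // cE loE lee_fin le_min => /andP[_].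
    by rewrite leNgt gtrBl ltr01.
  case hiE: hi hioo hx => [r| |] // _ _.
  have := all (Num.min x r); rewrite ge_min lexx => /(_ isT).
  by rewrite memKl ?ge_min ?lexx // cE hiE lte_fin lt_min ltxx andbF.
have {}eb : b = ~~ evenz n by move: eb; case: (b); case: (evenz n).
have right y : inseg A n y -> x <= y -> y \in K.
  by move=> yn yx; apply: Kc xK _; rewrite eb qbN; exact: seg_qb.
have hi_n : hi2 = pt A (n + 1) -> False.
  by move=> /(cell_hi hc2 hn1)[_ _ E]; move: xl; rewrite E ltNge ltW.
have [[r nr]|nN] : (exists r, pt A (n + 1) = r%:E) \/ pt A (n + 1) = +oo%E.
  by case: (pt A (n + 1)) xn => [r| |] //; [left; exists r | right].
  have rx : x < r by move: xn; rewrite nr lte_fin.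
  have rin : inseg A n r by split=> //; rewrite nr lexx -nr ltW // pt_succ_lt.
  have rK : r \in K by apply: right => //; exact: ltW.
  have nl y : r < y -> y \in K -> False.
    move=> yr yK; have hn2 : has_idx A (n + 1 + 1) by apply: idx_succ; rewrite // nr ltry.
    have [|y' [yy' y'r y'n]] := @seg_right _ A (n + 1) r y hn1 hn2 _ yr.
      by rewrite -nr lexx pt_succ_lt.
    have y'K : y' \in K by apply: itv_convex rK yK _; rewrite y'r ltW.
    apply: (Ks x r y') => //.
      by rewrite eb qbN; apply: seg_qb => //; exact: ltW.
    rewrite eb -evenzS; apply: seg_qb => //; last exact: ltW.
    by split=> //; rewrite -nr lexx ltW // pt_succ_lt.
  have := memKr r (ltW rx); rewrite rK => /esym.
  case cE: c2 => lr; last first.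
    have [y yr ly] := lt_above lr; apply: (nl y yr).
    by rewrite memKr ?cE // ltW // (lt_trans rx).
  move: lr; rewrite le_eqVlt => /predU1P[lr|lr]; first by apply: hi_n; rewrite -lr.
  have [y yr ly] := lt_above lr; apply: (nl y yr).
  by rewrite memKr ?cE ltW // (lt_trans rx).
have all y : x <= y -> y \in K.
  by move=> yx; apply: right => //; split=> //; rewrite nN leey andbT (le_trans (ltW nx)).
have hioo := (cell_lt hc2).2.1; have looo := (cell_lt hc2).2.2.
case cE: c2.
  case hiE: hi2 hioo => [r| |] // _; last by apply: hi_n; rewrite hiE nN.
  have := all (Num.max x (r + 1)); rewrite le_max lexx => /(_ isT).
  rewrite memKr ?le_max ?lexx // cE hiE lee_fin ge_max => /andP[_].
  by rewrite leNgt ltrDl ltr01.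
case loE: lo2 looo xl => [r| |] // _ _.
have := all (Num.max x r); rewrite le_max lexx => /(_ isT).
by rewrite memKr ?le_max ?lexx // cE loE lte_fin gt_max ltxx andbF.
Qed.

(** For K = [s_n, s_(n+1)] both cells would be this very segment. For a simple M_K the support would
    be a point, whereas the gap between the cells is open. *)
Lemma valid_conditions : AR_conditions k A K.
Proof.
have [lohi [hioo looo]] := cell_lt hc; have [lohi2 [hioo2 looo2]] := cell_lt hc2.
split=> [pK|iK|[sK|[n [hn hn1 E]]]].
- apply: (@valid_not_ideal true) => [x y xK yx|x z y xz zy zx zy' xK yK].
    exact: projective_closed pK xK yx.
  exact: (projective_no_sink pK xz zy zx zy' xK yK).
- apply: (@valid_not_ideal false) => [x y xK yx|x z y xz zy zx zy' xK yK].
    exact: injective_closed iK xK yx.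
  exact: (injective_no_source iK xz zy zx zy' xK yK).
- have [x /andP[hx xl]] := between_cells hc hc2 hl.
  have [y xy yl] := lt_above xl.
  have mem z : (hi < z%:E)%E -> (z%:E < lo2)%E -> z \in K.
    move=> hz zl; rewrite mem_cells; apply/andP; split.
      by case: c => //; rewrite (le_trans lohi) // ltW.
    by case: c2 => //; rewrite (le_trans _ lohi2) // ltW.
  have yK : y \in K by apply: mem yl; apply: lt_trans hx _; rewrite lte_fin.
  by have := simple_point sK (mem x hx xl) yK => E; rewrite E ltxx in xy.
- have /(congr1 (fun J => J.1)) /= E1 := E; have /(congr1 (fun J => J.2)) /= E2 := E.
  have loE : lo = pt A n.
    move: E1 (pt_succ_lt hn hn1); rewrite /lend; case: c.
      by case: (lo) (pt A n) => [r| |] [s| |] //= [->].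
    by case: (hi) (pt A n) hioo => [r| |] [s| |] //=; case: (pt A (n + 1)).
  have hiE : hi2 = pt A (n + 1).
    move: E2 (pt_succ_lt hn hn1); rewrite /rend; case: c2.
      by case: (hi2) (pt A (n + 1)) => [r| |] [s| |] //= [->].
    by case: (lo2) (pt A (n + 1)) looo2 => [r| |] [s| |] //=; case: (pt A n).
  have [_ _ hiE'] := cell_lo hc hn loE; have [_ _ loE'] := cell_hi hc2 hn1 hiE.
  by move: hl; rewrite hiE' loE' ltNge ltW // pt_succ_lt.
Qed.
End Valid.

Lemma seg_le_of_qb n x y : inseg A n x -> (x%:E < pt A (n + 1))%E ->
  qb A (evenz n) y x -> y <= x.
Proof.
move=> xn xn1 yx; rewrite leNgt; apply/negP => xy.
case: (xn) => hn hn1 /andP[nx _].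
have [|y' [xy' y'y y'n]] := @seg_right _ A n x y hn hn1 _ xy; first by rewrite nx.
have y'x : qb A (evenz n) y' x.
  move: y'y; rewrite le_eqVlt => /predU1P[->//|y'y].
  exact: (@qb_mid _ A _ false y x y' yx y'y xy').2.
have xy'' := seg_qb xn y'n (ltW xy').
by move: xy'; rewrite (qb_anti xy'' y'x) ltxx.
Qed.

Lemma seg_ge_of_qb n x y : inseg A n x -> (pt A n < x%:E)%E ->
  qb A (evenz n) x y -> x <= y.
Proof.
move=> xn xn1 yx; rewrite leNgt; apply/negP => xy.
case: (xn) => hn hn1 /andP[_ nx].
have [|y' [xy' y'y y'n]] := @seg_left _ A n x y hn hn1 _ xy; first by rewrite xn1.
have y'x : qb A (evenz n) x y'.
  move: xy'; rewrite le_eqVlt => /predU1P[<-//|y'y'].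
  exact: (@qb_mid _ A _ false x y y' yx y'y y'y').1.
have xy'' := seg_qb y'n xn (ltW y'y).
by move: y'y; rewrite (qb_anti xy'' y'x) ltxx.
Qed.

Lemma chain_ideal n b K : (forall x, x \in K -> inseg A n x) ->
  (forall x y, x \in K -> qb A b y x -> y \in K) -> poset_ideal A b K.
Proof.
move=> Kn Kc; split=> // x y xK yK.
have [|] : qb A b x y \/ qb A b y x.
- by have := inseg_qle_total (Kn x xK) (Kn y yK); rewrite /qb; case: b {Kc} => -[]; auto.
- by move=> xy; exists y => //; split=> //; exact: qb_refl.
- by move=> yx; exists x => //; split=> //; exact: qb_refl.
Qed.

(** From a point short of s_(n+1) the relation leads only to the left, and not past s_n, which is
    extremal in this direction; so it stays in K. *)
Lemma initial_ideal n K : (forall x, x \in K -> inseg A n x) ->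
  (forall x y, x \in K -> inseg A n y -> y <= x -> y \in K) ->
  (forall x, x \in K -> (x%:E < pt A (n + 1))%E) -> poset_ideal A (evenz n) K.
Proof.
move=> Kn Ki Kl; apply: (chain_ideal Kn) => x y xK yx.
have xn := Kn x xK; have yx' := seg_le_of_qb xn (Kl x xK) yx.
apply: (Ki x) => //; case: (xn) => hn hn1 /andP[nx xn1]; split=> //.
rewrite (le_trans _ xn1) ?lee_fin // andbT leNgt; apply/negP => yn.
have [r [nr /andP[yr rx]]] := ereal_between (ltW yn) nx.
have ry : qb A (evenz n) y r.
  move: rx; rewrite le_eqVlt => /predU1P[->//|rx].
  move: yr; rewrite le_eqVlt => /predU1P[->|yr]; first exact: qb_refl.
  exact: (@qb_mid _ A _ true y x r yx yr rx).1.
by move: yn; rewrite nr (end_left hn nr ry) ltxx.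
Qed.

Lemma final_ideal n K : (forall x, x \in K -> inseg A n x) ->
  (forall x y, x \in K -> inseg A n y -> x <= y -> y \in K) ->
  (forall x, x \in K -> (pt A n < x%:E)%E) -> poset_ideal A (~~ evenz n) K.
Proof.
move=> Kn Ki Kl; apply: (chain_ideal Kn) => x y xK; rewrite qbN => yx.
have xn := Kn x xK; have yx' := seg_ge_of_qb xn (Kl x xK) yx.
apply: (Ki x) => //; case: (xn) => hn hn1 /andP[nx xn1]; split=> //.
rewrite (le_trans nx) ?lee_fin //= leNgt; apply/negP => yn.
have [r [nr /andP[yr rx]]] := ereal_between xn1 (ltW yn).
have ry : qb A (evenz n) r y.
  move: rx; rewrite le_eqVlt => /predU1P[->|rx]; first exact: qb_refl.
  move: yr; rewrite le_eqVlt => /predU1P[<-//|yr].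
  exact: (@qb_mid _ A _ true x y r yx yr rx).2.
by move: yn; rewrite nr (end_right hn1 nr ry) ltxx.
Qed.

End Validity.

(** * Intervals with overlapping cells *)

Section Invalid.
Variables (k : fieldType) (R : realType) (A : contA R).
Implicit Types (x y z a r w : R) (n m : int) (lo hi : \bar R) (e c b : bool)
  (I J K U E W : interval R).

(** Two adjacent segments form the set of all points comparable to their common end, which generates
    it. *)
Lemma double_ideal n r K : has_idx A n -> has_idx A (n + 1) ->
  has_idx A (n + 1 + 1) -> pt A (n + 1) = r%:E ->
  (forall x, x \in K <-> (pt A n <= x%:E <= pt A (n + 1 + 1))%E) ->
  poset_ideal A (evenz n) K.
Proof.
move=> hn hn1 hn2 nr KE.
have rn : inseg A n r by split=> //; rewrite nr lexx -nr ltW // pt_succ_lt.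
have rn1 : inseg A (n + 1) r by split=> //; rewrite -nr lexx ltW // pt_succ_lt.
have rK : r \in K by apply/KE; case: rn => _ _ /andP[-> _]; case: rn1 => _ _ /andP[_ ->].
have Kr x : x \in K -> qb A (evenz n) x r.
  move=> /KE/andP[nx xn]; have [xr|rx] := leP x r.
    by apply: seg_qb => //; split=> //; rewrite nx nr lee_fin.
  have -> : evenz n = ~~ evenz (n + 1) by rewrite evenzS negbK.
  rewrite qbN; apply: seg_qb => //; last exact: ltW.
  by split=> //; rewrite xn nr lee_fin ltW.
split=> [x y xK yx|x y xK yK]; last by exists r => //; split; exact: Kr.
have yr := qb_trans yx (Kr x xK).
have [m ym rm] : exists2 m, inseg A m y & inseg A m r.
  by move: yr; rewrite /qb; case: ifP => _ /qle_witness[m [? ? _]]; exists m.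
apply/KE; have [nn1 n1n2] := (pt_succ_lt hn hn1, pt_succ_lt hn1 hn2).
case: (inseg_pt hn1 nr rm) ym => [->|/addIr <-] [_ _ /andP[h1 h2]]; apply/andP; split=> //.
  by apply: le_trans h1; exact: ltW.
by apply: (le_trans h2); exact: ltW.
Qed.

(** Overlapping point cells coincide, and in most other cases K is a part of one segment reaching
    one of its ends. The first conclusion concerns ends of the kind found in first terms: then the
    parities always select a filter, never a proper ideal or a bare segment. *)
Lemma invalid_cells c e lo hi c2 e2 lo2 hi2
    (K := Interval (lend c lo hi) (rend c2 lo2 hi2)) :
  cell A e lo hi -> cell A e2 lo2 hi2 -> Defs.nonempty K -> (lo2 <= hi)%E ->
  (c = e -> c2 = ~~ e2 -> poset_ideal A false K) /\
  [\/ forall x y, x \in K -> y \in K -> x = y, adjacent_supp A K |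
      exists b, poset_ideal A b K].
Proof.
move=> hc hc2 [p pK] lh.
have memK x : x \in K = (if c then (lo <= x%:E)%E else (hi < x%:E)%E) &&
  (if c2 then (x%:E <= hi2)%E else (x%:E < lo2)%E) by exact: mem_cells.
have := pK; rewrite memK.
case: (cell_inv hc) => [[n [a [hn hn1 an eE [loE hiE]]]]|[n [hn hn1 eE loE hiE]]];
case: (cell_inv hc2) => [[m [d [hm hm1 dm e2E [lo2E hi2E]]]]|[m [hm hm1 e2E lo2E hi2E]]].
- rewrite loE hiE lo2E hi2E !lee_fin !lte_fin in memK lh *.
  case: (c) (c2) memK => -[] memK /andP[h1 h2]; try by exfalso; move: lh h1 h2; clear; rewrite ?lee_fin ?lte_fin; lra.
  have da : d = a by move: lh h1 h2; clear; rewrite ?lee_fin ?lte_fin; lra.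
  have nm : n = m.
    apply: (inseg_open hm hm1 dm); rewrite da.
    by case/andP: an => na an; split=> //; rewrite !ltW.
  split; first by rewrite eE e2E nm; case: (evenz m).
  by apply: Or31 => x y; rewrite !memK !lee_fin; move: lh; clear; lra.
- case/andP: an => na an; have an' : inseg A n a by split=> //; rewrite !ltW.
  rewrite loE hiE lo2E hi2E in memK lh *.
  case: (c) (c2) memK => -[] memK /andP[h1 h2].
  + have am : inseg A m a by split=> //; rewrite lh (le_trans h1).
    have mn : m = n by apply: (inseg_open hn hn1 _ am); rewrite na an.
    have F : poset_ideal A (~~ evenz m) K.
      apply: final_ideal => [x|x y|x]; rewrite ?memK.
      * by move=> /andP[h3 h4]; split=> //; rewrite h4 (le_trans lh).
      * move=> /andP[h3 h4] [_ _ /andP[h5 h6]] xy; rewrite h6 andbT.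
        by apply: (le_trans h3); rewrite lee_fin.
      * by move=> /andP[h3 h4]; apply: lt_le_trans h3; rewrite mn.
    split; last by apply: Or33; exists (~~ evenz m).
    by move=> _ E2; move: F; rewrite -e2E; case: (e2) E2.
  + by move: h2; rewrite ltNge (le_trans lh).
  + have F : poset_ideal A (~~ evenz m) K.
      apply: final_ideal => [x|x y|x]; rewrite ?memK.
      * by move=> /andP[h3 h4]; split=> //; rewrite h4 (le_trans lh) ?ltW.
      * move=> /andP[h3 h4] [_ _ /andP[h5 h6]] xy; rewrite h6 andbT.
        by apply: (lt_le_trans h3); rewrite lee_fin.
      * by move=> /andP[h3 h4]; apply: le_lt_trans h3.
    split; last by apply: Or33; exists (~~ evenz m).
    by move=> _ E2; move: F; rewrite -e2E; case: (e2) E2.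
  + by move: h2; rewrite ltNge (le_trans lh) ?ltW.
- case/andP: dm => md dm; have dm' : inseg A m d by split=> //; rewrite !ltW.
  rewrite loE hiE lo2E hi2E in memK lh *.
  case: (c) (c2) memK => -[] memK /andP[h1 h2].
  + have am : inseg A n d by split=> //; rewrite lh (le_trans h1).
    have mn : n = m by apply: (inseg_open hm hm1 _ am); rewrite md dm.
    have F : poset_ideal A (evenz n) K.
      apply: initial_ideal => [x|x y|x]; rewrite ?memK.
      * by move=> /andP[h3 h4]; split=> //; rewrite h3 (le_trans h4).
      * move=> /andP[h3 h4] [_ _ /andP[h5 h6]] xy; rewrite h5 /=.
        by apply: le_trans h4; rewrite lee_fin.
      * by move=> /andP[h3 h4]; apply: (le_lt_trans h4); rewrite mn.
    split; last by apply: Or33; exists (evenz n).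
    by move=> E _; move: F; rewrite -[evenz n]negbK -eE -E.
  + have F : poset_ideal A (evenz n) K.
      apply: initial_ideal => [x|x y|x]; rewrite ?memK.
      * by move=> /andP[h3 h4]; split=> //; rewrite h3 (le_trans (ltW h4)).
      * move=> /andP[h3 h4] [_ _ /andP[h5 h6]] xy; rewrite h5 /=.
        by apply: le_lt_trans h4; rewrite lee_fin.
      * by move=> /andP[h3 h4]; apply: lt_le_trans lh.
    split; last by apply: Or33; exists (evenz n).
    by move=> E _; move: F; rewrite -[evenz n]negbK -eE -E.
  + by move: h1; rewrite ltNge (le_trans h2).
  + by move: h1; rewrite ltNge (le_trans (ltW h2)).
rewrite loE hiE lo2E hi2E in memK lh *.
case cE: c memK => memK; case c2E: c2 memK => memK /andP[h1 h2]; last 1 first.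
- by move: h1; rewrite ltNge (le_trans (ltW h2)).
- have mn1 : m <= n + 1 by rewrite -(pt_le hm hn1).
  have nm1 : n <= m + 1 by rewrite -(pt_le hn hm1) (le_trans h1).
  have [[mn|mn]|nm] : (m = n \/ m = n + 1) \/ n = m + 1 by lia.
  + split; first by rewrite eE e2E mn; case: (evenz n).
    by apply: Or32; exists n; split=> //; rewrite /K cE c2E loE hi2E mn.
  + have [r nr] : exists r, pt A (n + 1) = r%:E.
      have := pt_succ_lt hn hn1; have := pt_succ_lt hm hm1; rewrite mn.
      case: (pt A (n + 1)) => [r| |]; first by exists r.
        by case: (pt A (n + 1 + 1)).
      by case: (pt A n).
    have F : poset_ideal A (evenz n) K.
      apply: (double_ideal hn hn1 _ nr); first by rewrite -mn.
      by move=> x; rewrite memK mn.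
    split; last by apply: Or33; exists (evenz n).
    by move=> E _; move: F; rewrite -[evenz n]negbK -eE -E.
  + have K1 x y : x \in K -> y \in K -> x = y.
      rewrite !memK -nm => /andP[h3 h4] /andP[h5 h6]; apply/le_anti; apply/andP.
      by split; rewrite -lee_fin; [apply: le_trans h5 | apply: le_trans h3].
    split; last exact: Or31.
    move=> E _; have nE : pt A n = p%:E by apply/le_anti; rewrite h1 nm h2.
    have en : ~~ evenz n by rewrite -eE -E.
    split=> x y xK; rewrite (K1 x p) //; first by move=> /(source_max hn nE en) ->.
    by move=> yK; exists p => //; rewrite (K1 y p) //; split; exact: qb_refl.
- have F : poset_ideal A (evenz n) K.
    apply: initial_ideal => [x|x y|x]; rewrite ?memK.
    + by move=> /andP[h3 h4]; split=> //; rewrite h3 (le_trans (ltW h4)).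
    + move=> /andP[h3 h4] [_ _ /andP[h5 h6]] xy; rewrite h5 /=.
      by apply: le_lt_trans h4; rewrite lee_fin.
    + by move=> /andP[h3 h4]; apply: lt_le_trans lh.
  split; last by apply: Or33; exists (evenz n).
  by move=> E _; move: F; rewrite -[evenz n]negbK -eE -E.
- have F : poset_ideal A (~~ evenz m) K.
    apply: final_ideal => [x|x y|x]; rewrite ?memK.
    + by move=> /andP[h3 h4]; split=> //; rewrite h4 (le_trans lh) ?ltW.
    + move=> /andP[h3 h4] [_ _ /andP[h5 h6]] xy; rewrite h6 andbT.
      by apply: (lt_le_trans h3); rewrite lee_fin.
    + by move=> /andP[h3 h4]; apply: le_lt_trans h3.
  split; last by apply: Or33; exists (~~ evenz m).
  by move=> _ E2; move: F; rewrite -e2E; case: (e2) E2.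
Qed.

End Invalid.

(** * Almost split sequences *)

Section Classification.
Variables (k : fieldType) (R : realType) (A : contA R).
Implicit Types (I J K U E W : interval R) (t : ses k A).

Lemma in_rep_ends K : Defs.nonempty K -> in_rep (M k A K) ->
  exists c e lo hi c2 e2 lo2 hi2, [/\ cell A e lo hi, cell A e2 lo2 hi2 &
    K = Interval (lend c lo hi) (rend c2 lo2 hi2)].
Proof.
move=> K0 /in_rep_itvP K_fin.
have [c [e [lo [hi [hc KE1]]]]] := cell_left_end K0 K_fin.
have [c2 [e2 [lo2 [hi2 [hc2 KE2]]]]] := cell_right_end K0 K_fin.
exists c, e, lo, hi, c2, e2, lo2, hi2; split=> //.
by rewrite KE2; congr Interval; rewrite KE1.
Qed.

Lemma AR_left_almost t K (th : fam (M k A K) (ses_N t)) : AR_seq t -> is_iso th ->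
  left_almost (fam_comp (ses_f t) th).
Proof.
move=> [_ _ _ ARl _] thi J J_rep [x xK xJ] KJ nKJ.
have [thm [th' [th'm th'K]]] := thi.
have [||||h [hm hE]] := ARl (M k A J) (fam_comp (can K J) th').
- by apply: indecomposable_M => //; exists x.
- move=> JN; apply: nKJ; apply: (@iso_M_mem k R A).
  by apply: iso_trans JN _; apply: iso_sym; exists th.
- by apply: mor_comp => //; exact: can_mor.
- exists x, (th x (const_mx 1)); rewrite comp_lfunE (th'K x).1 can_one //.
  exact: M_neq0.
by exists h; split=> // y v; rewrite comp_lfunE hE comp_lfunE (th'K y).1.
Qed.

Lemma AR_start t K : AR_seq t -> Defs.nonempty K -> in_rep (M k A K) ->
  iso (M k A K) (ses_N t) -> exists E1 E2 W, cell_square A K E1 E2 W.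
Proof.
move=> ARt K0 K_rep [th thi]; have fl := AR_left_almost ARt thi.
have [[N_rep E_rep M_rep [fm gm fmono _ _]] [nsec _] _ _ _] := ARt.
have [thm [th' [th'm th'K]]] := thi.
have [f [f_mor {}fl f_nsec f_mono]] : exists f : fam (M k A K) (ses_E t),
    [/\ is_mor f, left_almost f, ~ is_section f & is_mono f].
  exists (fam_comp (ses_f t) th); split=> //; first exact: mor_comp.
    move=> [r [rm rf]]; apply: nsec; exists (fam_comp th r); split; first exact: mor_comp.
    move=> x v; rewrite comp_lfunE -[v](th'K x).2; have := rf x (th' x v).
    by rewrite comp_lfunE => ->.
  move=> x v w; rewrite !comp_lfunE => /fmono; exact: (iso_mono thi).
have [c [e [lo [hi [c2 [e2 [lo2 [hi2 [hc hc2 KE]]]]]]]]] := in_rep_ends K0 K_rep.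
have ce : c = e.
  apply/eqP/negPn/negP => ce; apply: f_nsec.
  have {}ce : c = ~~ e by move: ce; case: (c); case: (e).
  move: K0 K_rep f f_mor fl {f_mono thi thm th' th'm th'K th}; rewrite KE ce.
  move=> K0 K_rep f f_mor fl.
  exact: (start_left hc K0 K_rep E_rep f_mor fl).
have ce2 : c2 = ~~ e2.
  apply/eqP/negPn/negP => ce'; apply: f_nsec.
  have {}ce' : c2 = e2 by move: ce'; case: (c2); case: (e2).
  move: K0 K_rep f f_mor fl {f_mono thi thm th' th'm th'K th}; rewrite KE ce'.
  move=> K0 K_rep f f_mor fl.
  exact: (start_right hc2 K0 K_rep E_rep f_mor fl).
have [lh|hl] := leP lo2 hi; last first.
  exists (Interval (lend e lo hi) (rend e2 lo2 hi2)),
    (Interval (lend (~~ e) lo hi) (rend (~~ e2) lo2 hi2)),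
    (Interval (lend (~~ e) lo hi) (rend e2 lo2 hi2)), e, lo, hi, e2, lo2, hi2.
  by split=> //; split=> //; rewrite KE ce ce2.
(* Overlapping cells with these ends make M_K injective, so the monomorphism out of it splits. *)
case: f_nsec; have K0' := K0; rewrite KE in K0'.
have [/(_ ce ce2) Ki _] := invalid_cells hc hc2 K0' lh.
rewrite -KE in Ki; have [_ inj] := ideal_injective K_rep K0 Ki.
have [h [hm hE]] := inj (M k A K) (ses_E t) K_rep E_rep f (fam_id _) f_mor f_mono
  (@mor_id _ _ _ _).
by exists h; split=> // x v; rewrite hE id_lfunE.
Qed.

End Classification.

(** * Morphisms of short exact sequences *)

Section SequenceMaps.
Variables (k : fieldType) (R : realType) (A : contA R).

Definition exact_at (X Y Z : rep k A) (f : fam X Y) (g : fam Y Z) :=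
  forall x y, g x y = 0 <-> exists n, y = f x n.

Lemma short_exact_at (t : ses k A) : short_exact t -> exact_at (ses_f t) (ses_g t).
Proof.
move=> [_ _ _ _ ex] x y; split=> [gy|[n ->]].
  have : y \in limg (ses_f t x) by rewrite ex memv_ker gy.
  by case/memv_imgP => n _ ->; exists n.
by apply/eqP; rewrite -memv_ker -ex memv_img ?memvf.
Qed.

Variables (N E Z E' Z' : rep k A) (f : fam N E) (g : fam E Z)
  (f' : fam N E') (g' : fam E' Z') (u : fam E E').
Hypotheses (gm : is_mor g) (f'm : is_mor f') (g'm : is_mor g') (um : is_mor u).
Hypotheses (f'i : is_mono f') (ge : is_epi g) (g'e : is_epi g').
Hypotheses (ex : exact_at f g) (ex' : exact_at f' g').
Hypothesis uf : forall x v, u x (f x v) = f' x v.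

(** Preimages under g are taken by its generalized inverse; two of them differ by an element of the
    image of f, which the composite of u and g' kills. *)
Lemma cokernel_map : exists w : fam Z Z',
  is_mor w /\ forall x v, w x (g x v) = g' x (u x v).
Proof.
pose w : fam Z Z' := fun x => (g' x \o (u x \o (g x)^-1))%VF.
have wE x v : w x (g x v) = g' x (u x v).
  rewrite !comp_lfunE; apply/eqP; rewrite -subr_eq0 -!linearB /=; apply/eqP.
  have [|n ->] := (ex (x := x) (((g x)^-1)%VF (g x v) - v)).1.
    by rewrite linearB /= limg_lfunVK ?subrr // memv_img ?memvf.
  by rewrite uf; apply/ex'; exists n.
exists w; split=> // x y yx v; have [v' <-] := ge v.
by rewrite -gm // !wE um // g'm.
Qed.

Variable w : fam Z Z'.
Hypothesis wg : forall x v, w x (g x v) = g' x (u x v).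

(** The difference of u and the composite of g with the lift takes values in the kernel of g', that
    is in N, and restricts to f' on N; this is a retraction of f. *)
Lemma lift_section (w' : fam Z E') : is_mor w' ->
  (forall x v, g' x (w' x v) = w x v) -> is_section f.
Proof.
move=> w'm w'E.
pose d : fam E E' := fam_add u (fam_scale (-1) (fam_comp w' g)).
have dm : is_mor d by apply: mor_add => //; apply: mor_scale; exact: mor_comp.
have dE x v : d x v = u x v - w' x (g x v).
  by rewrite add_lfunE scale_lfunE comp_lfunE scaleN1r.
pose r : fam E N := fun x => ((f' x)^-1 \o d x)%VF.
have f'r x v : f' x (r x v) = d x v.
  have [|n dn] := (ex' (d x v)).1; first by rewrite dE linearB /= w'E wg subrr.
  by rewrite comp_lfunE limg_lfunVK // dn memv_img ?memvf.
exists r; split=> [x y yx v|x v]; apply: f'i.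
  by rewrite f'r dm // f'm // f'r.
rewrite f'r dE uf (_ : g x (f x v) = 0) ?linear0 ?addr0 //.
by apply: (ex (f x v)).2; exists v.
Qed.

Lemma five_lemma : is_mono w -> is_epi w -> is_iso u.
Proof.
move=> wi we; apply: bij_iso => // x.
  have ker0 v : u x v = 0 -> v = 0.
    move=> uv; have [|n vn] := (ex v).1.
      by apply: (wi x); rewrite wg uv !linear0.
    rewrite vn (_ : n = 0) ?linear0 //; apply: (f'i (x := x)).
    by rewrite -uf -vn uv linear0.
  move=> v1 v2 uv; apply/eqP; rewrite -subr_eq0; apply/eqP; apply: ker0.
  by rewrite linearB /= uv subrr.
move=> e'; have [z wz] := we x (g' x e'); have [e ez] := ge z.
have [|n en] := (ex' (e' - u x e)).1.
  by rewrite linearB /= -wg ez wz subrr.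
by exists (e + f x n); rewrite linearD /= uf -en addrC subrK.
Qed.

End SequenceMaps.

(** * Comparison of almost split sequences with the same first term *)

Section Uniqueness.
Variables (k : fieldType) (R : realType) (A : contA R).
Implicit Types (I J K U E W : interval R) (t : ses k A).

Lemma mor_bij_scalar (X : rep k A) W (w : fam X (M k A W)) : is_mor w ->
  iso X (M k A W) -> nontrivial w -> is_mono w /\ is_epi w.
Proof.
move=> wm [s [sm [s' [s'm ss']]]] [x0 [v0 wv0]].
have [c [cE _]] := mor_scalar (mor_comp wm s'm).
have wE x v : w x v = c *: s x v.
  by have := cE x (s x v); rewrite comp_lfunE (ss' x).1 can_id.
have c0 : c != 0 by apply/eqP => c0; apply: wv0; rewrite wE c0 scale0r.
split=> [x v v'|x v].
  by rewrite !wE => /(scalerI c0); exact: can_inj (ss' x).1 _ _.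
by exists (c^-1 *: s' x v); rewrite wE linearZ /= (ss' x).2 scalerA divff ?scale1r.
Qed.

(** Left almost splitness of the given sequence yields its map u to the square, with components into
    M_E1 and M_E2. The induced map w of last terms cannot lift, since f does not split; so w is
    nonzero, and right almost splitness of the square forces its source to be M_W. A nonzero
    endomorphism of M_W is invertible. *)
Lemma AR_unique t U E1 E2 W : AR_seq t -> cell_square A U E1 E2 W ->
  iso (M k A U) (ses_N t) ->
  iso (ses_E t) (rsum (M k A E1) (M k A E2)) /\ iso (ses_M t) (M k A W).
Proof.
move=> ARt sqU [th thi]; have fl := AR_left_almost ARt thi.
have [[D1 [D2 sq]] [p [pU pE1 pE2 pW]] [_ E1_rep E2_rep _]] := cell_squareP k sqU.
have [UE2 _ UE1 _ _] := sq.
have [[_ _ _ se] [nsec _] [_ M_indec] _ _] := ARt.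
have [[_ _ _ se'] _ _ _ ARr'] := cell_square_AR k sqU.
have [|||phi1 [phi1m phi1E]] := fl E1 E1_rep.
- by exists p.
- exact: end_move_hom UE1.
- by move=> H; apply: (end_move_neq UE1) => x; rewrite H.
have [|||phi2 [phi2m phi2E]] := fl E2 E2_rep.
- by exists p.
- exact: end_move_hom UE2.
- by move=> H; apply: (end_move_neq UE2) => x; rewrite H.
have [thm [th' [th'm th'K]]] := thi.
set f := fam_comp (ses_f t) th in fl phi1E phi2E.
have [fm gm fi ge _] := se; have ex0 := short_exact_at se.
have [f'm g'm f'i g'e _] := se'; have ex' := short_exact_at se'.
have ex : exact_at f (ses_g t).
  move=> x y; split=> [/ex0[n ->]|[n ->]].
    by exists (th' x n); rewrite comp_lfunE (th'K x).2.
  by apply/ex0; exists (th x n); rewrite comp_lfunE.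
pose u := fam_pair phi1 phi2.
have um : is_mor u by exact: mor_pair.
have uf x v : u x (f x v) = ses_f (itv_ses k A U E1 E2 W) x v.
  by rewrite square_fE !fam_pairE phi1E phi2E.
have [w [wm wg]] := cokernel_map gm g'm um ge ex ex' uf.
have f_nsec : ~ is_section f.
  move=> [r [rm rf]]; apply: nsec; exists (fam_comp th r); split; first exact: mor_comp.
  move=> x v; rewrite comp_lfunE -[v](th'K x).2; have := rf x (th' x v).
  by rewrite comp_lfunE => ->.
have nolift (w' : fam _ _) : is_mor w' -> (forall x v, ses_g _ x (w' x v) = w x v) -> False.
  by move=> w'm w'E; apply: f_nsec; exact: (lift_section gm f'm um f'i ex ex' uf wg w'm w'E).
(* A zero map would lift through zero. *)
have w_nt : nontrivial w.
  apply: contrapT => wt; apply: (nolift (fam_zero _ _)); first exact: mor_zero.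
  move=> x v; rewrite zero_lfunE linear0; apply: contrapT => wv.
  by apply: wt; exists x, v => E; apply: wv.
have wiso : iso (ses_M t) (M k A W).
  apply: contrapT => nW; have [w' [w'm w'E]] := ARr' _ w M_indec nW wm w_nt.
  exact: nolift w'm w'E.
split=> //; have [wi we] := mor_bij_scalar wm wiso w_nt.
by exists u; exact: (five_lemma um f'i ge ex ex' uf wg wi we).
Qed.

End Uniqueness.

(** * Cells determine the sequence *)

Section Conclusion.
Variables (k : fieldType) (R : realType) (A : contA R).
Implicit Types (I J K U E W : interval R) (t : ses k A) (lo hi : \bar R) (e c : bool).

(** Point cells lie strictly inside segments, so they share no end with a segment cell. *)
Lemma cell_uniq e lo hi e' lo' hi' : cell A e lo hi -> cell A e' lo' hi' ->
  lo = lo' \/ hi = hi' -> [/\ e = e', lo = lo' & hi = hi'].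
Proof.
move=> hc hc'.
case: (cell_inv hc) => [[n [a [hn hn1 an -> [-> ->]]]]|[n [hn hn1 -> -> ->]]];
case: (cell_inv hc') => [[m [b [hm hm1 bm -> [-> ->]]]]|[m [hm hm1 -> -> ->]]].
- move=> ab; have {ab}ab : a = b by case: ab => -[].
  have -> : n = m; last by rewrite ab.
  apply: (inseg_open hm hm1 bm); rewrite -ab; case/andP: an => na an.
  by split=> //; rewrite !ltW.
- by case=> E; [case: (@not_strictly_between _ A n m) | case: (@not_strictly_between _ A n (m + 1))];
    rewrite // -E.
- by case=> E; [case: (@not_strictly_between _ A m n) | case: (@not_strictly_between _ A m (n + 1))];
    rewrite // E.
- move=> E; suff -> : n = m by [].
  by case: E => [/(pt_inj hn hm)//|/(pt_inj hn1 hm1)/addIr].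
Qed.

(** At infinity [lbd] forgets the bracket, but [lo] is never +oo and [hi] never -oo, so the sign of
    infinity still tells [c]. *)
Lemma lend_inj c e lo hi c' e' lo' hi' : cell A e lo hi -> cell A e' lo' hi' ->
  lend c lo hi = lend c' lo' hi' -> [/\ c = c', e = e', lo = lo' & hi = hi'].
Proof.
move=> hc hc' E; have [_ [h l]] := cell_lt hc; have [_ [h' l']] := cell_lt hc'.
suff [-> E'] : c = c' /\ (lo = lo' \/ hi = hi') by have [-> -> ->] := cell_uniq hc hc' E'.
case: c c' E => -[]; rewrite /lend => E.
- by split=> //; left; case: lo lo' l l' E {hc hc'} => [r| |] [s| |] // _ _ [->].
- by exfalso; case: lo hi' l h' E {hc hc'} => [r| |] [s| |].
- by exfalso; case: hi lo' h l' E {hc hc'} => [r| |] [s| |].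
- by split=> //; right; case: hi hi' h h' E {hc hc'} => [r| |] [s| |] // _ _ [->].
Qed.

Lemma rend_inj c e lo hi c' e' lo' hi' : cell A e lo hi -> cell A e' lo' hi' ->
  rend c lo hi = rend c' lo' hi' -> [/\ c = c', e = e', lo = lo' & hi = hi'].
Proof.
move=> hc hc' E; have [_ [h l]] := cell_lt hc; have [_ [h' l']] := cell_lt hc'.
suff [-> E'] : c = c' /\ (lo = lo' \/ hi = hi') by have [-> -> ->] := cell_uniq hc hc' E'.
case: c c' E => -[]; rewrite /rend => E.
- by split=> //; right; case: hi hi' h h' E {hc hc'} => [r| |] [s| |] // _ _ [->].
- by exfalso; case: hi lo' h l' E {hc hc'} => [r| |] [s| |].
- by exfalso; case: lo hi' l h' E {hc hc'} => [r| |] [s| |].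
- by split=> //; left; case: lo lo' l l' E {hc hc'} => [r| |] [s| |] // _ _ [->].
Qed.

(** The left end of any one of the four intervals determines the left cell and its right end the
    right cell, hence all four intervals and the sequence itself. *)
Lemma cell_square_uniq I U E1 E2 W U' E1' E2' W' :
  cell_square A U E1 E2 W -> cell_square A U' E1' E2' W' ->
  [\/ I = U, I = E1, I = E2 | I = W] -> [\/ I = U', I = E1', I = E2' | I = W'] ->
  itv_ses k A U E1 E2 W = itv_ses k A U' E1' E2' W'.
Proof.
move=> [e [lo [hi [e2 [lo2 [hi2 [hc hc2 _ [-> -> -> ->]]]]]]]].
move=> [e' [lo' [hi' [e2' [lo2' [hi2' [hc' hc2' _ [-> -> -> ->]]]]]]]].
move=> IE IE'.
have [c [c2 {}IE]] : exists c c2, I = Interval (lend c lo hi) (rend c2 lo2 hi2).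
  by case: IE => ->; do 2?[eexists].
have [c' [c2' {}IE']] : exists c c2, I = Interval (lend c lo' hi') (rend c2 lo2' hi2').
  by case: IE' => ->; do 2?[eexists].
have [/(lend_inj hc hc')[_ -> -> ->] /(rend_inj hc2 hc2')[_ -> -> ->]] :
  lend c lo hi = lend c' lo' hi' /\ rend c2 lo2 hi2 = rend c2' lo2' hi2'.
  by move: IE'; rewrite IE => -[].
by [].
Qed.

Lemma contains_mem t I U E1 E2 W : Defs.nonempty I ->
  iso (M k A U) (ses_N t) -> iso (ses_E t) (rsum (M k A E1) (M k A E2)) ->
  iso (ses_M t) (M k A W) -> contains t I -> [\/ I = U, I = E1, I = E2 | I = W].
Proof.
move=> I0 Ut tE tW; have [p pI] := I0; case=> [It|It|[J [_ tJ]]].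
- by apply/Or41/(set_itv_inj pI)/(@iso_M_mem k _ A)/(iso_trans It)/iso_sym.
- by apply/Or44/(set_itv_inj pI)/(@iso_M_mem k _ A)/(iso_trans It).
case: (rsum_iso_mem I0 (iso_trans (iso_sym tE) tJ)) => /(set_itv_inj pI).
  exact: Or42.
exact: Or43.
Qed.

Lemma AR_conditions_cells c e lo hi c2 e2 lo2 hi2
    (K := Interval (lend c lo hi) (rend c2 lo2 hi2)) :
  cell A e lo hi -> cell A e2 lo2 hi2 -> indecomposable (M k A K) ->
  Defs.nonempty K -> AR_conditions k A K <-> (hi < lo2)%E.
Proof.
move=> hc hc2 [K_rep _ _] K0; split; last exact: (@valid_conditions k R A c e c2 e2).
move=> [nP nI nS]; rewrite ltNge; apply/negP => lh.
have [p pK] := K0; have [_ [K1|Ka|[b Kb]]] := invalid_cells hc hc2 K0 lh.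
- by apply: nS; left; apply: (point_simple K_rep pK) => y yK; exact: K1.
- by apply: nS; right.
- by case: b Kb => Kb; [apply: nP; exact: ideal_projective | apply: nI; exact: ideal_injective].
Qed.

End Conclusion.

Theorem theorem1 (k : fieldType) (R : realType) (A : contA R) (I : interval R)
    (indecI : indecomposable (M k A I)) :
  (AR_conditions k A I ->
     exists! t : ses k A, [/\ of_16_types t, AR_seq t & contains t I]) /\
  (~ AR_conditions k A I ->
     forall t : ses k A, AR_seq t -> ~ contains t I).
Proof.
have [I_rep In0 _] := indecI.
have I0 : Defs.nonempty I.
  apply: contrapT => nI; apply: In0 => x v; apply: M_zero => xI.
  by apply: nI; exists x.
have [c [e [lo [hi [c2 [e2 [lo2 [hi2 [hc hc2 IE]]]]]]]]] := in_rep_ends I0 I_rep.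
have condE : AR_conditions k A I <-> (hi < lo2)%E.
  by rewrite IE in indecI I0 *; exact: AR_conditions_cells hc hc2 indecI I0.
split=> [/condE hl|nc t ARt tI].
  pose U := Interval (lend e lo hi) (rend (~~ e2) lo2 hi2).
  pose E1 := Interval (lend e lo hi) (rend e2 lo2 hi2).
  pose E2 := Interval (lend (~~ e) lo hi) (rend (~~ e2) lo2 hi2).
  pose W := Interval (lend (~~ e) lo hi) (rend e2 lo2 hi2).
  have sq : cell_square A U E1 E2 W by exists e, lo, hi, e2, lo2, hi2.
  have [_ [p [_ pE1 pE2 _]] _] := cell_squareP k sq.
  have Imem : [\/ I = U, I = E1, I = E2 | I = W].
    (* On each side the end of I is either the one of U or the toggled one; the four combinations
       are the four intervals. *)
    rewrite IE /U /E1 /E2 /W; case: (c) (c2) (e) (e2) => -[] [] [];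
      by [exact: Or41 | exact: Or42 | exact: Or43 | exact: Or44].
  exists (itv_ses k A U E1 E2 W); split.
    split; first by exists U, E1, E2, W; split=> //; apply/ARtype_cells.
      exact: cell_square_AR.
    case: Imem => ->; [apply: Or31|apply: Or33; exists E2|apply: Or33; exists E1|apply: Or32].
    - exact: iso_refl.
    - by split; [exists p | exact: iso_refl].
    - by split; [exists p | exact: iso_rsumC].
    - exact: iso_refl.
  move=> _ [[U' [E1' [E2' [W' [/ARtype_cells sq' ->]]]]] _ tI].
  apply: (cell_square_uniq k sq sq' Imem).
  by apply: contains_mem tI => //; exact: iso_refl.
have [_ _ [N_indec _] _ _] := ARt.
have [K [K0 K_rep KN]] := indec_itv N_indec.
have [E1 [E2 [W sq]]] := AR_start ARt K0 K_rep KN.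
have [tE tW] := AR_unique ARt sq KN.
have Imem := contains_mem I0 KN tE tW tI.
(* Being one of the four intervals of a square, I has the two disjoint cells of that square, which
   already implies the three conditions. *)
apply: nc; case: sq => [d [l [h [d2 [l2 [h2 [dc dc2 dl [KE E1E E2E WE]]]]]]]].
have [b [b2 ->]] : exists b b2, I = Interval (lend b l h) (rend b2 l2 h2).
  by case: Imem => ->; rewrite ?KE ?E1E ?E2E ?WE; do 2?[eexists].
exact: valid_conditions dc dc2 dl.
Qed.
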